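(* Let $y\in\mathbb R\setminus\{0\}$ be such that $w_0=w_0(y)$, which is the (unique) real root of $$\int_0^1\frac{dt}{w-\widehat f(t)}=y,$$ is outside the interval $\left[\frac{\lambda_N(N)}N,\frac{\lambda_1(N)}N+1\right]$ for all large enough $N$. Suppose that for a function $f(t)$ $$\lim_{N\to\infty}\mathcal Q(w;\lambda(N),f)=g(w)$$ uniformly on an open set $\mathcal M$ in $\mathbb C$ containing $w_0$. Assume also that $g(w_0)\neq0$ and $\mathcal F''(w_0;f)\ne0$. Then as $N\to\infty$ $$S_{\lambda(N)}(e^y;N,1)=\frac{g(w_0)}{\sqrt{-\mathcal F''(w_0;f)}}\cdot\frac{\exp\bigl(N(yw_0-\mathcal F(w_0;f))\bigr)}{e^N(e^y-1)^{N-1}}\cdot\bigl(1+o(1)\bigr).$$ The remainder $o(1)$ is uniform over $y$ belonging to compact subsets of $\mathbb R\setminus\{0\}$ and such that $w_0=w_0(y)\in\mathcal M$.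
   Context: A signature of size $N$ is an $N$-tuple of integers $\lambda_1\ge\cdots\ge\lambda_N$; $\lambda(N)$, $N=1,2,\dots$, is a sequence of signatures with $\lambda(N)$ of size $N$, and $f$ is a weakly decreasing function on $[0,1]$. The Schur function is the symmetric Laurent polynomial $s_\lambda(u_1,\dots,u_N)=\det[u_i^{\lambda_j+N-j}]_{i,j=1}^N/\prod_{i<j}(u_i-u_j)$, and $S_\lambda(x;N,1)=s_\lambda(x,1^{N-1})/s_\lambda(1^N)$, where $1^m$ stands for $m$ arguments equal to $1$. Notation: $\widehat f(t)=f(t)+1-t$, $$\mathcal F(w;f)=\int_0^1\ln\bigl(w-\widehat f(t)\bigr)\,dt,\quad w\in\mathbb C\setminus\{\widehat f(t): t\in[0,1]\},$$ $$\mu_j(N)=\lambda_j(N)+N-j,\qquad \mathcal Q(w;\lambda(N),f)=\frac{\exp\bigl(N\mathcal F(w;f)\bigr)}{\prod_{j=1}^N\bigl(w-\frac{\mu_j(N)}N\bigr)}.$$ The branch of the logarithm is chosen consistently in all the formulas; derivatives of $\mathcal F$ are with respect to $w$. The root $w_0(y)$ is the one satisfying $w_0(y)>\widehat f(0)$ if $y>0$ and $w_0(y)<\widehat f(1)$ if $y<0$.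
   Formalization: The square root of −F''(w_0) is taken with the sign of y: with the positive root the formula fails for y<0 (λ=0, f=0 gives −1 instead of 1). Uniformity is over compact sets of y at all of whose points the hypotheses, including w_0(y)∈M and g(w_0)≠0, hold. *)

(* Defs.v *)
From HB Require Import structures.
From mathcomp Require Import all_boot all_order all_algebra.
From mathcomp Require Import complex.
From mathcomp Require Import all_classical all_reals all_analysis.
Set Implicit Arguments.
Unset Strict Implicit.
Unset Printing Implicit Defensive.

Import Order.TTheory GRing.Theory Num.Theory.
Import numFieldNormedType.Exports.
Local Open Scope classical_set_scope.
Local Open Scope complex_scope.
Local Open Scope ring_scope.

(* Entries are indexed from 0: the paper's lambda_j is tnth l (j - 1). *)
Definition is_signature (N : nat) (l : N.-tuple int) : Prop :=
  forall i j : 'I_N, (i <= j)%N -> tnth l j <= tnth l i.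

(* The exponent lambda_j + N - j. *)
Definition mu (N : nat) (l : N.-tuple int) (i : 'I_N) : int :=
  tnth l i + N%:Z - (i.+1)%:Z.

(* s is given, at points with nonzero coordinates, by a finite sum of
   (coefficient, exponent vector) monomials. *)
Definition is_laurent (K : fieldType) (N : nat) (s : ('I_N -> K) -> K) : Prop :=
  exists c : seq (K * ('I_N -> int)),
    forall u : 'I_N -> K, (forall i, u i != 0) ->
      s u = \sum_(m <- c) m.1 * \prod_(i < N) u i ^ m.2 i.

(* The quotient det / Vandermonde is taken among Laurent polynomials, so that
   it makes sense at points with repeated coordinates. Over an infinite field
   it determines s at all points with nonzero coordinates. *)
Definition is_schur (K : fieldType) (N : nat) (l : N.-tuple int)
    (s : ('I_N -> K) -> K) : Prop :=
  is_laurent s /\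
  forall u : 'I_N -> K, (forall i, u i != 0) ->
    s u * (\prod_(i < N) \prod_(j < N | (i < j)%N) (u i - u j)) =
    \det (\matrix_(i < N, j < N) u i ^ mu l j).

Definition schur (K : fieldType) (N : nat) (l : N.-tuple int) :
    ('I_N -> K) -> K :=
  xget (fun=> 0) [set s | is_schur l s].

Definition schur_normalized (K : fieldType) (N : nat) (l : N.-tuple int)
    (x : K) : K :=
  schur l (fun i : 'I_N => if val i == 0%N then x else 1) / schur l (fun=> 1).

HB.instance Definition _ (R : realType) := PseudoPointedMetric.copy R[i] R[i]^o.
HB.instance Definition _ (R : realType) := NormedModule.copy R[i] R[i]^o.

Section Complex.
Variable R : realType.

Definition expc (z : R[i]) : R[i] :=
  (expR (complex.Re z))%:C * (cos (complex.Im z) +i* sin (complex.Im z)).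

(* Values in ]-pi, pi]; the value at 0 is irrelevant. *)
Definition argc (z : R[i]) : R :=
  let a := acos (complex.Re z / Normc.normc z) in
  if 0 <= complex.Im z then a else - a.

Definition lnc (z : R[i]) : R[i] := ln (Normc.normc z) +i* argc z.

Definition integral01 (h : R -> R[i]) : R[i] :=
  (\int[lebesgue_measure]_(t in `[0, 1]) complex.Re (h t)) +i*
  (\int[lebesgue_measure]_(t in `[0, 1]) complex.Im (h t)).

Definition fhat (f : R -> R) (t : R) : R := f t + 1 - t.

(* ln (w - fhat t). The principal branch is used, except that for
   Re w < fhat 1 = min fhat the cut is put on the positive half-line
   (argument in ]0, 2pi]). Then calF is holomorphic near every real point
   outside [fhat 1, fhat 0], on both sides, and expc (N * calF) is the same as
   for the principal branch, since the two differ by multiples of 2 i pi that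
   do not depend on t. *)
Definition ln_diff (f : R -> R) (w : R[i]) (t : R) : R[i] :=
  if complex.Re w < fhat f 1 then lnc ((fhat f t)%:C - w) + pi *i
  else lnc (w - (fhat f t)%:C).

Definition calF (f : R -> R) (w : R[i]) : R[i] := integral01 (ln_diff f w).

Definition calF'' (f : R -> R) (w : R[i]) : R[i] :=
  ((calF f)^`(2))%classic w.

Definition calQ (f : R -> R) (N : nat) (l : N.-tuple int) (w : R[i]) : R[i] :=
  expc (N%:R * calF f w) /
  \prod_(j < N) (w - ((mu l j)%:~R / N%:R : R)%:C).

Definition is_w0 (f : R -> R) (y w0 : R) : Prop :=
  [/\ (0 < y -> fhat f 0 < w0), (y < 0 -> w0 < fhat f 1) &
      \int[lebesgue_measure]_(t in `[0, 1]) (w0 - fhat f t)^-1 = y].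

(* -calF''(w0) is the integral of (w0 - fhat t)^-2, hence positive, and
   sqrtC of it is positive. With the branch of the logarithm used in calF,
   w0 - fhat t has argument pi when y < 0, so (w0 - fhat t)^-2 has argument
   -2 pi and the consistent square root is the negative one.
   (Check: lambda = 0, f = 0 gives S = 1, g(w0) = exp (-y/2) and
   - calF''(w0) = (exp y - 1)^2 / exp y; the root has to be
   (exp y - 1) / exp (y/2), of the sign of y.) *)
Definition sqrt_opp_calF'' (f : R -> R) (y w0 : R) : R[i] :=
  (Num.sg y)%:C * sqrtC (- calF'' f w0%:C).

Definition main_term (f : R -> R) (g : R[i] -> R[i]) (N : nat) (y w0 : R) :
    R[i] :=
  g w0%:C / sqrt_opp_calF'' f y w0 *
  (expc (N%:R * ((y * w0)%:C - calF f w0%:C)) /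
   (expR N%:R * (expR y - 1) ^+ N.-1)%:C).

Definition admissible (lambda : forall N : nat, N.-tuple int) (f : R -> R)
    (M : set R[i]) (g : R[i] -> R[i]) (y w0 : R) : Prop :=
  [/\ y != 0 /\ is_w0 f y w0,
      \forall N \near \oo,
        w0 \notin `[(nth 0 (lambda N) N.-1)%:~R / N%:R,
                    (nth 0 (lambda N) 0)%:~R / N%:R + 1],
      M w0%:C,
      g w0%:C != 0 &
      calF'' f w0%:C != 0].

End Complex.

(* Main.v *)
Require Import Defs.
From HB Require Import structures.
From mathcomp Require Import all_boot all_order all_algebra.
From mathcomp Require Import perm complex.
From mathcomp Require Import all_classical all_reals all_analysis.
From mathcomp Require Import measurable_realfun ring lra.
From mathcomp Require Import zify.
Set Implicit Arguments.
Unset Strict Implicit.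
Unset Printing Implicit Defensive.

Import Order.TTheory GRing.Theory Num.Theory.
Import numFieldNormedType.Exports.
Local Open Scope classical_set_scope.
Local Open Scope complex_scope.
Local Open Scope ring_scope.

(* For distinct c_j > 0 the density of a sum of independent exponential
   variables with means c_j is a divided difference of exponentials. With
   c_j = 1 / |N w0 - mu_j| its value at |y| is, up to explicit factors, the sum
   sum_j e^(y mu_j) / prod_{i <> j} (mu_j - mu_i), to which the quotient of
   determinants defining S_lambda(e^y; N, 1) reduces. This turns the asymptotics
   of S into a local limit theorem: the equation for w0 says that the mean of
   the sum is close to |y|, and - F''(w0) is the limit of N times its variance.

   The local limit theorem is proved by replacing two of the means by others
   with the same sum of squares, so that one of them becomes the root mean
   square; after at most N such steps the sum has a Gamma distribution, for
   which Stirling's formula applies, and each step costs O(1/N) because the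
   third derivative of the density is bounded.

   That the mean and variance are close enough to y and - F''(w0) follows from
   the convergence of Q on the real line near w0: N F(w) - sum_j ln |w - mu_j/N|
   is bounded there, and comparing its second order expansion at distance
   N^(-1/4) bounds its first two derivatives by o(N^(1/2)) and o(N). *)

(** The exact identity behind the proof is [schur_main_term]: S is the main term times Q(w0)/g(w0)
    times [tau], and [tau] compares the density at |y| with a Gamma density at its mean. The
    factorial coming from the N-1 equal arguments and the factor e^N of the main term combine into
    the Poisson weight of that Gamma density, so Stirling is needed only as a two-sided bound of
    order N^(-1/2), without its constant. The scales are: means O(1/N), density of order N^(1/2),
    first derivative O(N), third derivative O(N^2). A smoothing step costs N^(-3) N^2, and N of them
    O(1), which is small against N^(1/2). For the same reason the mean may miss |y| by o(N^(-1/2)).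
    The obstacle is that nothing is assumed on the individual mu_j/N. That they keep a distance from
    w0, uniformly in N and for all nearby roots, has to be extracted from the convergence of Q
    ([points_stable]). Nor is g assumed continuous: its size near w0 is read off from Q for one
    fixed N ([calQ_regular]). *)

Section RealDerivatives.
Variable R : realType.
Implicit Types (f g p q : R -> R) (x y t a b c : R).

(** * Derivatives of real functions and mean value bounds *)

Lemma is_derive1_eq f x a b : is_derive x 1 f a -> a = b -> is_derive x 1 f b.
Proof. by move=> df <-. Qed.

Lemma is_derive1_cst c x : is_derive x 1 (fun=> c) (0 : R).
Proof. exact: is_derive_cst. Qed.

Lemma is_derive1D f g x a b : is_derive x 1 f a -> is_derive x 1 g b ->
  is_derive x 1 (fun t => f t + g t) (a + b).
Proof. by move=> df dg; exact: is_deriveD. Qed.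

Lemma is_derive1N f x a : is_derive x 1 f a -> is_derive x 1 (fun t => - f t) (- a).
Proof. by move=> df; exact: is_deriveN. Qed.

Lemma is_derive1B f g x a b : is_derive x 1 f a -> is_derive x 1 g b ->
  is_derive x 1 (fun t => f t - g t) (a - b).
Proof. by move=> df dg; exact: is_deriveB. Qed.

Lemma is_derive1M f g x a b : is_derive x 1 f a -> is_derive x 1 g b ->
  is_derive x 1 (fun t => f t * g t) (a * g x + f x * b).
Proof.
move=> df dg; refine (@is_derive_eq _ _ _ _ _ _ _ _ (is_deriveM df dg) _).
by rewrite /GRing.scale/= addrC (mulrC a).
Qed.

Lemma is_derive1V f x a : f x != 0 -> is_derive x 1 f a ->
  is_derive x 1 (fun t => (f t)^-1) (- (f x) ^- 2 * a).
Proof. by move=> fx df; exact: is_deriveV. Qed.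

Lemma is_derive1Z k f x a : is_derive x 1 f a ->
  is_derive x 1 (fun t => k * f t) (k * a).
Proof. by move=> df; exact: is_deriveZ. Qed.

Lemma is_derive1_expRM k x :
  is_derive x 1 (fun t => expR (k * t)) (k * expR (k * x)).
Proof.
have dk : is_derive x 1 (fun t => k * t) k.
  by rewrite -{2}[k]mulr1; apply: is_derive1Z; exact: is_derive_id.
refine (@is_derive_eq _ _ _ _ _ _ _ _ (is_derive1_comp (f := expR) (is_derive_expR _) dk) _).
exact: mulrC.
Qed.

Lemma is_derive1X n x :
  is_derive x 1 (fun t => t ^+ n.+1) (n.+1%:R * x ^+ n).
Proof.
elim: n => [|n IHn].
  by rewrite expr0 mulr1; exact: is_derive_id.
have := is_derive1M (is_derive_id x (1 : R)) IHn; rewrite /= => H.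
under eq_fun do rewrite exprS.
apply: is_derive1_eq H _; rewrite [n.+2%:R]mulrSr exprS; ring.
Qed.

Lemma is_derive1_continuous f x a : is_derive x 1 f a -> {for x, continuous f}.
Proof.
by move=> df; apply/differentiable_continuous/derivable1_diffP; exact: ex_derive.
Qed.

Lemma ge0_is_derive1_homo f (df : R -> R) a b :
  (forall x, a <= x <= b -> is_derive x 1 f (df x)) ->
  (forall x, a <= x <= b -> 0 <= df x) -> a <= b -> f a <= f b.
Proof.
move=> dfE df0 ab.
have [||c cab fE] := @MVT_segment R f df a b ab.
- by move=> x; rewrite in_itv/= => /andP[ax xb]; apply: dfE; rewrite !ltW.
- apply: continuous_in_subspaceT => x; rewrite inE/= in_itv/= => xab.
  exact: is_derive1_continuous (dfE _ xab).
- rewrite -subr_ge0 fE mulr_ge0 ?subr_ge0//; apply: df0.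
  by move: cab; rewrite in_itv.
Qed.

Lemma le_is_derive1_norm f (df : R -> R) a b K :
  (forall x, a <= x <= b -> is_derive x 1 f (df x)) ->
  (forall x, a <= x <= b -> `|df x| <= K) -> a <= b ->
  `|f b - f a| <= K * (b - a).
Proof.
move=> dfE dfK ab.
have [||c cab ->] := @MVT_segment R f df a b ab.
- by move=> x; rewrite in_itv/= => /andP[ax xb]; apply: dfE; rewrite !ltW.
- apply: continuous_in_subspaceT => x; rewrite inE/= in_itv/= => xab.
  exact: is_derive1_continuous (dfE _ xab).
- rewrite normrM (ger0_norm (x := b - a)) ?subr_ge0//.
  by rewrite ler_wpM2r ?subr_ge0// dfK//; move: cab; rewrite in_itv.
Qed.

(** * The equation c q' = p - q *)

(** For [t >= 0] the solution is an average of [q 0] and of the past values of [p]. In terms of the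
    integrating factor: e^(t/c) (M - q) has derivative e^(t/c) (M - p) / c, which is nonnegative. *)
Lemma relax_le p q c M :
  0 < c -> (forall t, is_derive t 1 q ((p t - q t) / c)) ->
  (forall t, 0 <= t -> p t <= M) -> q 0 <= M ->
  forall t, 0 <= t -> q t <= M.
Proof.
move=> c0 dq pM q0 t t0.
have h (x : R) : is_derive x 1 (fun u => expR (c^-1 * u) * (M - q u))
    (expR (c^-1 * x) * ((M - p x) / c)).
  have := is_derive1M (is_derive1_expRM c^-1 x)
    (is_derive1B (is_derive1_cst M x) (dq x)).
  move/is_derive1_eq; apply; field; by rewrite gt_eqF.
have := @ge0_is_derive1_homo _ _ 0 t (fun x _ => h x).
rewrite mulr0 expR0 mul1r => /(_ _ t0) H.
have : 0 <= expR (c^-1 * t) * (M - q t).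
  apply: le_trans (H _); first by rewrite subr_ge0.
  move=> x /andP[x0 _].
  by rewrite mulr_ge0 ?expR_ge0// divr_ge0 ?subr_ge0 ?pM// ltW.
by rewrite pmulr_rge0 ?expR_gt0// subr_ge0.
Qed.

Lemma relax_norm p q c M :
  0 < c -> (forall t, is_derive t 1 q ((p t - q t) / c)) ->
  (forall t, 0 <= t -> `|p t| <= M) -> `|q 0| <= M ->
  forall t, 0 <= t -> `|q t| <= M.
Proof.
move=> c0 dq pM q0 t t0.
rewrite ler_norml; apply/andP; split; last first.
  apply: (relax_le c0 dq) => // [u u0|]; last exact: le_trans (ler_norm _) q0.
  exact: le_trans (ler_norm _) (pM u u0).
rewrite lerNl.
apply: (@relax_le (fun u => - p u) (fun u => - q u) c M c0) => //.
- move=> u; have := is_derive1N (dq u); move/is_derive1_eq; apply.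
  by rewrite -mulNr opprB opprK addrC.
- by move=> u u0; apply: le_trans (pM u u0); rewrite -normrN ler_norm.
- by apply: le_trans q0; rewrite -normrN ler_norm.
Qed.

Lemma relax_unique p q1 q2 c : c != 0 ->
  (forall t, is_derive t 1 q1 ((p t - q1 t) / c)) ->
  (forall t, is_derive t 1 q2 ((p t - q2 t) / c)) ->
  q1 0 = q2 0 -> q1 = q2.
Proof.
move=> c0 d1 d2 q0; apply/funext => t.
pose h u := expR (c^-1 * u) * (q1 u - q2 u).
have dh x : is_derive x 1 h 0.
  have := is_derive1M (is_derive1_expRM c^-1 x) (is_derive1B (d1 x) (d2 x)).
  move/is_derive1_eq; apply; by field.
have := is_derive_0_is_cst t 0 dh; rewrite /h q0 subrr mulr0 => /eqP.
by rewrite mulf_eq0 gt_eqF ?expR_gt0//= subr_eq0 => /eqP.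
Qed.

(** A class closed under multiplication by exponentials and under primitives, hence under solving c
    q' = p - q by variation of constants. The densities are built inside it, without integrals. *)
Inductive exp_poly : (R -> R) -> Prop :=
| ExpPolyMono k a b : exp_poly (fun t => b * (t ^+ k * expR (a * t)))
| ExpPolyD f g : exp_poly f -> exp_poly g -> exp_poly (fun t => f t + g t).

Lemma exp_poly_cst c : exp_poly (fun=> c).
Proof.
have := ExpPolyMono 0 0 c; congr exp_poly; apply/funext => t.
by rewrite mul0r expR0 expr0 !mulr1.
Qed.

Lemma exp_polyM f a b :
  exp_poly f -> exp_poly (fun t => b * expR (a * t) * f t).
Proof.
elim=> [k a' b'|g h _ IHg _ IHh].
  have := ExpPolyMono k (a + a') (b * b'); congr exp_poly; apply/funext => t.
  by rewrite mulrDl expRD; ring.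
have := ExpPolyD IHg IHh; congr exp_poly; apply/funext => t.
by rewrite mulrDr.
Qed.

Lemma exp_poly_primitive f : exp_poly f ->
  exists2 F, exp_poly F & forall t, is_derive t 1 F (f t).
Proof.
elim=> [k a b|g h _ [G eG dG] _ [H eH dH]]; last first.
  exists (fun t => G t + H t); first exact: ExpPolyD.
  by move=> t; exact: is_derive1D.
have [->|a0] := eqVneq a 0.
  exists (fun t => b / k.+1%:R * (t ^+ k.+1 * expR (0 * t))).
    exact: ExpPolyMono.
  move=> t; have := is_derive1Z (b / k.+1%:R)
    (is_derive1M (is_derive1X k t) (is_derive1_expRM 0 t)).
  move/is_derive1_eq; apply; rewrite mul0r expR0; field; by rewrite nat1r pnatr_eq0.
(* Integration by parts lowers the power of [t]. *)
elim: k b => [|k IH] b.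
  exists (fun t => b / a * (t ^+ 0 * expR (a * t))); first exact: ExpPolyMono.
  move=> t; have := is_derive1Z (b / a)
    (is_derive1M (is_derive1_cst 1 t) (is_derive1_expRM a t)).
  move/is_derive1_eq; apply; rewrite expr0; by field.
have [F eF dF] := IH (- (b * k.+1%:R / a)).
exists (fun t => b / a * (t ^+ k.+1 * expR (a * t)) + F t).
  by apply: ExpPolyD => //; exact: ExpPolyMono.
move=> t; have := is_derive1D (is_derive1Z (b / a)
    (is_derive1M (is_derive1X k t) (is_derive1_expRM a t))) (dF t).
move/is_derive1_eq; apply; rewrite exprS; by field.
Qed.

Lemma relax_exists p c b : c != 0 -> exp_poly p -> exists q,
  [/\ exp_poly q, q 0 = b & forall t, is_derive t 1 q ((p t - q t) / c)].
Proof.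
move=> c0 ep; have [F eF dF] := exp_poly_primitive (exp_polyM c^-1 c^-1 ep).
exists (fun t => 1 * expR (- c^-1 * t) * (F t + (b - F 0))); split.
- by apply/exp_polyM/ExpPolyD => //; exact: exp_poly_cst.
- by rewrite mulr0 expR0; ring.
- move=> t; have := is_derive1M (is_derive1_expRM (- c^-1) t)
    (is_derive1D (dF t) (is_derive1_cst (b - F 0) t)).
  rewrite (_ : (fun t0 => _) = (fun t => 1 * expR (- c^-1 * t) *
    (F t + (b - F 0)))); last by apply/funext => u; rewrite mul1r.
  move/is_derive1_eq; apply.
  have -> : expR (c^-1 * t) = (expR (- c^-1 * t))^-1 by rewrite mulNr expRN invrK.
  by field; rewrite c0 gt_eqF ?expR_gt0.
Qed.

(** Only the equation and the initial value are used afterwards; for [c != 0] they determine the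
    function, by [relax_unique]. *)
Definition relax c p b : R -> R := xget (fun=> 0) [set q |
  [/\ exp_poly q, q 0 = b & forall t, is_derive t 1 q ((p t - q t) / c)]].

Lemma relaxP c p b : c != 0 -> exp_poly p ->
  [/\ exp_poly (relax c p b), relax c p b 0 = b &
    forall t, is_derive t 1 (relax c p b) ((p t - relax c p b t) / c)].
Proof.
move=> c0 ep; rewrite /relax; case: xgetP => [q _ //|no].
by have [q /no] := relax_exists b c0 ep.
Qed.

End RealDerivatives.

(** * Densities of sums of independent exponential variables *)

Section Hypoexponential.
Variable R : realType.
Implicit Types (s : seq R) (c d t M : R) (k n : nat).

(* [hypo s k] is the [k]-th derivative of the density of a sum of independent
   exponential variables with means the elements of [s]; it is only meaningful
   on the half-line [0 <= t]. *)
Fixpoint hypo s k : R -> R :=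
  match s with
  | [::] => fun=> 0
  | c :: s' =>
    (fix F k := match k with
     | 0%N => relax c (hypo s' 0) (if s' is [::] then c^-1 else 0)
     | k'.+1 => fun t => (hypo s' k' t - F k' t) / c
     end) k
  end.

Lemma hypo_nil k t : hypo [::] k t = 0.
Proof. by []. Qed.

Lemma hypo_cons0 c s :
  hypo (c :: s) 0 = relax c (hypo s 0) (if s is [::] then c^-1 else 0).
Proof. by []. Qed.

Lemma hypo_consS c s k t :
  hypo (c :: s) k.+1 t = (hypo s k t - hypo (c :: s) k t) / c.
Proof. by []. Qed.

Arguments hypo : simpl never.

Definition positive s := all (fun c => 0 < c) s.

Lemma exp_poly_hypo s : positive s -> exp_poly (hypo s 0).
Proof.
elim: s => [_|c s IHs /andP[c0 /IHs es]]; first exact: exp_poly_cst.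
by rewrite hypo_cons0; have [] := relaxP (if s is [::] then c^-1 else 0)
  (lt0r_neq0 c0) es.
Qed.

Lemma is_derive_hypo s k t : positive s ->
  is_derive t 1 (hypo s k) (hypo s k.+1 t).
Proof.
elim: s k => [|c s IHs] k; first by move=> _; exact: is_derive1_cst.
move=> /= /andP[c0 s0]; elim: k => [|k IHk].
  by have [_ _] := relaxP (if s is [::] then c^-1 else 0) (lt0r_neq0 c0)
    (exp_poly_hypo s0).
have := is_derive1Z c^-1 (is_derive1B (IHs k s0) IHk).
under eq_fun do rewrite mulrC.
by move/is_derive1_eq; apply; rewrite mulrC.
Qed.

(** The empty sum is a point mass at 0, represented by the function 0. Its effect on the first
    density is the initial value [c^-1]. *)
Lemma hypo0 c s : positive (c :: s) ->
  hypo (c :: s) 0 0 = if s is [::] then c^-1 else 0.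
Proof.
by case/andP=> c0 s0; have [_] := relaxP (if s is [::] then c^-1 else 0)
  (lt0r_neq0 c0) (exp_poly_hypo s0).
Qed.

Lemma hypo_ode c s k t : positive (c :: s) ->
  is_derive t 1 (hypo (c :: s) k) ((hypo s k t - hypo (c :: s) k t) / c).
Proof. by move=> s0; rewrite -hypo_consS; exact: is_derive_hypo. Qed.

Lemma hypo_unique c s (q : R -> R) : positive (c :: s) ->
  (forall t, is_derive t 1 q ((hypo s 0 t - q t) / c)) ->
  q 0 = (if s is [::] then c^-1 else 0) -> hypo (c :: s) 0 = q.
Proof.
move=> s0 dq q0; apply: (relax_unique (c := c)) dq _.
- by case/andP: s0 => c0 _; rewrite gt_eqF.
- by move=> t; exact: hypo_ode.
- by rewrite q0; exact: hypo0.
Qed.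

Lemma eq_hypo0 s s' : positive s -> positive s' ->
  hypo s 0 = hypo s' 0 -> hypo s = hypo s'.
Proof.
move=> s0 s0' e; apply/funext; elim=> // k IHk; apply/funext => t.
have := is_derive_hypo k t s0; rewrite IHk => d1.
have d2 := is_derive_hypo k t s0'.
by rewrite -(@derive_val _ _ _ _ _ _ _ d1) -(@derive_val _ _ _ _ _ _ _ d2).
Qed.

(** A sum of n exponential variables has a density of order t^(n-1) at 0. In the proof, [hypo_consS]
    expresses a derivative through derivatives of one order less, of the list and of its tail. *)
Lemma hypo_at0 s k : positive s -> (k.+1 < size s)%N -> hypo s k 0 = 0.
Proof.
elim: k s => [|k IHk] [|c [|d s]]//; first by move=> s0 _; rewrite hypo0.
move=> s0 ks; rewrite hypo_consS !IHk ?subrr ?mul0r//; first exact: ltnW.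
by case/andP: s0.
Qed.

(** With D the derivative, [A] satisfies (1 + dD) A = [hypo (c :: s)] and hence (1 + cD)(1 + dD) A =
    [hypo s]. The operators commute, so (1 + cD) A solves the equation of [hypo (d :: s)] with the
    same initial value, and [A] solves that of the left-hand side. *)
Lemma hypo_swap c d s : positive [:: c, d & s] ->
  hypo [:: c, d & s] 0 = hypo [:: d, c & s] 0.
Proof.
move=> s0; have /and3P[c0 d0 sp] := s0.
have s0' : positive [:: d, c & s] by apply/and3P.
pose A := hypo [:: d, c & s].
have cA t : A 0%N t + c * A 1%N t = hypo (d :: s) 0 t; last first.
  apply: hypo_unique => //; last by rewrite hypo_at0.
  move=> t; have := is_derive_hypo 0 t s0'; move/is_derive1_eq; apply.
  by rewrite -cA -/A; field; rewrite gt_eqF.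
have -> // : hypo (d :: s) 0 = (fun t => A 0%N t + c * A 1%N t).
apply: hypo_unique; first by apply/andP.
  move=> u; have := is_derive1D (is_derive_hypo 0 u s0')
    (is_derive1Z c (is_derive_hypo 1 u s0')).
  move/is_derive1_eq; apply.
  rewrite /A !(hypo_consS d (c :: s)) !(hypo_consS c s); field.
  by rewrite !gt_eqF.
rewrite /A hypo_consS !hypo0 //; last by apply/andP.
by case: (s) => [|? ?]; field; rewrite !gt_eqF.
Qed.

Lemma hypo_head c s s' : positive (c :: s) -> perm_eq s s' ->
  hypo s 0 = hypo s' 0 -> hypo (c :: s) 0 = hypo (c :: s') 0.
Proof.
move=> s0 ss' e; rewrite !hypo_cons0 e.
by case: s s' ss' {s0 e} => [|? ?] [|? ?]// /perm_size.
Qed.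

Lemma hypo_perm s s' : positive s -> perm_eq s s' -> hypo s = hypo s'.
Proof.
move=> s0 ss'; have s0' : positive s' by rewrite /positive -(perm_all _ ss').
apply: eq_hypo0 => //; elim: s s' s0 s0' ss' => [|c s IHs] s' s0 s0' ss'.
  by have /perm_size/esym/size0nil -> := ss'.
have: c \in s' by rewrite -(perm_mem ss') mem_head.
move=> cs'; case/path.splitPr: cs' s0' ss' => s1 s2 s0' ss'.
have ss12 : perm_eq s (s1 ++ s2).
  by rewrite -(perm_cons c) (perm_trans ss')// perm_catC/= perm_cons perm_catC.
have p12 : positive (s1 ++ s2).
  by rewrite /positive -(perm_all _ ss12); case/andP: s0.
have c0 : 0 < c by case/andP: s0.
rewrite (@hypo_head c s (s1 ++ s2))//; last first.
  by apply: IHs => //; case/andP: s0.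
elim: s1 p12 {IHs ss' ss12 s0 s0'} => //= d s1 IHs1 /andP[d0 p12].
rewrite hypo_swap; last by apply/and3P.
apply: hypo_head; first by rewrite /= d0/= c0.
  by rewrite -cat1s perm_catCA.
by rewrite IHs1.
Qed.

(** [hypo (c :: s) k] relaxes towards [hypo s k] starting from 0; the start at 0 is where
    [k < size s] enters. *)
Lemma hypo_le_head c s k M : positive (c :: s) -> (k < size s)%N ->
  0 <= M -> (forall t, 0 <= t -> `|hypo s k t| <= M) ->
  forall t, 0 <= t -> `|hypo (c :: s) k t| <= M.
Proof.
move=> s0 ks M0 sM; apply: (relax_norm (c := c)) sM _.
- by case/andP: s0.
- by move=> t; exact: hypo_ode.
- by rewrite hypo_at0// normr0.
Qed.

(* [Exp c] is the convolution of [Exp d] with a probability measure. *)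
Lemma hypo_le_replace c d s k M : positive (c :: s) -> (k < size s)%N ->
  0 < d -> d <= c -> 0 <= M ->
  (forall t, 0 <= t -> `|hypo (d :: s) k t| <= M) ->
  forall t, 0 <= t -> `|hypo (c :: s) k t| <= M.
Proof.
move=> s0 ks d0 dc M0 dM t t0; have /andP[c0 sp] := s0.
have s0' : positive (d :: s) by apply/andP.
pose B := hypo (d :: s) k.
have dc1 : d / c <= 1 by rewrite ler_pdivrMr ?mul1r.
(* The measure in question has mass d/c at 0 and is Exp c with weight 1 - d/c. Here [q] is the
   contribution of the second part. *)
pose q u := hypo (c :: s) k u - d / c * B u.
have qM u : 0 <= u -> `|q u| <= (1 - d / c) * M.
  apply: (@relax_norm _ (fun v => (1 - d / c) * B v) q c) => //.
  - move=> v; have := is_derive1B (hypo_ode k v s0)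
      (is_derive1Z (d / c) (hypo_ode k v s0')).
    move/is_derive1_eq; apply; rewrite /q /B; field.
    by rewrite !gt_eqF.
  - move=> v v0; rewrite normrM ger0_norm ?subr_ge0//.
    by rewrite ler_wpM2l ?subr_ge0// dM.
  - by rewrite /q /B !hypo_at0// mulr0 subrr normr0 mulr_ge0 ?subr_ge0.
rewrite (_ : hypo _ _ _ = q t + d / c * B t); last by rewrite /q subrK.
rewrite (le_trans (ler_normD _ _))// (_ : M = (1 - d / c) * M + d / c * M).
  rewrite lerD ?qM// normrM ger0_norm ?divr_ge0 ?(ltW d0) ?(ltW c0)//.
  by rewrite ler_wpM2l ?dM// divr_ge0 // ltW.
by rewrite -mulrDl subrK mul1r.
Qed.

Lemma hypo_le_cat s s' k M : positive (s ++ s') -> (k < size s')%N ->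
  0 <= M -> (forall t, 0 <= t -> `|hypo s' k t| <= M) ->
  forall t, 0 <= t -> `|hypo (s ++ s') k t| <= M.
Proof.
move=> + ks M0 sM; elim: s => [//|c s IHs] s0.
apply: hypo_le_head => //; first by rewrite size_cat ltn_addl.
by apply: IHs; case/andP: s0.
Qed.

Lemma hypo_le_nseq d s m k M : positive s -> all (fun c => d <= c) s -> 0 < d ->
  (k.+1 < size s + m)%N -> 0 <= M ->
  (forall t, 0 <= t -> `|hypo (nseq (size s + m) d) k t| <= M) ->
  forall t, 0 <= t -> `|hypo (s ++ nseq m d) k t| <= M.
Proof.
move=> + + d0 + M0; elim: s m => [//|c s IHs] m /= /andP[c0 s0] /andP[dc sd].
move=> km sM; have pm : positive (s ++ nseq m d).
  by rewrite /positive all_cat -/(positive s) s0/= all_nseq d0 orbT.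
apply: (@hypo_le_replace c d) => //.
- exact/andP.
- by rewrite size_cat size_nseq.
have -> : hypo (d :: s ++ nseq m d) = hypo (s ++ nseq m.+1 d).
  apply: hypo_perm; first by apply/andP.
  by rewrite -cat1s perm_catCA.
by apply: IHs => //; rewrite addnS.
Qed.

Lemma hypo_le_gamma d s k M : positive s -> 0 < d ->
  (k.+1 < count (fun c => (d <= c)%R) s)%N -> 0 <= M ->
  (forall t, 0 <= t ->
     `|hypo (nseq (count (fun c => d <= c) s) d) k t| <= M) ->
  forall t, 0 <= t -> `|hypo s k t| <= M.
Proof.
move=> s0 d0; set P := fun c => _; rewrite -size_filter => ks M0 sM.
have ss : perm_eq s (seq.filter (predC P) s ++ seq.filter P s).
  by rewrite perm_sym perm_catC (permEl (perm_filterC P s)).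
have s0' : positive (seq.filter (predC P) s ++ seq.filter P s).
  by rewrite /positive -(perm_all _ ss).
rewrite (hypo_perm s0 ss); apply: hypo_le_cat => //; first exact: ltnW.
rewrite -[seq.filter P s]cats0; apply: (@hypo_le_nseq d _ 0) => //.
- by move: s0'; rewrite /positive all_cat => /andP[].
- exact: filter_all.
- by rewrite addn0.
- by move=> t t0; rewrite addn0 sM.
Qed.

(** As a function of [x] this is also the Gamma density of shape k + 1. *)
Definition poisson k (x : R) : R := x ^+ k * expR (- x) / k`!%:R.

Lemma poisson_expE n d (t : R) :
  d^-1 ^+ n.+1 / n`!%:R * (t ^+ n * expR (- d^-1 * t)) = poisson n (t / d) / d.
Proof.
by rewrite /poisson mulNr (mulrC _ t) exprMn exprS; ring.
Qed.

Lemma hypo_nseq n d t : 0 < d ->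
  hypo (nseq n.+1 d) 0 t = poisson n (t / d) / d.
Proof.
move=> d0; have dn0 := lt0r_neq0 d0; elim: n t => [|n IHn] t.
  have -> // : hypo [:: d] 0 = (fun t => poisson 0 (t / d) / d).
  apply: hypo_unique; rewrite ?/positive/= ?d0//.
    move=> u; have := is_derive1Z d^-1 (is_derive1_expRM (- d^-1) u).
    rewrite (_ : (fun _ => _) = (fun v => poisson 0 (v / d) / d)).
      move/is_derive1_eq; apply.
      rewrite /poisson expr0 fact0 hypo_nil !mulNr (mulrC _ u); by field.
    apply/funext => v /=; rewrite /poisson expr0 fact0 mulNr (mulrC _ v).
    by field.
  by rewrite /poisson mul0r oppr0 expR0 expr0 fact0 divr1 !mul1r.
have -> // : hypo (nseq n.+2 d) 0 = (fun t => poisson n.+1 (t / d) / d).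
apply: hypo_unique.
- by rewrite /positive/= d0 all_nseq d0 orbT.
- move=> u; rewrite IHn.
  have := is_derive1Z (d^-1 ^+ n.+2 / n.+1`!%:R)
    (is_derive1M (is_derive1X n u) (is_derive1_expRM (- d^-1) u)).
  rewrite (_ : (fun _ => _) = (fun v => poisson n.+1 (v / d) / d)); last first.
    by apply/funext => v; rewrite poisson_expE.
  move/is_derive1_eq; apply; rewrite -!poisson_expE factS natrM !exprS; field.
  by rewrite dn0 pnatr_eq0 -lt0n fact_gt0 nat1r pnatr_eq0.
- by rewrite /poisson mul0r exprS !mul0r.
Qed.

End Hypoexponential.

Arguments hypo : simpl never.

(** * Bounds on Poisson weights and on derivatives of Gamma densities *)

Section PoissonKernel.
Variable R : realType.
Implicit Types (x z t d : R) (n k : nat).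

Lemma is_derive1_ln1D x : -1 < x ->
  is_derive x 1 (fun t => ln (1 + t)) (1 + x)^-1.
Proof.
move=> x1; have x0 : 0 < 1 + x by rewrite -ltrBlDl sub0r.
have d1 := is_derive1D (is_derive1_cst 1 x) (is_derive_id x (1 : R)).
have H := @is_derive1_comp R (@ln R) (fun t => 1 + t) x _ _ (is_derive1_ln x0) d1.
by apply: is_derive1_eq H _; rewrite add0r mulr1.
Qed.

Lemma ln1D_le x : 0 <= x -> ln (1 + x) <= x - x ^+ 2 / 2 + x ^+ 3 / 3.
Proof.
move=> x0; rewrite -subr_ge0.
have := @ge0_is_derive1_homo R
  (fun t => t - t ^+ 2 / 2 + t ^+ 3 / 3 - ln (1 + t))
  (fun t => t ^+ 3 / (1 + t)) 0 x.
rewrite (_ : 0 - 0 ^+ 2 / 2 + 0 ^+ 3 / 3 - ln (1 + 0) = 0 :> R); last first.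
  by rewrite addr0 ln1; ring.
move=> H; apply: H => [t /andP[t0 _]|t /andP[t0 _]|]; last exact: x0.
  have := is_derive1B (is_derive1D (is_derive1B (is_derive_id t (1 : R))
    (is_derive1Z 2^-1 (is_derive1X 1 t))) (is_derive1Z 3^-1 (is_derive1X 2 t)))
    (is_derive1_ln1D (lt_le_trans (ltrN10 R) t0)).
  rewrite (_ : (fun _ => _) = (fun t => t - t ^+ 2 / 2 + t ^+ 3 / 3 - ln (1 + t))).
    by move/is_derive1_eq; apply; field; rewrite gt_eqF// ltr_wpDr.
  by apply/funext => u; rewrite !(mulrC _^-1).
by rewrite divr_ge0 ?exprn_ge0// addr_ge0.
Qed.

(** At x = 1/n this rational bound gives exactly (n + 1/2) ln(1 + 1/n) >= 1, that is, the
    monotonicity of [log_stirling]. *)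
Lemma ln1D_ge x : 0 <= x -> 2 * x / (2 + x) <= ln (1 + x).
Proof.
move=> x0; rewrite -subr_ge0.
have := @ge0_is_derive1_homo R
  (fun t => ln (1 + t) - (2 - 4 * (2 + t)^-1))
  (fun t => (1 + t)^-1 - 4 * (2 + t)^-2) 0 x.
have -> : 2 * x / (2 + x) = 2 - 4 * (2 + x)^-1.
  by field; rewrite gt_eqF// ltr_wpDr.
have -> : ln (1 + 0) - (2 - 4 * (2 + 0)^-1) = 0 :> R.
  by rewrite addr0 ln1; field.
move=> H; apply: H => [t /andP[t0 _]|t /andP[t0 _]|]; last exact: x0.
  have t2 : 2 + t != 0 by rewrite gt_eqF// ltr_wpDr.
  have d2 := is_derive1D (is_derive1_cst 2 t) (is_derive_id t (1 : R)).
  have dV := is_derive1V t2 d2.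
  have := is_derive1B (is_derive1_ln1D (lt_le_trans (ltrN10 R) t0))
    (is_derive1B (is_derive1_cst 2 t) (is_derive1Z 4 dV)).
  move/is_derive1_eq; apply; rewrite /GRing.scale/=; field.
  by rewrite t2 gt_eqF// ltr_wpDr.
rewrite subr_ge0 -[leLHS]mulrC ler_pdivrMl ?exprn_gt0 ?ltr_wpDr//.
by rewrite ler_pdivlMr ?ltr_wpDr//; nra.
Qed.

(** The correction is quadratic near 0 and linear at infinity, so one inequality yields both the
    Gaussian peak and the exponential tail of the Poisson weights. *)
Lemma ln1D_le_gauss z : -1 < z -> ln (1 + z) <= z - z ^+ 2 / (2 * (1 + `|z|)).
Proof.
move=> z1; have [z0|z0] := leP 0 z.
  rewrite ger0_norm// -subr_ge0.
  have E t : 0 <= t -> t ^+ 2 / (2 * (1 + t)) = 2^-1 * (t - 1 + (1 + t)^-1).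
    by move=> t0; field; rewrite gt_eqF// ltr_wpDr.
  rewrite E//.
  have := @ge0_is_derive1_homo R
    (fun t => t - 2^-1 * (t - 1 + (1 + t)^-1) - ln (1 + t))
    (fun t => t ^+ 2 / (2 * (1 + t) ^+ 2)) 0 z.
  rewrite (_ : 0 - 2^-1 * (0 - 1 + (1 + 0)^-1) - ln (1 + 0) = 0 :> R); last first.
    by rewrite addr0 ln1; field.
  move=> H; apply: H => [t /andP[t0 _]|t /andP[t0 _]|]; last exact: z0.
    have t1 : 1 + t != 0 by rewrite gt_eqF// ltr_wpDr.
    have d2 := is_derive1D (is_derive1_cst 1 t) (is_derive_id t (1 : R)).
    have dV := is_derive1V t1 d2.
    have := is_derive1B (is_derive1B (is_derive_id t (1 : R)) (is_derive1Z 2^-1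
      (is_derive1D (is_derive1B (is_derive_id t (1 : R)) (is_derive1_cst 1 t)) dV)))
      (is_derive1_ln1D (lt_le_trans (ltrN10 R) t0)).
    by move/is_derive1_eq; apply; rewrite /GRing.scale/=; field.
  by rewrite divr_ge0 ?sqr_ge0// mulr_ge0// sqr_ge0.
apply: (@le_trans _ _ (z - z ^+ 2 / 2)); last first.
  rewrite lerB// ler_wpM2l ?sqr_ge0//.
  by rewrite lef_pV2 ?posrE ?mulr_gt0 ?ltr_wpDr// ler_peMr// lerDl.

have := @ge0_is_derive1_homo R (fun t => ln (1 + t) - (t - t ^+ 2 / 2))
  (fun t => t ^+ 2 / (1 + t)) z 0.
rewrite (_ : ln (1 + 0) - (0 - 0 ^+ 2 / 2) = 0 :> R); last first.
  by rewrite addr0 ln1; ring.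
move=> H; have {}H : ln (1 + z) - (z - z ^+ 2 / 2) <= 0.
  apply: H => [t /andP[zt _]|t /andP[zt _]|]; last exact: ltW.
    have t1 : -1 < t by exact: lt_le_trans zt.
    have := is_derive1B (is_derive1_ln1D t1) (is_derive1B
      (is_derive_id t (1 : R)) (is_derive1Z 2^-1 (is_derive1X 1 t))).
    rewrite (_ : (fun _ => _) = (fun t => ln (1 + t) - (t - t ^+ 2 / 2))).
      move/is_derive1_eq; apply; field.
      by rewrite gt_eqF// -ltrBlDl sub0r.
    by apply/funext => u; rewrite (mulrC 2^-1).
  by rewrite divr_ge0 ?sqr_ge0// -lerBlDl sub0r ltW// (lt_le_trans z1).
by rewrite -subr_le0.
Qed.

(** The logarithm of n^n e^(-n) n^(1/2) / n!, which increases to - ln(2 pi) / 2. Only the bounds -1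
    and 0 are needed. *)
Definition log_stirling n : R :=
  n%:R * ln n%:R - n%:R + ln n%:R / 2 - ln n`!%:R.

Lemma poisson_stirling n : (0 < n)%N ->
  poisson n n%:R * Num.sqrt n%:R = expR (log_stirling n).
Proof.
move=> n0; have nR : 0 < n%:R :> R by rewrite ltr0n.
rewrite /log_stirling !expRD expRN lnK ?posrE ?ltr0n ?fact_gt0//.
rewrite expRM_natl lnK ?posrE// /poisson.
have -> : expR (ln n%:R / 2) = Num.sqrt n%:R :> R.
  rewrite -[LHS]ger0_norm ?expR_ge0// -sqrtr_sqr -expRM_natl.
  by rewrite mulrC divfK// lnK ?posrE.
by ring.
Qed.

Lemma log_stirlingS n : (0 < n)%N -> log_stirling n.+1 - log_stirling n =
  (n%:R + 2^-1) * ln (1 + n%:R^-1) - 1.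
Proof.
move=> n0; have nR : 0 < n%:R :> R by rewrite ltr0n.
have -> : 1 + n%:R^-1 = n.+1%:R / n%:R :> R.
  by rewrite -natr1; field; rewrite gt_eqF.
rewrite ln_div ?posrE ?ltr0n// /log_stirling factS natrM lnM ?posrE ?ltr0n ?fact_gt0//.
by rewrite -natr1; field.
Qed.

Lemma log_stirling_ge n : (0 < n)%N -> -1 <= log_stirling n.
Proof.
elim: n => // -[_ _|n IHn _].
  by rewrite /log_stirling factS fact0 ln1; lra.
apply: le_trans (IHn isT) _; rewrite -subr_ge0 log_stirlingS// subr_ge0.
have nR : 0 < n.+1%:R :> R by rewrite ltr0n.
have nV : 0 <= n.+1%:R^-1 :> R by rewrite invr_ge0 ltW.
apply: le_trans (ler_wpM2l _ (ln1D_ge nV)); last by rewrite addr_ge0 ?ltW.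
rewrite le_eqVlt; apply/orP; left; apply/eqP; field.
by rewrite !gt_eqF// addr_gt0 ?mulr_gt0.
Qed.

Lemma log_stirling_le n : (0 < n)%N -> log_stirling n <= 0.
Proof.
(* The strengthened claim telescopes: an increment is at most (m + 2) / (12 m^3), which is at most
   1/(2m) - 1/(2(m + 1)), with equality at m = 1. *)
move=> n0; suff : log_stirling n + (2 * n%:R)^-1 <= 0.
  by apply: le_trans; rewrite lerDl invr_ge0 mulr_ge0.
elim: n n0 => // -[_ _|n IHn _].
  by rewrite /log_stirling factS fact0 ln1; lra.
apply: le_trans (IHn isT).
have nR : 1 <= n.+1%:R :> R by rewrite ler1n.
have n0 : 0 < n.+1%:R :> R by rewrite ltr0n.
have mV : 0 <= n.+1%:R^-1 :> R by rewrite invr_ge0 ltW.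
have m2 : 0 <= n.+1%:R + 2^-1 :> R by rewrite addr_ge0.
have := ler_wpM2l m2 (ln1D_le mV).
have := @log_stirlingS n.+1 isT.
rewrite -[n.+2%:R]natr1; set m : R := n.+1%:R in nR n0 *.
have -> : (m + 2^-1) * (m^-1 - m^-1 ^+ 2 / 2 + m^-1 ^+ 3 / 3) =
    1 + (m + 2) / (12 * m ^+ 3) by field; rewrite gt_eqF.
have -> : (2 * m)^-1 = (2 * (m + 1))^-1 + (2 * m * (m + 1))^-1.
  by field; rewrite !gt_eqF// addr_gt0.
have : (m + 2) / (12 * m ^+ 3) <= (2 * m * (m + 1))^-1.
  rewrite ler_pdivrMr ?mulr_gt0 ?exprn_gt0// ler_pdivlMl; first by nra.
  by rewrite !mulr_gt0// addr_gt0.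
move: (_ / (12 * _)) ((2 * m * _)^-1) ((2 * _)^-1) (_ * ln _) => a b c e.
by move=> H1 H2 H3; lra.
Qed.

Lemma poisson_peak_ge n : (0 < n)%N ->
  expR (-1) / Num.sqrt n%:R <= poisson n n%:R :> R.
Proof.
move=> n0; rewrite ler_pdivrMr ?sqrtr_gt0 ?ltr0n// poisson_stirling//.
by rewrite ler_expR log_stirling_ge.
Qed.

Lemma poisson_peak_le n : (0 < n)%N ->
  poisson n n%:R <= (Num.sqrt n%:R)^-1 :> R.
Proof.
move=> n0; rewrite -[leRHS]mul1r ler_pdivlMr ?sqrtr_gt0 ?ltr0n//.
by rewrite poisson_stirling// -expR0 ler_expR log_stirling_le.
Qed.

(** The logarithm of the ratio to the peak is n ln(x/n) - (x - n), to which [ln1D_le_gauss] applies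
    at z = (x - n)/n. *)
Lemma poisson_le_peak n x : (0 < n)%N -> 0 < x ->
  poisson n x <= poisson n n%:R *
    expR (- ((x - n%:R) ^+ 2 / (2 * (n%:R + `|x - n%:R|)))).
Proof.
move=> n0 x0; have nR : 0 < n%:R :> R by rewrite ltr0n.
set m : R := n%:R in nR *.
have z1 : -1 < (x - m) / m by rewrite ltr_pdivlMr// mulN1r ltrBrDl subrr.
have := ler_wpM2l (ltW nR) (ln1D_le_gauss z1).
have -> : 1 + (x - m) / m = x / m by field; rewrite gt_eqF.
rewrite normrM normfV (gtr0_norm nR) mulrBr => H.
have E : m * ((x - m) / m) = x - m by field; rewrite gt_eqF.
have E2 : m * (((x - m) / m) ^+ 2 / (2 * (1 + `|x - m| / m))) =
    (x - m) ^+ 2 / (2 * (m + `|x - m|)).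
  by field; rewrite !gt_eqF// ltr_wpDr.
move: H; rewrite {}E {}E2 ln_div ?posrE// => H.
have -> : poisson n x = poisson n m * expR (m * (ln x - ln m) - (x - m)).
  rewrite expRB expRB mulrBr expRB !expRM_natl !lnK ?posrE//.
  rewrite /poisson !expRN; field.
  by rewrite !gt_eqF ?expR_gt0 ?exprn_gt0// ltr0n fact_gt0.
rewrite ler_pM2l; first by rewrite ler_expR; lra.
by rewrite /poisson divr_gt0 ?mulr_gt0 ?expR_gt0 ?exprn_gt0// ltr0n fact_gt0.
Qed.

Lemma cube_le_expR x : 0 <= x -> x ^+ 3 <= 6 * expR x.
Proof.
move=> x0; have := @expR_ge1Dxn R x 2 x0; rewrite !factS fact0 => H.
have : x ^+ 3 / 6 <= expR x.
  by apply: le_trans H; rewrite (_ : (3 * (2 * (1 * 1)))%N = 6)// lerDr.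
by rewrite ler_pdivrMr// mulrC.
Qed.

(** The cube is there for the third derivative of the Gamma density, a Poisson weight times a cubic
    in the distance to the peak. On the scale n^(1/2) the weight decays exponentially, which beats
    the cube. *)
Lemma poisson_tail n x : (0 < n)%N -> 0 <= x ->
  poisson n x * (1 + `|x - n%:R| / Num.sqrt n%:R) ^+ 3 <=
  48 * expR 1 / Num.sqrt n%:R.
Proof.
move=> n0; rewrite le_eqVlt => /predU1P[<-|x0].
  rewrite /poisson expr0n (gtn_eqF n0) !mul0r.
  by rewrite divr_ge0 ?mulr_ge0 ?expR_ge0 ?sqrtr_ge0.
have s1 : 1 <= Num.sqrt n%:R :> R by rewrite -[leLHS]sqrtr1 ler_wsqrtr// ler1n.
have nE : n%:R = Num.sqrt n%:R ^+ 2 :> R by rewrite sqr_sqrtr.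
have := poisson_peak_le n0; have := poisson_le_peak n0 x0.
set u := `|x - n%:R|; set s := Num.sqrt n%:R in s1 nE *.
have s0 : 0 < s by exact: lt_le_trans s1.
rewrite -[(x - n%:R) ^+ 2]real_normK ?num_real// -/u => P1 P2.
set a := u / s; have a0 : 0 <= a by rewrite divr_ge0 ?normr_ge0// ltW.
have uE : u = a * s by rewrite /a divfK// gt_eqF.
(* With n = s^2 and |x - n| = a s the exponent is a^2 s / (2 (s + a)), and this is at least (a -
   1)/2 because s >= 1. *)
have Pe : poisson n x <= s^-1 * expR ((1 - a) / 2).
  apply: le_trans P1 _; apply: ler_pM => //; rewrite ?expR_ge0//.
    by rewrite /poisson divr_ge0 ?mulr_ge0 ?expR_ge0 ?exprn_ge0.
  rewrite ler_expR uE nE lerNl -mulNr opprB.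
  rewrite ler_pdivlMr; last first.
    by rewrite mulr_gt0// ltr_wpDr ?exprn_gt0// mulr_ge0// ltW.
  rewrite -subr_ge0 (_ : _ - _ = s * ((s - 1) * ((a - 2^-1) ^+ 2 + 3 / 4) + 1)).
    rewrite mulr_ge0 ?(ltW s0)// addr_ge0// mulr_ge0 ?subr_ge0//.
    by rewrite addr_ge0 ?sqr_ge0// divr_ge0.
  by field.
apply: le_trans (ler_wpM2r _ Pe) _; first by rewrite exprn_ge0// addr_ge0.
rewrite -[leLHS]mulrA [leLHS]mulrC ler_pM2r ?invr_gt0//.
have a2 : 0 <= (1 + a) / 2 by rewrite divr_ge0// addr_ge0.
(* The constant 48 is 6 times 2^3. *)
have := cube_le_expR a2; rewrite expr_div_n ler_pdivrMr ?exprn_gt0// => H.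
apply: le_trans (ler_wpM2l (expR_ge0 _) H) _.
have -> : expR 1 = expR ((1 - a) / 2) * expR ((1 + a) / 2).
  by rewrite -expRD; congr expR; field.
by rewrite le_eqVlt; apply/orP; left; apply/eqP; ring.
Qed.

Lemma hypo_nseqS k n d t : hypo (nseq n.+1 d) k.+1 t =
  (hypo (nseq n d) k t - hypo (nseq n.+1 d) k t) / d.
Proof. exact: (hypo_consS d (nseq n d) k t). Qed.

(** The derivative is a difference of consecutive Poisson weights, hence the weight of index [n]
    times a factor linear in the distance to the peak. *)
Lemma hypo_nseq_deriv1_le n d t : (0 < n)%N -> 0 < d -> 0 <= t ->
  `|hypo (nseq n.+2 d) 1 t| <= 48 * expR 1 / (n%:R * d ^+ 2).
Proof.
move=> n0 d0 t0; have nR : 0 < n%:R :> R by rewrite ltr0n.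
have dn0 := lt0r_neq0 d0.
rewrite hypo_nseqS !hypo_nseq//; set x := t / d.
have x0 : 0 <= x by rewrite divr_ge0// ltW.
have -> : (poisson n x / d - poisson n.+1 x / d) / d =
    poisson n x * (n.+1%:R - x) / (n.+1%:R * d ^+ 2).
  have nf : (n`!%:R : R) != 0 by rewrite pnatr_eq0 -lt0n fact_gt0.
  rewrite /poisson factS natrM !exprS; field.
  by rewrite dn0 nf nat1r pnatr_eq0.
have := poisson_tail n0 x0.
set u := `|x - n%:R|; set s := Num.sqrt n%:R => H.
have s0 : 0 < s by rewrite sqrtr_gt0.
have s1 : 1 <= s by rewrite -[leLHS]sqrtr1 ler_wsqrtr// ler1n.
have p0 : 0 <= poisson n x by rewrite /poisson divr_ge0 ?mulr_ge0 ?expR_ge0 ?exprn_ge0.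
have nE : n%:R = s ^+ 2 :> R by rewrite sqr_sqrtr.
move: (poisson n x) p0 H => P p0 H.
rewrite !normrM normfV (ger0_norm p0) (@ger0_norm _ (_ * _)); last first.
  by rewrite mulr_ge0 ?sqr_ge0.
set a := u / s in H; have a0 : 0 <= a by rewrite divr_ge0 ?normr_ge0// ltW.
have uE : u = a * s by rewrite /a divfK// gt_eqF.
have ub : `|n.+1%:R - x| <= s * (1 + a) ^+ 3.
  apply: (@le_trans _ _ (1 + u)).
    rewrite -natr1 addrAC addrC (le_trans (ler_normD _ _))// normr1 lerD2l.
    by rewrite distrC.
  apply: (@le_trans _ _ (s * (1 + a))); first by rewrite uE; nra.
  rewrite ler_pM2l// exprS ler_peMr ?addr_ge0//.
  by rewrite exprn_ege1// lerDl.
have : P * `|n.+1%:R - x| <= 48 * expR 1.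
  apply: le_trans (ler_wpM2l p0 ub) _.
  by rewrite mulrCA -ler_pdivlMl// [leRHS]mulrC.
move=> {}ub; apply: ler_pM => //.
- by rewrite mulr_ge0.
- by rewrite invr_ge0 mulr_ge0 ?sqr_ge0.
rewrite lef_pV2 ?posrE ?mulr_gt0 ?exprn_gt0// ler_pM2r ?exprn_gt0//.
by rewrite ler_nat.
Qed.

(** The third difference of Poisson weights is the weight of index [n] times a Laguerre polynomial
    of degree 3. Expanded about n + 3 it is seen to be of size n^(3/2) within n^(1/2) of the
    peak. *)
Lemma hypo_nseq_deriv3_le n d t : (0 < n)%N -> 0 < d -> 0 <= t ->
  `|hypo (nseq n.+4 d) 3 t| <= 48 * 71 * expR 1 / (n%:R ^+ 2 * d ^+ 4).
Proof.
move=> n0 d0 t0; have nR : 0 < n%:R :> R by rewrite ltr0n.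
have dn0 := lt0r_neq0 d0.
rewrite !hypo_nseqS !hypo_nseq//; set x := t / d.
have x0 : 0 <= x by rewrite divr_ge0// ltW.
have -> : (((poisson n x / d - poisson n.+1 x / d) / d -
    (poisson n.+1 x / d - poisson n.+2 x / d) / d) / d -
    ((poisson n.+1 x / d - poisson n.+2 x / d) / d -
    (poisson n.+2 x / d - poisson n.+3 x / d) / d) / d) / d =
    - (poisson n x * ((x - n.+3%:R) ^+ 3 - 3 * n.+3%:R * (x - n.+3%:R) -
      2 * n.+3%:R)) / (n.+1%:R * n.+2%:R * n.+3%:R * d ^+ 4).
  rewrite /poisson !factS !natrM !exprS -[n.+3%:R]natr1 -[n.+2%:R]natr1 -natr1.
  have nf : (n`!%:R : R) != 0 by rewrite pnatr_eq0 -lt0n fact_gt0.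
  have [n1 n2 n3] : [/\ (n%:R + 1 : R) != 0, (n%:R + 1 + 1 : R) != 0 &
      (n%:R + 1 + 1 + 1 : R) != 0] by split; rewrite !natr1 pnatr_eq0.
  by field; rewrite dn0 nf n1 n2 n3.
have := poisson_tail n0 x0.
set u := `|x - n%:R|; set s := Num.sqrt n%:R => H.
have s0 : 0 < s by rewrite sqrtr_gt0.
have s1 : 1 <= s by rewrite -[leLHS]sqrtr1 ler_wsqrtr// ler1n.
have p0 : 0 <= poisson n x by rewrite /poisson divr_ge0 ?mulr_ge0 ?expR_ge0 ?exprn_ge0.
have nE : n%:R = s ^+ 2 :> R by rewrite sqr_sqrtr.
move: (poisson n x) p0 H => P p0 H.
rewrite normrM normrN normfV !normrM (ger0_norm p0).
set a := u / s in H; have a0 : 0 <= a by rewrite divr_ge0 ?normr_ge0// ltW.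
have uE : u = a * s by rewrite /a divfK// gt_eqF.
have k4 : n.+3%:R <= 4 * s ^+ 2 :> R.
  by rewrite -nE -natrM ler_nat -addn3 (leq_add (leqnn n) (leq_mul (leqnn 3) n0)).
set k : R := n.+3%:R in k4 *; set w := x - k.
have k0 : 0 <= k by rewrite /k.
set b := 1 + a in H; have b1 : 1 <= b by rewrite lerDl.
have b0 : 0 <= b := le_trans ler01 b1.
have wu : `|w| <= 3 * s * b.
  apply: (@le_trans _ _ (u + 3)); last by rewrite uE /b; nra.
  rewrite /w /k -addn3 natrD opprD addrA (le_trans (ler_normD _ _))//.
  by rewrite normrN normr_nat.
(* Here 71 = 27 + 36 + 8, one summand for each term of the cubic, from |w| <= 3 s b and k <= 4
   s^2. *)
have qb : `|w ^+ 3 - 3 * k * w - 2 * k| <= s * n%:R * 71 * b ^+ 3.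
  rewrite (le_trans (ler_normB _ _))//.
  rewrite (le_trans (lerD (ler_normB _ _) (lexx _)))//.
  rewrite normrX !normrM !normr_nat.
  have w3 : `|w| ^+ 3 <= (3 * s * b) ^+ 3 by rewrite lerXn2r ?nnegrE// mulr_ge0// mulr_ge0// ltW.
  have kw : k * `|w| <= 4 * s ^+ 2 * (3 * s * b) by apply: ler_pM.
  have bb : b <= b ^+ 3 by rewrite exprS ler_peMr// exprn_ege1.
  have b3 : 1 <= b ^+ 3 by rewrite exprn_ege1.
  have s2 : s ^+ 2 <= s ^+ 3 by rewrite [leRHS]exprS ler_peMl// sqr_ge0.
  have s3 : 0 <= s ^+ 3 by rewrite exprn_ge0// ltW.
  have sb : s ^+ 3 * b <= s ^+ 3 * b ^+ 3 by rewrite ler_wpM2l.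
  have sb1 : s ^+ 3 <= s ^+ 3 * b ^+ 3 by rewrite ler_peMr.
  rewrite nE; nra.
have : P * `|w ^+ 3 - 3 * k * w - 2 * k| <= 48 * 71 * expR 1 * n%:R.
  apply: le_trans (ler_wpM2l p0 qb) _.
  rewrite [leLHS](_ : _ = P * b ^+ 3 * s * (71 * n%:R)); last by ring.
  rewrite [leRHS](_ : _ = 48 * expR 1 / s * s * (71 * n%:R)); last first.
    by rewrite -[48 * _ / s * s]mulrA mulVf ?gt_eqF//; ring.
  by rewrite !ler_pM2r// mulr_gt0.
move=> {}qb; apply: le_trans (ler_wpM2r _ qb) _; first by rewrite invr_ge0.
rewrite -!mulrA !ler_pM2l ?expR_gt0// -ler_pdivlMl// -invfM.
rewrite !(gtr0_norm d0) !normr_nat -[d * (d * _)]/(d ^+ 4).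
rewrite lef_pV2 ?posrE ?mulr_gt0 ?exprn_gt0 ?ltr0n// !mulrA.
by rewrite /k -!natrM !ler_pM2r// ler_nat !leq_mul// !leqW.
Qed.

End PoissonKernel.

(** * Local limit theorem for sums of exponential variables *)

Section LocalLimit.
Variable R : realType.
Implicit Types (s r : seq R) (c d t x w M K : R) (n m : nat).

Lemma hypo_deriv1_le s d x t : positive s -> 0 < d -> 0 < x ->
  x + 2 <= (count (fun c => (d <= c)%R) s)%:R -> 0 <= t ->
  `|hypo s 1 t| <= 48 * expR 1 / (x * d ^+ 2).
Proof.
move=> s0 d0 x0 xs; set M := _ / _.
have M0 : 0 <= M by rewrite divr_ge0 ?mulr_ge0 ?expR_ge0 ?exprn_ge0// ltW.
move: t; case E : (count _ s) xs => [|[|n]] xs.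
- by move: xs; rewrite leNgt addr_gt0.
- by move: xs; rewrite leNgt ltr_wpDl// ?ltr1n// ltW.
have xn : x <= n%:R by move: xs; rewrite -[n.+2]addn2 natrD lerD2r.
have n0 : (0 < n)%N by rewrite -(ltr_nat R) (lt_le_trans x0).
apply: (hypo_le_gamma s0 d0) => //; first by rewrite E.
move=> t t0; rewrite E; apply: le_trans (hypo_nseq_deriv1_le n0 d0 t0) _.
rewrite ler_wpM2l ?mulr_ge0 ?expR_ge0// lef_pV2 ?posrE ?mulr_gt0 ?exprn_gt0 ?ltr0n//.
by rewrite ler_wpM2r// exprn_ge0// ltW.
Qed.

Lemma hypo_deriv3_le s d x t : positive s -> 0 < d -> 0 < x ->
  x + 4 <= (count (fun c => (d <= c)%R) s)%:R -> 0 <= t ->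
  `|hypo s 3 t| <= 48 * 71 * expR 1 / (x ^+ 2 * d ^+ 4).
Proof.
move=> s0 d0 x0 xs; set M := _ / _.
have M0 : 0 <= M by rewrite divr_ge0 ?mulr_ge0 ?expR_ge0 ?exprn_ge0// ltW.
have s4 : (4 < count (fun c => (d <= c)%R) s)%N.
  by rewrite -(ltr_nat R) (lt_le_trans _ xs)// ltrDr.
move: t; case E : (count _ s) xs s4 => [//|[//|[//|[//|n]]]] xs s4.
have xn : x <= n%:R by move: xs; rewrite -[n.+4]addn4 natrD lerD2r.
apply: (hypo_le_gamma s0 d0) => //; first by rewrite E.
move=> t t0; rewrite E; apply: le_trans (hypo_nseq_deriv3_le _ d0 t0) _ => //.
have n0 : 0 < n%:R :> R := lt_le_trans x0 xn.
rewrite ler_wpM2l ?mulr_ge0 ?expR_ge0//.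
rewrite lef_pV2 ?posrE ?mulr_gt0 ?exprn_gt0//.
rewrite ler_wpM2r ?exprn_ge0 ?(ltW d0)// lerXn2r ?nnegrE// ltW//.
Qed.

Lemma taylor3 (F : nat -> R -> R) (t h M : R) : 0 <= h ->
  (forall k (u : R), is_derive u 1 (F k) (F k.+1 u)) ->
  (forall u, t <= u -> `|F 3 u| <= M) ->
  `|F 0%N (t + h) - (F 0%N t + h * F 1%N t + h ^+ 2 / 2 * F 2 t)| <= M * h ^+ 3.
Proof.
move=> h0 dF F3; have th : t <= t + h by rewrite lerDl.
have M0 : 0 <= M by rewrite (le_trans _ (F3 t (lexx t))).
have F2 u : t <= u <= t + h -> `|F 2 u - F 2 t| <= M * h.
  move=> /andP[tu uh]; apply: (@le_trans _ _ (M * (u - t))).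
    by apply: (le_is_derive1_norm (df := F 3)) => // v /andP[tv _]; exact: F3.
  by rewrite ler_wpM2l// lerBlDl.
have F1 u : t <= u <= t + h -> `|F 1%N u - F 1%N t - (u - t) * F 2 t| <= M * h * h.
  move=> /andP[tu uh]; apply: (@le_trans _ _ (M * h * (u - t))); last first.
    by rewrite ler_wpM2l ?mulr_ge0// lerBlDl.
  rewrite (_ : _ - _ * _ = (F 1%N u - (u - t) * F 2 t) -
    (F 1%N t - (t - t) * F 2 t)); last by ring.
  apply: (le_is_derive1_norm (f := fun u => F 1%N u - (u - t) * F 2 t)
    (df := fun u => F 2 u - F 2 t)) => // [v _|v /andP[tv vu]].
    have := is_derive1B (dF 1%N v) (is_derive1M
      (is_derive1B (is_derive_id v (1 : R)) (is_derive1_cst t v))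
      (is_derive1_cst (F 2 t) v)).
    by move/is_derive1_eq; apply; ring.
  by apply: F2; rewrite tv (le_trans vu).
pose G u := F 0%N u - (u - t) * F 1%N t - 2^-1 * ((u - t) * (u - t) * F 2 t).
have -> : F 0%N (t + h) - (F 0%N t + h * F 1%N t + h ^+ 2 / 2 * F 2 t) =
    G (t + h) - G t by rewrite /G; field.
have -> : M * h ^+ 3 = M * h * h * (t + h - t) by ring.
apply: (le_is_derive1_norm
  (df := fun u => F 1%N u - F 1%N t - (u - t) * F 2 t)) => // v _.
have d1 := is_derive1B (is_derive_id v (1 : R)) (is_derive1_cst t v).
have := is_derive1B (is_derive1B (dF 0%N v) (is_derive1M d1
  (is_derive1_cst (F 1%N t) v))) (is_derive1Z 2^-1
  (is_derive1M (is_derive1M d1 d1) (is_derive1_cst (F 2 t) v))).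
by move/is_derive1_eq; apply; field.
Qed.

(* Adding an exponential variable of mean [c] and following the mean acts on
   the density as [1 + c^2/2 D^2] up to third order. *)
Lemma hypo_step c s t M : positive (c :: s) -> 0 <= t -> (3 < size s)%N ->
  (forall u, 0 <= u -> `|hypo s 3 u| <= M) ->
  `|hypo (c :: s) 0 (t + c) - (hypo s 0 t + c ^+ 2 / 2 * hypo s 2 t)| <=
  2 * c ^+ 3 * M.
Proof.
move=> s0 t0 ss sM; have c0 : 0 < c by case/andP: s0.
have M0 : 0 <= M by rewrite (le_trans _ (sM 0 (lexx 0))).
have aM u : 0 <= u -> `|hypo (c :: s) 3 u| <= M by exact: hypo_le_head.
(* Everything is expressed through [hypo (c :: s)] at [t]: there (1 + c^2/2 D^2)(1 + cD) agrees with
   the Taylor expansion of the shift by [c] up to D^2. *)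
have E k : hypo s k t = hypo (c :: s) k t + c * hypo (c :: s) k.+1 t.
  by rewrite hypo_consS; field; rewrite gt_eqF.
have T := @taylor3 (hypo (c :: s)) t c M (ltW c0).
rewrite !E.
have -> : hypo (c :: s) 0 (t + c) - (hypo (c :: s) 0 t + c * hypo (c :: s) 1 t +
  c ^+ 2 / 2 * (hypo (c :: s) 2 t + c * hypo (c :: s) 3 t)) =
  (hypo (c :: s) 0 (t + c) - (hypo (c :: s) 0 t + c * hypo (c :: s) 1 t +
    c ^+ 2 / 2 * hypo (c :: s) 2 t)) - c ^+ 3 / 2 * hypo (c :: s) 3 t.
  by ring.
rewrite (le_trans (ler_normB _ _))//.
have -> : 2 * c ^+ 3 * M = M * c ^+ 3 + c ^+ 3 * M by ring.
apply: lerD; first apply: T => [k u|u tu].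
- exact: is_derive_hypo.
- by apply: aM; exact: le_trans tu.
have c3 : 0 <= c ^+ 3 / 2 by rewrite divr_ge0// exprn_ge0// ltW.
rewrite normrM ger0_norm// ler_pM ?aM//.
by rewrite ler_pdivrMr// ler_peMr ?exprn_ge0 ?(ltW c0)// ler1n.
Qed.

(** To the order kept, the pair enters only through c^2 + d^2; this is why two means may be traded
    for two others with the same sum of squares. *)
Lemma hypo_pair c d r t K M : positive [:: c, d & r] -> 0 <= t ->
  (3 < size r)%N -> c <= K -> d <= K ->
  (forall u, 0 <= u -> `|hypo r 3 u| <= M) ->
  `|hypo [:: c, d & r] 0 (t + d + c) -
    (hypo r 0 t + (c ^+ 2 + d ^+ 2) / 2 * hypo r 2 t)| <= 5 * K ^+ 3 * M.
Proof.
move=> p0 t0 sr cK dK rM; have /and3P[c0 d0 r0] := p0.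
have p1 : positive (d :: r) by apply/andP.
have M0 : 0 <= M by rewrite (le_trans _ (rM 0 (lexx 0))).
have K0 : 0 <= K by rewrite (le_trans (ltW c0)).
have dM u : 0 <= u -> `|hypo (d :: r) 3 u| <= M by exact: hypo_le_head.
have td : 0 <= t + d by rewrite addr_ge0// ltW.
have S1 := hypo_step p0 td (ltnW sr) dM.
have S2 := hypo_step p1 t0 sr rM.
have S3 : `|hypo (d :: r) 2 (t + d) - hypo r 2 t| <= 2 * d * M.
  have -> : hypo r 2 t = hypo (d :: r) 2 t + d * hypo (d :: r) 3 t.
    by rewrite (hypo_consS d r 2); field; rewrite gt_eqF.
  rewrite opprD addrA (le_trans (ler_normB _ _))//.
  have -> : 2 * d * M = M * (t + d - t) + d * M by ring.
  apply: lerD; last by rewrite normrM gtr0_norm// ler_wpM2l ?dM ?(ltW d0).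
  apply: (le_is_derive1_norm (df := hypo (d :: r) 3)) => // [u _|u /andP[tu _]|].
  - exact: is_derive_hypo.
  - by apply: dM; exact: le_trans tu.
  - by rewrite lerDl ltW.
have -> : hypo [:: c, d & r] 0 (t + d + c) -
    (hypo r 0 t + (c ^+ 2 + d ^+ 2) / 2 * hypo r 2 t) =
  (hypo [:: c, d & r] 0 (t + d + c) - (hypo (d :: r) 0 (t + d) +
     c ^+ 2 / 2 * hypo (d :: r) 2 (t + d))) +
  (hypo (d :: r) 0 (t + d) - (hypo r 0 t + d ^+ 2 / 2 * hypo r 2 t)) +
  c ^+ 2 / 2 * (hypo (d :: r) 2 (t + d) - hypo r 2 t) by ring.
rewrite (le_trans (ler_normD _ _))//.
have -> : 5 * K ^+ 3 * M = 2 * K ^+ 3 * M + 2 * K ^+ 3 * M + K ^+ 3 * M by ring.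
have c3 : c ^+ 3 <= K ^+ 3 by rewrite lerXn2r ?nnegrE// ltW.
have d3 : d ^+ 3 <= K ^+ 3 by rewrite lerXn2r ?nnegrE// ltW.
apply: lerD; first apply: le_trans (ler_normD _ _) _; first apply: lerD.
- by apply: le_trans S1 _; rewrite ler_wpM2r// ler_wpM2l.
- by apply: le_trans S2 _; rewrite ler_wpM2r// ler_wpM2l.
have c2 : 0 <= c ^+ 2 / 2 by rewrite divr_ge0// sqr_ge0.
rewrite normrM ger0_norm//; apply: le_trans (ler_wpM2l c2 S3) _.
rewrite [leLHS](_ : _ = c ^+ 2 * d * M); last by field.
rewrite ler_wpM2r// (exprSr K) ler_pM ?sqr_ge0 ?(ltW d0)//.
by rewrite lerXn2r ?nnegrE// ltW.
Qed.

(** The numbers w^2 - c^2 all have one sign and add up to 0. The boolean selects the sign, so that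
    both sides of the root mean square are covered. *)
Lemma eq_mean_square (b : bool) s w : positive s -> 0 <= w ->
  all (fun c => if b then w <= c else c <= w) s ->
  \sum_(c <- s) c ^+ 2 = (size s)%:R * w ^+ 2 -> all (pred1 w) s.
Proof.
move=> s0 w0 sw E.
have : \sum_(c <- s) (-1) ^+ b * (w ^+ 2 - c ^+ 2) == 0.
  rewrite -mulr_sumr sumrB E big_const_seq count_predT iter_addr_0.
  by rewrite mulr_natl subrr mulr0.
rewrite big_seq psumr_eq0 => [/allP H|c cs]; last first.
  have := allP sw c cs; have c0 : 0 < c := allP s0 c cs.
  case: b {sw E} => cw; rewrite ?expr0 ?mul1r ?expr1 ?mulN1r ?opprB subr_ge0.
    by rewrite lerXn2r ?nnegrE// ltW.
  by rewrite lerXn2r ?nnegrE// ltW.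
apply/allP => c cs; have := H c cs; rewrite cs/= mulf_eq0 signr_eq0/= subr_eq0.
have c0 : 0 < c := allP s0 c cs.
by rewrite eqrXn2// ?ltW// eq_sym.
Qed.

(** A mean contributes at most K^2 to the sum of squares if it is at least [d], and at most d^2
    otherwise. *)
Lemma count_ge_of_square s d K : positive s -> 0 < K -> all (fun c => c <= K) s ->
  \sum_(c <- s) c ^+ 2 - (size s)%:R * d ^+ 2 <=
  (count (fun c => (d <= c)%R) s)%:R * K ^+ 2.
Proof.
move=> + K0; elim: s => [|c s IHs]; first by rewrite big_nil !mul0r subrr.
rewrite big_cons/= => /andP[c0 s0] /andP[cK sK].
rewrite natrD mulrDl -nat1r mulrDl mul1r opprD addrACA.
apply: lerD; last exact: IHs.
have [dc|dc] := leP d c; rewrite /= ?mul1r ?mul0r.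
  apply: (@le_trans _ _ (c ^+ 2)); first by rewrite gerBl sqr_ge0.
  by rewrite lerXn2r ?nnegrE// ltW.
by rewrite subr_le0 lerXn2r ?nnegrE ?ltW// (lt_trans c0).
Qed.

(* If the sum of squares is [n w^2] and not all means are [w], some [c < w < d];
   replacing them by [w] and [sqrt (c^2 + d^2 - w^2)] decreases the number [m]
   of means other than [w]. *)
Lemma hypo_smoothing w K M n m s : 0 < w -> 0 <= K -> 0 <= M -> (5 < n)%N ->
  (forall r t, positive r -> all (fun c => c <= K) r -> size r = n.-2 ->
     n%:R * w ^+ 2 - 2 * K ^+ 2 <= \sum_(c <- r) c ^+ 2 -> 0 <= t ->
     `|hypo r 3 t| <= M) ->
  positive s -> all (fun c => c <= K) s -> size s = n ->
  \sum_(c <- s) c ^+ 2 = n%:R * w ^+ 2 ->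
  (count (predC1 w) s <= m)%N ->
  `|hypo s 0 (\sum_(c <- s) c) - hypo (nseq n w) 0 (n%:R * w)| <=
  m%:R * (10 * K ^+ 3 * M).
Proof.
move=> w0 K0 M0 n5 rM; have K3 : 0 <= 10 * K ^+ 3 * M.
  by rewrite !mulr_ge0 ?exprn_ge0.
elim: m s => [|m IHm] s s0 sK sn s2.
  rewrite leqn0 => /eqP/eqP; rewrite -leqn0 leqNgt -has_count -all_predC => H.
  have : all (pred1 w) s.
    by apply: sub_all H => x /=; rewrite negbK.
  move/all_pred1P; rewrite sn => ->.
  by rewrite big_nseq iter_addr_0 mulr_natl subrr normr0 mul0r.
have [sm _|sm sle] := boolP (count (predC1 w) s <= m)%N.
  by apply: le_trans (IHm _ s0 sK sn s2 sm) _; rewrite ler_wpM2r// ler_nat.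
have Nw : ~~ all (pred1 w) s.
  apply: contraNN sm => sw.
  by rewrite (_ : count _ s = 0%N)//; apply/eqP; rewrite -leqn0 leqNgt -has_count -all_predC;
    apply: sub_all sw => x /= ->.
have E2 : \sum_(c <- s) c ^+ 2 = (size s)%:R * w ^+ 2 by rewrite sn.
have : has (fun c => c < w) s.
  rewrite -[has _ _]negbK -all_predC; apply: contraNN Nw => sw.
  apply: (@eq_mean_square true) => //; first exact: ltW.
  by apply: sub_all sw => x /=; rewrite -leNgt.
move=> /hasP[c cs cw].
have : has (fun c => w < c) s.
  rewrite -[has _ _]negbK -all_predC; apply: contraNN Nw => sw.
  apply: (@eq_mean_square false) => //; first exact: ltW.
  by apply: sub_all sw => x /=; rewrite -leNgt.
move=> /hasP[d ds wd].
have dc : d != c by rewrite gt_eqF// (lt_trans cw).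
have ds' : d \in rem c s.
  by have := ds; rewrite (perm_mem (perm_to_rem cs)) inE (negbTE dc).
pose r := rem d (rem c s).
have sr : perm_eq s [:: c, d & r].
  apply: (perm_trans (perm_to_rem cs)); rewrite perm_cons.
  exact: perm_to_rem.
have sp : positive [:: c, d & r] by rewrite /positive -(perm_all _ sr).
have /and3P[c0 d0 r0] := sp.
have : all (fun c => c <= K) [:: c, d & r] by rewrite -(perm_all _ sr).
move=> /and3P[cK dK rK].
have rn : size r = n.-2 by rewrite -sn (perm_size sr).
have r2 : n%:R * w ^+ 2 = c ^+ 2 + (d ^+ 2 + \sum_(c <- r) c ^+ 2).
  by rewrite -s2 (perm_big _ sr) !big_cons.
have c2K : c ^+ 2 <= K ^+ 2 by rewrite lerXn2r ?nnegrE// ltW.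
have d2K : d ^+ 2 <= K ^+ 2 by rewrite lerXn2r ?nnegrE// ltW.
(* Removing two means costs at most 2 K^2 of the sum of squares, which is the loss allowed in the
   hypothesis on [M]. *)
have rM' u : 0 <= u -> `|hypo r 3 u| <= M.
  by apply: rM => //; rewrite r2; lra.
have r3 : (3 < size r)%N by rewrite rn; case: (n) n5 => [|[|]].
pose e := Num.sqrt (c ^+ 2 + d ^+ 2 - w ^+ 2).
have cw2 : c ^+ 2 <= w ^+ 2 by rewrite lerXn2r ?nnegrE// ltW.
have wd2 : w ^+ 2 <= d ^+ 2 by rewrite lerXn2r ?nnegrE// ltW.
have c20 : 0 < c ^+ 2 by rewrite exprn_gt0.
have e0 : 0 < e by rewrite sqrtr_gt0; lra.
have e2 : e ^+ 2 = c ^+ 2 + d ^+ 2 - w ^+ 2 by rewrite sqr_sqrtr//; lra.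
have eK : e <= K.
  by rewrite -(@ler_pXn2r _ 2)// ?nnegrE ?(ltW e0)// e2; lra.
have wK : w <= K by exact: le_trans (ltW wd) dK.
have sp' : positive [:: w, e & r] by apply/and3P.
have sr0 : 0 <= \sum_(c <- r) c.
  by rewrite big_seq sumr_ge0// => x xr; exact: ltW (allP r0 x xr).
have aK : all (fun c => c <= K) [:: w, e & r] by apply/and3P.
have sz : size [:: w, e & r] = n by rewrite /= rn; case: (n) n5 => [|[|]].
have sq : \sum_(c <- [:: w, e & r]) c ^+ 2 = n%:R * w ^+ 2.
  by rewrite !big_cons e2 r2; ring.
have ct : (count (predC1 w) [:: w, e & r] <= m)%N.
  move: sle; rewrite (seq.permP sr)/= eqxx (lt_eqF cw) (gt_eqF wd)/= add0n !add1n ltnS.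
  by apply: leq_trans; case: (_ == _) => //=; rewrite add1n.
have H1 := hypo_pair sp sr0 r3 cK dK rM'.
have H2 := hypo_pair sp' sr0 r3 wK eK rM'.
have H3 := IHm _ sp' aK sz sq ct.
have -> : \sum_(c <- s) c = \sum_(c <- r) c + d + c.
  by rewrite (perm_big _ sr) /= !big_cons/=; ring.
rewrite (hypo_perm s0 sr).
rewrite !big_cons in H3.
have E : w + (e + \sum_(j <- r) j) = \sum_(c <- r) c + e + w by ring.
rewrite {}E in H3.
(* Both pairs have the same sum of squares, so both densities are compared with the same [T]. *)
rewrite (_ : (w ^+ 2 + e ^+ 2) = c ^+ 2 + d ^+ 2) in H2; last by rewrite e2; ring.
move: H1 H2 H3; move: (hypo r 0 _ + _) => T.
move: (hypo [:: c, d & r] _ _) (hypo [:: w, e & r] _ _) (hypo (nseq n w) _ _).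
move=> x y z H1 H2 H3.
have -> : x - z = (x - T) - (y - T) + (y - z) by ring.
have -> : m.+1%:R * (10 * K ^+ 3 * M) =
  5 * K ^+ 3 * M + 5 * K ^+ 3 * M + m%:R * (10 * K ^+ 3 * M).
  by rewrite -natr1; ring.
rewrite (le_trans (ler_normD _ _))// lerD//.
by rewrite (le_trans (ler_normB _ _))// lerD.
Qed.

(** The Gamma density of shape n is taken at its mean, not at its mode; the Poisson weights of n - 1
    and n at parameter n coincide. *)
Lemma hypo_nseq_peak n w : (0 < n)%N -> 0 < w ->
  hypo (nseq n w) 0 (n%:R * w) = poisson n n%:R / w.
Proof.
case: n => // n _ w0; rewrite hypo_nseq// mulfK ?gt_eqF//; congr (_ / _).
have nf : (n`!%:R : R) != 0 by rewrite pnatr_eq0 -lt0n fact_gt0.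
rewrite /poisson factS natrM [in RHS]exprS; field.
by rewrite nf nat1r pnatr_eq0.
Qed.

(** The normalization is the one for which the Gamma density with the same root mean square has
    value exactly 1 at its mean. The error consists of the cost of smoothing and of the cost of
    evaluating at [t] instead of at the mean. *)
Lemma hypo_local_limit (B V : R) : 0 < B -> 0 < V ->
  exists (C : R) (N0 : nat), forall n s t, (N0 <= n)%N -> positive s ->
    size s = n -> all (fun c => c <= B / n%:R) s ->
    V / n%:R <= \sum_(c <- s) c ^+ 2 -> 0 <= t ->
    `|hypo s 0 t * Num.sqrt ((\sum_(c <- s) c ^+ 2) / n%:R) /
        poisson n n%:R - 1| <=
    C * (1 + n%:R * `|t - \sum_(c <- s) c|) / Num.sqrt n%:R.
Proof.
(* Means below (V/2)^(1/2)/n carry at most V/(2n) of the sum of squares, and every other mean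
   carries at most (B/n)^2. Hence at least a proportion [rho] of the means is of order 1/n. *)
move=> B0 V0; pose rho := V / (2 * B ^+ 2).
have rho0 : 0 < rho by rewrite divr_gt0 ?mulr_gt0 ?exprn_gt0.
pose C3 : R := 48 * 71 * expR 1 / ((rho / 2) ^+ 2 * (V / 2) ^+ 2).
pose C1 : R := 48 * expR 1 / (rho / 2 * (V / 2)).
have C30 : 0 <= C3.
  apply: divr_ge0; first by rewrite !mulr_ge0 ?expR_ge0.
  by apply: mulr_ge0; exact: sqr_ge0.
have C10 : 0 <= C1.
  have [r2 V2] : 0 < rho / 2 /\ 0 < V / 2 by split; rewrite divr_gt0.
  apply: divr_ge0; first by rewrite !mulr_ge0 ?expR_ge0.
  by apply: mulr_ge0; exact: ltW.
pose C := (C1 + 10 * B ^+ 3 * C3) * B * expR 1.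
(* The bound rho n >= 12 turns rho n - 2, the count left after two means are removed, into at least
   rho n / 2 + 4, as [hypo_deriv3_le] requires; 6 is required by [hypo_smoothing]. *)
exists C, (maxn 6 (Num.truncn (12 / rho)).+1) => n s t.
rewrite geq_max => /andP[n6 nrho] s0 sn sB sV t0.
have nR : 0 < n%:R :> R by rewrite ltr0n (leq_trans _ n6).
have rn : 12 <= rho * n%:R.
  rewrite -ler_pdivrMl// mulrC ltW//.
  apply: lt_le_trans (_ : (Num.truncn (12 / rho)).+1%:R <= _); last first.
    by rewrite ler_nat.
  by apply: truncnS_gt.
set Q := \sum_(c <- s) c ^+ 2 in sV *; set w := Num.sqrt (Q / n%:R).
have Q0 : 0 < Q by apply: lt_le_trans sV; rewrite divr_gt0.
have w2 : w ^+ 2 = Q / n%:R by rewrite sqr_sqrtr// ltW// divr_gt0.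
have w0 : 0 < w by rewrite sqrtr_gt0 divr_gt0.
have QE : Q = n%:R * w ^+ 2 by rewrite w2; field; rewrite gt_eqF.
have wB : w <= B / n%:R.
  suff : w ^+ 2 <= (B / n%:R) ^+ 2.
    by rewrite ler_pXn2r// nnegrE ltW// divr_gt0.
  rewrite w2 ler_pdivrMr// /Q.
  have -> : (B / n%:R) ^+ 2 * n%:R = \sum_(c <- s) (B / n%:R) ^+ 2.
    by rewrite big_const_seq count_predT iter_addr_0 sn mulr_natr.
  rewrite big_seq [leRHS]big_seq ler_sum// => c cs.
  have c0 : 0 < c := allP s0 c cs; have cB : c <= B / n%:R := allP sB c cs.
  by rewrite lerXn2r ?nnegrE ?(ltW c0)// (le_trans (ltW c0)).
pose d := Num.sqrt (V / 2) / n%:R.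
have d0 : 0 < d by rewrite divr_gt0 ?sqrtr_gt0 ?divr_gt0.
have d2 : d ^+ 2 = V / 2 / n%:R ^+ 2 by rewrite expr_div_n sqr_sqrtr// divr_ge0// ltW.
pose K := B / n%:R; have K0 : 0 < K by rewrite divr_gt0.
have cnt r : positive r -> all (fun c => c <= K) r -> (size r <= n)%N ->
    n%:R * w ^+ 2 - 2 * K ^+ 2 <= \sum_(c <- r) c ^+ 2 ->
    rho / 2 * n%:R + 4 <= (count (fun c => (d <= c)%R) r)%:R.
  move=> r0 rK rn' r2; have := count_ge_of_square d r0 K0 rK.
  have : (size r)%:R * d ^+ 2 <= n%:R * d ^+ 2 by rewrite ler_wpM2r ?sqr_ge0// ler_nat.
  move: (count _ _)%:R => k H1 H2.
  have {}H2 : V / n%:R - 2 * K ^+ 2 - n%:R * d ^+ 2 <= k * K ^+ 2.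
    by apply: le_trans H2; move: sV; rewrite QE; lra.
  have : rho * n%:R - 2 <= k.
    rewrite -(@ler_pM2r _ (K ^+ 2)) ?exprn_gt0//; apply: le_trans H2.
    rewrite d2 /rho /K le_eqVlt; apply/orP; left; apply/eqP; field.
    by rewrite !gt_eqF.
  by move: rn; lra.
have rn0 : 0 < rho / 2 * n%:R by rewrite mulr_gt0// divr_gt0.
pose M := C3 * n%:R ^+ 2; have M0 : 0 <= M by rewrite mulr_ge0// sqr_ge0.
have d3M r u : positive r -> all (fun c => c <= K) r -> size r = n.-2 ->
    n%:R * w ^+ 2 - 2 * K ^+ 2 <= \sum_(c <- r) c ^+ 2 -> 0 <= u ->
    `|hypo r 3 u| <= M.
  move=> r0 rK rn' r2 u0; have rc : (size r <= n)%N by rewrite rn' -subn2 leq_subr.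
  have := hypo_deriv3_le r0 d0 rn0 (cnt r r0 rK rc r2) u0.
  rewrite (_ : d ^+ 4 = (d ^+ 2) ^+ 2); last by rewrite -exprM.
  rewrite d2 /M /C3 => /le_trans; apply; rewrite le_eqVlt; apply/orP; left.
  by apply/eqP; field; rewrite !gt_eqF.
have D1 : `|hypo s 0 t - hypo s 0 (\sum_(c <- s) c)| <=
    C1 * n%:R * `|t - \sum_(c <- s) c|.
  have S0 : 0 <= \sum_(c <- s) c.
    by rewrite big_seq sumr_ge0// => x xs; exact: ltW (allP s0 x xs).
  have d1M u : 0 <= u -> `|hypo s 1 u| <= C1 * n%:R.
    have r2 : n%:R * w ^+ 2 - 2 * K ^+ 2 <= \sum_(c <- s) c ^+ 2.
      by rewrite -QE gerBl mulr_ge0// sqr_ge0.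
    have := cnt s s0 sB (eq_leq sn) r2.
    move: (count _ _)%:R (fun x => @hypo_deriv1_le s d x u s0 d0) => k Hk kn u0.
    have := Hk _ rn0 _ u0; rewrite d2 => H; apply: le_trans (H _) _; first by lra.
    rewrite /C1 le_eqVlt; apply/orP; left; apply/eqP; field.
    by rewrite !gt_eqF.
  have [tS|St] := leP t (\sum_(c <- s) c).
    rewrite distrC (distrC t) (ger0_norm (x := _ - t)) ?subr_ge0//.
    apply: (le_is_derive1_norm (df := hypo s 1)) => // [u _|u /andP[tu _]].
      exact: is_derive_hypo.
    by apply: d1M; exact: le_trans tu.
  rewrite (gtr0_norm (x := t - _)) ?subr_gt0//.
  apply: (le_is_derive1_norm (df := hypo s 1)) => [u _|u /andP[tu _]|].
  - exact: is_derive_hypo.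
  - by apply: d1M; exact: le_trans tu.
  - exact: ltW.
have D2 := hypo_smoothing w0 (ltW K0) M0 n6 d3M s0 sB sn QE (count_size _ _).
have n0 : (0 < n)%N by rewrite -(ltr_nat R).
rewrite sn (hypo_nseq_peak n0 w0) in D2.
have P0 := poisson_peak_ge R n0.
have s0' : 0 < Num.sqrt n%:R :> R by rewrite sqrtr_gt0.
have PP : 0 < poisson n n%:R :> R.
  by apply: lt_le_trans P0; rewrite divr_gt0 ?expR_gt0.
set X := `|t - _| in D1 *.
have X0 : 0 <= X by exact: normr_ge0.
have H : `|hypo s 0 t - poisson n n%:R / w| <= (C1 + 10 * B ^+ 3 * C3) * (1 + n%:R * X).
  have -> : hypo s 0 t - poisson n n%:R / w = (hypo s 0 t - hypo s 0 (\sum_(c <- s) c))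
    + (hypo s 0 (\sum_(c <- s) c) - poisson n n%:R / w) by rewrite addrA subrK.
  rewrite (le_trans (ler_normD _ _))//.
  apply: le_trans (lerD D1 D2) _.
  have -> : n%:R * (10 * K ^+ 3 * M) = 10 * B ^+ 3 * C3.
    by rewrite /K /M; field; rewrite gt_eqF.
  have E : 0 <= 10 * B ^+ 3 * C3.
    by apply: mulr_ge0 => //; apply: mulr_ge0 => //; rewrite exprn_ge0// ltW.
  have nX : 0 <= n%:R * X by rewrite mulr_ge0// ltW.
  rewrite -mulrA -subr_ge0.
  move: E nX; move: (10 * _ * _) (n%:R * X) => E Y E0 Y0.
  rewrite (_ : _ - _ = C1 + E * Y); last by ring.
  by apply: addr_ge0 => //; exact: mulr_ge0.
have -> : hypo s 0 t * w / poisson n n%:R - 1 =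
  (hypo s 0 t - poisson n n%:R / w) * (w / poisson n n%:R).
  by field; rewrite !gt_eqF.
have wPn : 0 < w / poisson n n%:R by exact: divr_gt0.
rewrite normrM (gtr0_norm wPn).
have wP : w / poisson n n%:R <= B * expR 1 / Num.sqrt n%:R.
  rewrite ler_pdivrMr//; apply: le_trans wB _.
  rewrite ler_pdivrMr//.
  have : 1 <= expR 1 * Num.sqrt n%:R * poisson n n%:R :> R.
    move: P0; rewrite expRN ler_pdivrMr// -[_^-1]mulr1 ler_pdivrMl ?expR_gt0//.
    by rewrite mulrA mulrAC.
  move=> {}P0.
  have -> : B * expR 1 / Num.sqrt n%:R * poisson n n%:R * n%:R =
    B * (expR 1 * Num.sqrt n%:R * poisson n n%:R).
    move: (sqr_sqrtr (ltW nR)) s0'.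
    move: (Num.sqrt n%:R) (poisson n n%:R) => u P uE u0.
    by rewrite -uE; field; rewrite gt_eqF.
  by rewrite ler_peMr// ltW.
apply: le_trans (ler_pM _ _ H wP) _ => //.
  exact: ltW.
by rewrite /C le_eqVlt; apply/orP; left; apply/eqP; ring.
Qed.

End LocalLimit.

(** * Closure properties of Laurent polynomials *)

Section Laurent.
Variables (K : fieldType) (N : nat).
Implicit Types (s : ('I_N -> K) -> K) (u : 'I_N -> K).

Lemma is_laurent_ext s s' : (forall u, (forall i, u i != 0) -> s u = s' u) ->
  is_laurent s -> is_laurent s'.
Proof. by move=> e [c cP]; exists c => u u0; rewrite -e// cP. Qed.

Lemma is_laurent_cst a : is_laurent (fun _ : 'I_N -> K => a).
Proof.
exists [:: (a, fun=> 0)] => u u0; rewrite big_seq1/=.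
by rewrite big1 ?mulr1// => i _; rewrite expr0z.
Qed.

Lemma is_laurentD s s' : is_laurent s -> is_laurent s' ->
  is_laurent (fun u => s u + s' u).
Proof.
by move=> [c cP] [c' cP']; exists (c ++ c') => u u0; rewrite big_cat/= cP// cP'.
Qed.

Lemma is_laurentM s s' : is_laurent s -> is_laurent s' ->
  is_laurent (fun u => s u * s' u).
Proof.
move=> [c cP] [c' cP'].
exists [seq (p.1 * q.1, fun i => p.2 i + q.2 i) | p <- c, q <- c'] => u u0.
rewrite big_allpairs_dep/= cP// cP'// mulr_suml; apply: eq_bigr => p _.
rewrite mulr_sumr; apply: eq_bigr => q _.
rewrite mulrACA -big_split/=; congr (_ * _).
by apply: eq_bigr => i _; rewrite expfzDr.
Qed.

Lemma is_laurent_exprz i (m : int) : is_laurent (fun u => u i ^ m).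
Proof.
exists [:: (1, fun j => if j == i then m else 0)] => u u0.
rewrite big_seq1/= mul1r (bigD1 i)//= eqxx big1 ?mulr1// => j /negbTE ->.
by rewrite expr0z.
Qed.

Lemma is_laurentX i (m : nat) : is_laurent (fun u => u i ^+ m).
Proof.
by apply: is_laurent_ext (is_laurent_exprz i m) => u _; rewrite -exprnP.
Qed.

Lemma is_laurent_sum (I : Type) (r : seq I) (P : pred I) (F : I -> ('I_N -> K) -> K) :
  (forall i, is_laurent (F i)) -> is_laurent (fun u => \sum_(i <- r | P i) F i u).
Proof.
move=> FL; elim: r => [|i r IHr].
  by apply: is_laurent_ext (is_laurent_cst 0) => u _; rewrite big_nil.
case Pi : (P i).
  by apply: is_laurent_ext (is_laurentD (FL i) IHr) => u _; rewrite big_cons Pi.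
by apply: is_laurent_ext IHr => u _; rewrite big_cons Pi.
Qed.

Lemma is_laurent_prod (I : Type) (r : seq I) (P : pred I) (F : I -> ('I_N -> K) -> K) :
  (forall i, is_laurent (F i)) -> is_laurent (fun u => \prod_(i <- r | P i) F i u).
Proof.
move=> FL; elim: r => [|i r IHr].
  by apply: is_laurent_ext (is_laurent_cst 1) => u _; rewrite big_nil.
case Pi : (P i).
  by apply: is_laurent_ext (is_laurentM (FL i) IHr) => u _; rewrite big_cons Pi.
by apply: is_laurent_ext IHr => u _; rewrite big_cons Pi.
Qed.

Lemma is_laurent_det n (A : 'I_n -> 'I_n -> ('I_N -> K) -> K) :
  (forall i j, is_laurent (A i j)) ->
  is_laurent (fun u => \det (\matrix_(i, j) A i j u)).
Proof.
move=> AL; pose F (g : 'S_n) (u : 'I_N -> K) :=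
  (-1) ^+ g * \prod_i A i (g i) u.
have FL g : is_laurent (F g).
  by apply: is_laurentM; [exact: is_laurent_cst|exact: is_laurent_prod].
apply: is_laurent_ext (is_laurent_sum (index_enum _) xpredT FL) => u _.
apply: eq_bigr => g _; congr (_ * _).
by apply: eq_bigr => i _; rewrite mxE.
Qed.

End Laurent.

(* Newton interpolation of the monomial x^m at the nodes w 0, w 1, ...:
   [newton_coef w m k r] is the coefficient of x^r in the k-th iterated
   quotient. *)
Section Newton.
Variable K : fieldType.
Implicit Types (w : nat -> K) (x : K).

Fixpoint newton_coef w (m k r : nat) : K :=
  if k is k'.+1 then
    \sum_(t < m.+1 | (r < t)%N) newton_coef w m k' t * w k' ^+ (t - r.+1)
  else (r == m)%:R.

Definition newton_quotient w m k x :=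
  \sum_(r < m.+1) newton_coef w m k r * x ^+ r.

Lemma newton_quotient0 w m x : newton_quotient w m 0 x = x ^+ m.
Proof.
rewrite /newton_quotient big_ord_recr/= eqxx mul1r big1 ?add0r// => i _.
by rewrite ltn_eqF ?mul0r.
Qed.

Lemma newton_quotientS w m k x : newton_quotient w m k x =
  newton_quotient w m k (w k) + (x - w k) * newton_quotient w m k.+1 x.
Proof.
apply/eqP; rewrite addrC -subr_eq -sumrB; apply/eqP.
rewrite /newton_quotient/= mulr_sumr.
under [RHS]eq_bigr do rewrite mulr_suml mulr_sumr.
under [RHS]eq_bigr do rewrite big_mkcond.
rewrite exchange_big/=; apply: eq_bigr => t _.
rewrite -mulrBr -[x ^+ t - _]opprB subrXX -mulNr opprB mulrCA mulr_sumr.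
rewrite [in LHS](_ : \sum_(i < t) _ = \sum_(0 <= i < t) newton_coef w m k t *
  (w k ^+ (t.-1 - i) * x ^+ i)); last by rewrite big_mkord.
rewrite (@big_nat_widen _ _ _ _ _ m.+1) ?(ltnW (ltn_ord t))// big_mkord mulr_sumr.
rewrite [LHS]big_mkcond; apply: eq_bigr => r _/=; case: ifP => // rt.
rewrite -!mulrA; congr (_ * (_ * (_ ^+ _ * _))).
by case: (nat_of_ord t) rt => // t' _; rewrite subSS.
Qed.

Lemma newton_interpolation w m n x : x ^+ m =
  \sum_(k < n) newton_quotient w m k (w k) * \prod_(l < k) (x - w l) +
  newton_quotient w m n x * \prod_(l < n) (x - w l).
Proof.
elim: n => [|n IHn]; first by rewrite !big_ord0 add0r mulr1 newton_quotient0.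
rewrite {}IHn big_ord_recr/= -addrA; congr (_ + _).
by rewrite newton_quotientS mulrDl big_ord_recr/=; ring.
Qed.

End Newton.

(** * Existence of the Schur function as a Laurent polynomial *)

Section SchurExists.
Variables (K : fieldType) (n : nat) (l : n.+1.-tuple int).
Implicit Types u : 'I_n.+1 -> K.

(** Translates all exponents into natural numbers, so that Newton interpolation applies; the
    monomial [u i ^ (- shift)] compensates. *)
Let shift : nat := (\sum_(j < n.+1) absz (mu l j))%N.
Let m (j : 'I_n.+1) : nat := absz (mu l j + shift%:Z).

Let mE j : mu l j = (m j)%:Z - shift%:Z.
Proof.
have : (absz (mu l j) <= shift)%N by rewrite /shift (bigD1 j)//=; exact: leq_addr.
rewrite -lez_nat abszE => js; rewrite /m gez0_abs ?addrK//.
by rewrite -lerBlDl sub0r (le_trans (ler_norm _))// normrN.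
Qed.

Let nodes u (k : nat) : K := u (inord k).

Let H u : 'M[K]_n.+1 :=
  \matrix_(k, j) newton_quotient (nodes u) (m j) k (nodes u k).

Let L u : 'M[K]_n.+1 :=
  \matrix_(i, k) (u i ^ (- shift%:Z) * \prod_(t < k) (u i - nodes u t)).

(** Interpolating the monomials at the coordinates themselves factors the alternant into a lower
    triangular matrix and a matrix of divided differences. The determinant of the first is the
    Vandermonde product up to a sign and a monomial. So the determinant of the second is the
    quotient sought, and it makes sense at repeated coordinates. *)
Let alternantE u : (forall i, u i != 0) ->
  \matrix_(i < n.+1, j < n.+1) u i ^ mu l j = L u *m H u.
Proof.
move=> u0; apply/matrixP => i j; rewrite !mxE mE addrC expfzDr// -exprnP.
rewrite (newton_interpolation (nodes u) (m j) n.+1 (u i)) mulrDr mulr_sumr.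
rewrite (bigD1 (P := xpredT) (F := fun t : 'I_n.+1 => u i - nodes u t) i)//=.
rewrite /nodes inord_val subrr mul0r !mulr0 addr0.
by apply: eq_bigr => k _; rewrite !mxE; ring.
Qed.

Let detL u : \det (L u) = (\prod_i u i ^ (- shift%:Z)) *
  (\prod_(i < n.+1) \prod_(j < n.+1 | (i < j)%N) (-1)) *
  (\prod_(i < n.+1) \prod_(j < n.+1 | (i < j)%N) (u i - u j)).
Proof.
rewrite det_trig; last first.
  apply/is_trig_mxP => i j ij; rewrite mxE (bigD1 (Ordinal ij))//=.
  by rewrite /nodes inord_val subrr mul0r mulr0.
rewrite -mulrA -!big_split/=.
under [in RHS]eq_bigr do rewrite -big_split/=.
under [RHS]eq_bigr do under eq_bigr do rewrite mulN1r opprB.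
rewrite [in RHS]big_split/= (exchange_big_dep xpredT)//= -big_split/=.
apply: eq_bigr => i _; rewrite mxE; congr (_ * _).
rewrite (big_ord_widen n.+1 (fun t => u i - nodes u t)); last exact: ltnW.
by apply: eq_bigr => t _; rewrite /nodes inord_val.
Qed.

Lemma is_laurent_newton k r p :
  is_laurent (fun u => newton_coef (nodes u) p k r).
Proof.
elim: k r => [|k IHk] r /=; first exact: is_laurent_cst.
apply: is_laurent_sum => t; apply: is_laurentM; first exact: IHk.
exact: is_laurentX.
Qed.

Lemma schurP : is_schur l (schur l : ('I_n.+1 -> K) -> K).
Proof.
rewrite /schur; case: xgetP => [s _ //|no]; exfalso.
apply: (no (fun u => (\prod_i u i ^ (- shift%:Z)) *
  (\prod_(i < n.+1) \prod_(j < n.+1 | (i < j)%N) (-1)) * \det (H u))).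
split.
  apply: is_laurentM; last first.
    apply: (is_laurent_det (A := fun k j u =>
      newton_quotient (nodes u) (m j) k (nodes u k))) => k j.
    apply: is_laurent_sum => r; apply: is_laurentM; first exact: is_laurent_newton.
    exact: is_laurentX.
  apply: is_laurentM; last exact: is_laurent_cst.
  by apply: is_laurent_prod => i; exact: is_laurent_exprz.
move=> u u0; rewrite alternantE// det_mulmx detL -!mulrA; do 2 congr (_ * _).
exact: mulrC.
Qed.

End SchurExists.

(** * Alternants with one exceptional row *)

Section Alternants.
Variable K : fieldType.

Definition pairp n (F : 'I_n -> 'I_n -> K) : K :=
  \prod_(i < n) \prod_(j < n | (i < j)%N) F i j.

Lemma ltn_lift n (j : 'I_n.+1) (i k : 'I_n) :
  (lift j i < lift j k)%N = (i < k)%N.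
Proof. by rewrite !ltnNge /= leq_bump2. Qed.

Lemma pairp_lift n (F : 'I_n.+1 -> 'I_n.+1 -> K) (j : 'I_n.+1) : pairp F =
  \prod_(i < n) (if (j <= i)%N then F j (lift j i) else F (lift j i) j) *
  pairp (fun i k => F (lift j i) (lift j k)).
Proof.
have E (i : 'I_n.+1) : \prod_(k < n.+1 | (i < k)%N) F i k =
    (if (i < j)%N then F i j else 1) *
    \prod_(k < n) (if (i < lift j k)%N then F i (lift j k) else 1).
  by rewrite big_mkcond (@bigD1_ord _ _ _ _ j).
have E2 (i : 'I_n) : \prod_(k < n.+1 | (lift j i < k)%N) F (lift j i) k =
    (if (lift j i < j)%N then F (lift j i) j else 1) *
    \prod_(k < n | (i < k)%N) F (lift j i) (lift j k).
  rewrite E [X in _ = _ * X]big_mkcond; congr (_ * _).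
  by apply: eq_bigr => k _; rewrite ltn_lift.
rewrite /pairp (@bigD1_ord _ _ _ _ j)// [RHS]mulrC E ltnn mul1r.
rewrite (eq_bigr _ (fun i _ => E2 i)) big_split/= mulrA -big_split/= mulrC.
congr (_ * _); apply: eq_bigr => i _.
have -> : (j < lift j i)%N = (j <= i)%N.
  by rewrite /= /bump; case: (leqP j i) => ji /=; lia.
have -> : (lift j i < j)%N = ~~ (j <= i)%N.
  by rewrite /= /bump; case: (leqP j i) => ji /=; lia.
by case: (j <= i)%N; rewrite /= ?mulr1 ?mul1r.
Qed.

(** Reconciles the cofactor sign (-1)^j with the signs produced when the pairs containing [j] are
    reordered. *)
Lemma prod_sign_ge n j : (j <= n)%N ->
  (-1) ^+ j * \prod_(i < n) (if (j <= i)%N then -1 else 1) = (-1) ^+ n :> K.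
Proof.
elim: n => [|n IHn]; first by rewrite leqn0 => /eqP ->; rewrite big_ord0 mulr1.
rewrite leq_eqVlt => /predU1P[->|]; last first.
  by rewrite ltnS big_ord_recr/= mulrA => jn; rewrite IHn// jn exprSr.
by rewrite big1 ?mulr1// => i _; rewrite leqNgt ltn_ord.
Qed.

(** In the expansion along row 0 every minor is a Vandermonde determinant with one node removed;
    divided by the full one it leaves the Lagrange weight of that node. *)
Lemma det_alternant_row0 n (phi b : 'I_n.+1 -> K) : injective b ->
  \det (\matrix_(i, j) if unlift ord0 i is Some k then b j ^+ k else phi j) =
  pairp (fun i k => b k - b i) * (-1) ^+ n *
    \sum_j phi j / \prod_(i < n) (b j - b (lift j i)).
Proof.
move=> b_inj; rewrite (expand_det_row _ ord0) mulr_sumr; apply: eq_bigr => j _.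
rewrite mxE unlift_none /cofactor add0n.
have -> : row' ord0 (col' j (\matrix_(i, j) if unlift ord0 i is Some k
    then b j ^+ k else phi j)) = Vandermonde n (\row_k b (lift j k)).
  by apply/matrixP => i k; rewrite !mxE liftK.
have -> : pairp (fun i k => b k - b i) =
    \prod_(i < n) (if (j <= i)%N then -1 else 1) *
    \prod_(i < n) (b j - b (lift j i)) *
    pairp (fun i k => b (lift j k) - b (lift j i)).
  rewrite (pairp_lift _ j); congr (_ * _); rewrite -big_split/=.
  by apply: eq_bigr => i _; case: ifP => _; rewrite ?mul1r ?mulN1r ?opprB.
rewrite det_Vandermonde -(prod_sign_ge (ltn_ord j : (j <= n)%N)).
have -> : \prod_(i < n) \prod_(k < n | (i < k)%N)
    ((\row_k0 b (lift j k0)) 0 k - (\row_k0 b (lift j k0)) 0 i) =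
  pairp (fun i k => b (lift j k) - b (lift j i)).
  by apply: eq_bigr => i _; apply: eq_bigr => k _; rewrite !mxE.
have : \prod_(i < n) (b j - b (lift j i)) != 0.
  apply/prodf_neq0 => i _; rewrite subr_eq0; apply/negP => /eqP/b_inj/eqP.
  by rewrite (negbTE (neq_lift _ _)).
move: (\prod_(i < n) _) (pairp _) => D P D0.
have : \prod_(i < n) (if (j <= i)%N then -1 else 1) ^+ 2 = 1 :> K.
  by rewrite big1// => i _; case: ifP => _; rewrite ?sqrrN expr1n.
rewrite prodrXl; move: (\prod_(i < n) _) => e e2.
rewrite (_ : e * D * P * _ * _ = e ^+ 2 * P * (-1) ^+ j * phi j).
  by rewrite e2; ring.
by field.
Qed.

End Alternants.

(** * Limits of finite sums and products *)

Lemma continuous_dnbhs (R : realType) (f : R -> R) (x : R) :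
  {for x, continuous f} -> f @ x^' --> f x.
Proof. by move/continuous_withinNx. Qed.

Lemma cvg_near_eq (R : realType) (f g : R -> R) (F : set_system R) (l : R) :
  Filter F -> (\forall x \near F, g x = f x) -> f @ F --> l -> g @ F --> l.
Proof.
move=> FF gf fl; apply: cvg_trans fl; apply: near_eq_cvg.
by apply: filterS gf => x ->.
Qed.

Section CvgBig.
Variables (R : realType) (I : Type) (r : seq I) (P : pred I).
Variables (F : set_system R) (f : I -> R -> R) (a : I -> R).
Hypothesis (FF : Filter F) (fa : forall i, P i -> f i @ F --> a i).

Lemma cvg_prodr :
  (fun e => \prod_(i <- r | P i) f i e) @ F --> \prod_(i <- r | P i) a i.
Proof.
elim: r => [|i s IHs].
  by under eq_fun do rewrite big_nil; rewrite big_nil; exact: cvg_cst.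
under eq_fun do rewrite big_cons; rewrite big_cons.
by case: ifP => // Pi; apply: cvgM => //; exact: fa.
Qed.

Lemma cvg_sumr :
  (fun e => \sum_(i <- r | P i) f i e) @ F --> \sum_(i <- r | P i) a i.
Proof.
elim: r => [|i s IHs].
  by under eq_fun do rewrite big_nil; rewrite big_nil; exact: cvg_cst.
under eq_fun do rewrite big_cons; rewrite big_cons.
by case: ifP => // Pi; apply: cvgD => //; exact: fa.
Qed.

End CvgBig.

(** * The normalized Schur function as a sum over the exponents *)

Section SchurValue.
Variables (R : realType) (n : nat) (l : n.+1.-tuple int).
Hypothesis sig : is_signature l.
Implicit Types (e y : R).

Lemma mu_decr (i j : 'I_n.+1) : (i < j)%N -> mu l j < mu l i.
Proof.
move=> ij; rewrite /mu; have := sig (ltnW ij).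
have : (i.+1%:Z < j.+1%:Z) by rewrite ltz_nat.
lia.
Qed.

Let m (j : 'I_n.+1) : R := (mu l j)%:~R.

Lemma mu_inj : injective m.
Proof.
move=> i j /eqP; rewrite /m eqr_int => /eqP e; apply/val_inj/eqP.
by have [/mu_decr|/mu_decr|//] := ltngtP (val i) (val j); rewrite e ltxx.
Qed.

Lemma expR_exprz (t : R) (k : int) : expR t ^ k = expR (t * k%:~R).
Proof.
case: k => k; first by rewrite -exprnP -expRM_natr.
by rewrite NegzE -exprnN -expRM_natr -expRN mulrNz mulrN.
Qed.

(** Continuity gives access to the values at repeated coordinates, where the alternant identity
    reads 0 = 0. *)
Lemma laurent_cvg N (s : ('I_N -> R) -> R) (th : 'I_N -> R -> R) : is_laurent s ->
  (forall i, {for 0, continuous (th i)}) ->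
  (fun e => s (fun i => expR (th i e))) @ 0^' --> s (fun i => expR (th i 0)).
Proof.
move=> [c cP] th_cont.
have E e : s (fun i => expR (th i e)) =
    \sum_(p <- c) p.1 * \prod_(i < N) expR (th i e * (p.2 i)%:~R).
  rewrite cP; last by move=> i; rewrite gt_eqF// expR_gt0.
  by apply: eq_bigr => p _; congr (_ * _); apply: eq_bigr => i _; exact: expR_exprz.
under eq_fun do rewrite E.
rewrite E; apply: cvg_sumr.
move=> p _; apply: cvgM; first exact: cvg_cst.
  apply: cvg_prodr.
move=> i _; apply: (continuous_dnbhs (f := fun e => expR (th i e * (p.2 i)%:~R))).
apply: continuous_comp; last exact: continuous_expR.
by apply: continuousM; [exact: th_cont|exact: cst_continuous].
Qed.

Lemma expR_diff_cvg (a b : R) :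
  (fun e => (expR (e * a) - expR (e * b)) / e) @ 0^' --> a - b.
Proof.
have d : is_derive (0 : R) 1 (fun e => expR (a * e) - expR (b * e)) (a - b).
  have := is_derive1B (is_derive1_expRM a 0) (is_derive1_expRM b 0).
  by move/is_derive1_eq; apply; rewrite !mulr0 expR0 !mulr1.
have := @ex_derive _ _ _ _ _ _ _ d.
rewrite /derivable => /cvg_ex[L HL].
have := @derive_val _ _ _ _ _ _ _ d; rewrite /derive (cvg_lim _ HL)// => LE.
rewrite -LE; apply: cvg_trans HL; apply: near_eq_cvg; near=> e.
rewrite /GRing.scale/= mulr1 addr0 !mulr0 expR0 subrr subr0 mulrC.
by rewrite !(mulrC e).
Unshelve. all: by end_near. Qed.

Lemma expR_ratio_cvg (a b c d : R) : c != d ->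
  (fun e => (expR (e * a) - expR (e * b)) / (expR (e * c) - expR (e * d)))
    @ 0^' --> (a - b) / (c - d).
Proof.
move=> cd; have cd0 : c - d != 0 by rewrite subr_eq0.
have L := cvgM (@expR_diff_cvg a b) (cvgV cd0 (@expR_diff_cvg c d)).
apply: cvg_near_eq (L _ _); near=> e.
have e0 : e != 0 by near: e; exact: nbhs_dnbhs_neq.
by rewrite /= invfM invrK mulrACA mulVf ?mulr1.
Unshelve. all: by end_near. Qed.

Let expR_neq e (a b : R) : e != 0 -> a != b -> expR (e * a) - expR (e * b) != 0.
Proof.
by move=> e0; apply: contra; rewrite subr_eq0 => /eqP/expR_inj/(mulfI e0) ->.
Qed.

Let nat_neq (i j : nat) : (i < j)%N -> i%:R != j%:R :> R.
Proof. by move=> ij; rewrite eqr_nat ltn_eqF. Qed.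

(** At the coordinates e^(e i) the alternant is a Vandermonde determinant in the numbers e^(e mu_j).
    As e tends to 0 the quotient tends to the Weyl dimension formula, a product of nonzero
    factors. *)
Lemma schur1_neq0 : schur l (fun=> 1) != 0 :> R.
Proof.
have [sL sP] := @schurP R n l.
have L := laurent_cvg (th := fun i e => e * (val i)%:R) sL.
have {}L : (fun e => schur l (fun i => expR (e * (val i)%:R))) @ 0^' -->
    (schur l (fun=> 1) : R).
  have -> : (fun=> 1) = (fun i : 'I_n.+1 => expR (0 * (val i)%:R)) :> ('I_n.+1 -> R).
    by apply/funext => i; rewrite mul0r expR0.
  by apply: L => i; apply: continuousM; [exact: cvg_id|exact: cst_continuous].
have L2 : (fun e => pairp (fun i k : 'I_n.+1 => (expR (e * m k) - expR (e * m i)) /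
    (expR (e * (val i)%:R) - expR (e * (val k)%:R)))) @ 0^' -->
    pairp (fun i k : 'I_n.+1 => (m k - m i) / ((val i)%:R - (val k)%:R)).
  apply: cvg_prodr.
  move=> i _; apply: cvg_prodr.
  by move=> k ik; apply: expR_ratio_cvg; exact: nat_neq.
have -> : schur l (fun=> 1) =
    pairp (fun i k : 'I_n.+1 => (m k - m i) / ((val i)%:R - (val k)%:R)) :> R.
  apply: cvg_unique L _ => //; apply: cvg_near_eq L2; near=> e.
  have e0 : e != 0 by near: e; exact: nbhs_dnbhs_neq.
  have := sP (fun i => expR (e * (val i)%:R)).
  have -> : \matrix_(i < n.+1, j < n.+1) expR (e * (val i)%:R) ^ mu l j =
      Vandermonde n.+1 (\row_j expR (e * m j)) :> 'M[R]_n.+1.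
    apply/matrixP => i j; rewrite !mxE expR_exprz -expRM_natr.
    by congr expR; rewrite /m; ring.
  rewrite det_Vandermonde => /(_ (fun i => lt0r_neq0 (expR_gt0 _))).
  have D0 : pairp (fun i k : 'I_n.+1 =>
      expR (e * (val i)%:R) - expR (e * (val k)%:R)) != 0.
    apply/prodf_neq0 => i _; apply/prodf_neq0 => k ik.
    by apply: expR_neq => //; exact: nat_neq.
  move=> H; apply: (mulIf D0); apply: (etrans H).
  rewrite /pairp -big_split/=; apply: eq_bigr => i _.
  rewrite -big_split/=; apply: eq_bigr => k ik; rewrite !mxE divfK//.
  by apply: expR_neq => //; exact: nat_neq.
apply/prodf_neq0 => i _; apply/prodf_neq0 => k ik.
rewrite mulf_neq0 ?invr_eq0// subr_eq0; last exact: nat_neq.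
by apply/negP => /eqP/mu_inj ki; rewrite ki ltnn in ik.
Unshelve. all: by end_near. Qed.

(** The arguments 1 are perturbed to e^(e k) and the first one is kept at e^y; the alternant then
    has geometric rows except one. Dividing by the principal specialization keeps every summand
    finite in the limit. *)
Lemma schur_row_eq y : y != 0 ->
  schur l (fun i : 'I_n.+1 => if val i == 0%N then expR y else 1) *
    (expR y - 1) ^+ n =
  schur l (fun=> 1) * (n`!%:R *
    \sum_j expR (y * m j) / \prod_(i < n) (m j - m (lift j i))).
Proof.
move=> y0; have [sL sP] := @schurP R n l.
pose th (i : 'I_n.+1) e : R :=
  if unlift ord0 i is Some k then e * (val k)%:R else y.
have L1 : (fun e => schur l (fun i => expR (th i e)) *
    \prod_(k < n) (expR y - expR (e * (val k)%:R))) @ 0^' -->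
    schur l (fun i : 'I_n.+1 => if val i == 0%N then expR y else 1) *
    (expR y - 1) ^+ n.
  apply: cvgM.
    have -> : (fun i : 'I_n.+1 => if val i == 0%N then expR y else 1) =
        (fun i => expR (th i 0)).
      apply/funext => i; rewrite /th; case: unliftP => [k ->|->]//=.
      by rewrite mul0r expR0.
    apply: laurent_cvg => // i; rewrite /th.
    case: unlift => [k|]; last exact: cst_continuous.
    by apply: continuousM; [exact: cvg_id|exact: cst_continuous].
  have -> : (expR y - 1) ^+ n = \prod_(k < n) (expR y - expR (0 * (val k)%:R)).
    rewrite (eq_bigr (fun=> expR y - 1)) ?prodr_const ?card_ord// => k _.
    by rewrite mul0r expR0.
  apply: cvg_prodr.
  move=> k _; apply: cvgB; first exact: cvg_cst.
  apply: (continuous_dnbhs (f := fun e => expR (e * (val k)%:R))).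
  apply: continuous_comp; last exact: continuous_expR.
  by apply: continuousM; [exact: cvg_id|exact: cst_continuous].
have L2 : (fun e => schur l (fun i => expR (e * (val i)%:R)) * ((-1) ^+ n *
    \sum_j expR (y * m j) * \prod_(i < n) ((expR (e * (val i)%:R) - expR (e * n%:R)) /
      (expR (e * m j) - expR (e * m (lift j i)))))) @ 0^' -->
    schur l (fun=> 1) * ((-1) ^+ n *
    \sum_j expR (y * m j) * \prod_(i < n) (((val i)%:R - n%:R) / (m j - m (lift j i)))).
  apply: cvgM.
    have -> : (fun=> 1) = (fun i : 'I_n.+1 => expR (0 * (val i)%:R)) :> ('I_n.+1 -> R).
      by apply/funext => i; rewrite mul0r expR0.
    apply: (laurent_cvg (th := fun i e => e * (val i)%:R)) => // i.
    by apply: continuousM; [exact: cvg_id|exact: cst_continuous].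
  apply: cvgM; first exact: cvg_cst.
  apply: cvg_sumr.
move=> j _; apply: cvgM; first exact: cvg_cst.
  apply: cvg_prodr.
  move=> i _; apply: expR_ratio_cvg; apply/negP => /eqP/mu_inj/eqP.
  by rewrite (negbTE (neq_lift _ _)).
have -> : n`!%:R * (\sum_j expR (y * m j) / \prod_(i < n) (m j - m (lift j i))) =
  (-1) ^+ n * \sum_j expR (y * m j) *
    \prod_(i < n) (((val i)%:R - n%:R) / (m j - m (lift j i))).
  have -> : n`!%:R = (-1) ^+ n * \prod_(i < n) ((val i)%:R - n%:R) :> R.
    rewrite -[X in (-1) ^+ X]card_ord -prodr_const -big_split/=.
    rewrite (reindex_inj rev_ord_inj)/= fact_prod natr_prod big_add1 big_mkord.
    apply: eq_bigr => i _; rewrite mulN1r opprB natrB//.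
    by rewrite -addn1 natrD; ring.
  rewrite -mulrA mulr_sumr; congr (_ * _); apply: eq_bigr => j _.
  by rewrite mulrCA big_split/= prodfV.
apply: cvg_unique L1 _ => //; apply: cvg_near_eq L2; near=> e.
have e0 : e != 0 by near: e; exact: nbhs_dnbhs_neq.
pose b j := expR (e * m j).
have b_inj : injective b.
  by move=> i j /expR_inj/(mulfI e0)/mu_inj.
have Hv := sP (fun i => expR (e * (val i)%:R)) (fun i => lt0r_neq0 (expR_gt0 _)).
have Hu := sP (fun i => expR (th i e)) (fun i => lt0r_neq0 (expR_gt0 _)).
have Mv : \matrix_(i < n.+1, j < n.+1) expR (e * (val i)%:R) ^ mu l j =
    Vandermonde n.+1 (\row_j b j) :> 'M[R]_n.+1.
  apply/matrixP => i j; rewrite !mxE expR_exprz -expRM_natr.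
  by congr expR; rewrite /m; ring.
have Mu : \matrix_(i < n.+1, j < n.+1) expR (th i e) ^ mu l j =
    \matrix_(i, j) if unlift ord0 i is Some k then b j ^+ k else expR (y * m j).
  apply/matrixP => i j; rewrite !mxE expR_exprz /th.
  case: unlift => [k|//]; rewrite -expRM_natr.
  by congr expR; rewrite /m; ring.
rewrite Mv det_Vandermonde in Hv; rewrite Mu det_alternant_row0// in Hu.
set P := pairp (fun i k : 'I_n => expR (e * (val i)%:R) - expR (e * (val k)%:R)).
have P0 : P != 0.
  apply/prodf_neq0 => i _; apply/prodf_neq0 => k ik.
  by apply: expR_neq => //; exact: nat_neq.
(* Splitting off the last node leaves the Vandermonde product [P] of n nodes, common to both sides.
   The n factors split off balance the n vanishing denominators of each summand. *)
have Pv : pairp (fun i k : 'I_n.+1 => expR (e * (val i)%:R) - expR (e * (val k)%:R)) =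
    \prod_(i < n) (expR (e * (val i)%:R) - expR (e * n%:R)) * P.
  rewrite (pairp_lift _ ord_max); congr (_ * _).
    apply: eq_bigr => i _; rewrite ifN -?ltnNge//.
    by congr (expR (e * _%:R) - expR _); exact: lift_max.
  apply: eq_bigr => i _; apply: eq_bigr => k _.
  by congr (expR (e * _%:R) - expR (e * _%:R)); exact: lift_max.
have Pu : pairp (fun i k : 'I_n.+1 => expR (th i e) - expR (th k e)) =
    \prod_(k < n) (expR y - expR (e * (val k)%:R)) * P.
  rewrite (pairp_lift _ ord0); congr (_ * _).
    by apply: eq_bigr => i _; rewrite /th unlift_none liftK.
  apply: eq_bigr => i _; apply: eq_bigr => k _.
  by rewrite /th !liftK.
apply: (mulIf P0); rewrite -[LHS]mulrA -Pu; apply: (etrans Hu).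
have <- : schur l (fun i : 'I_n.+1 => expR (e * (val i)%:R)) *
    pairp (fun i k : 'I_n.+1 => expR (e * (val i)%:R) - expR (e * (val k)%:R)) =
    pairp (fun i k => b k - b i).
  by rewrite [LHS]Hv; apply: eq_bigr => i _; apply: eq_bigr => k _; rewrite !mxE.
rewrite Pv -!mulrA; congr (_ * _); rewrite mulr_suml !mulr_sumr.
by apply: eq_bigr => j _; rewrite big_split/= prodfV; ring.
Unshelve. all: by end_near. Qed.

Lemma schur_normalizedE y : y != 0 -> schur_normalized l (expR y) =
  n`!%:R / (expR y - 1) ^+ n *
  \sum_j expR (y * m j) / \prod_(i < n) (m j - m (lift j i)).
Proof.
move=> y0; have := schur_row_eq y0; have := schur1_neq0.
rewrite /schur_normalized => s1 E.
have x1 : (expR y - 1) ^+ n != 0.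
  by rewrite expf_neq0// subr_eq0 -expR0; apply: contra y0 => /eqP/expR_inj ->.
apply: (mulIf x1); rewrite mulrAC E mulrAC mulfV// mul1r.
by rewrite mulrAC mulfVK.
Qed.

End SchurValue.

(** * Explicit density for distinct rates *)

Section HypoExplicit.
Variable R : realType.

(** The divided difference of a constant at two or more nodes vanishes: in [det_alternant_row0] the
    exceptional row of ones repeats the row of zeroth powers. *)
Lemma sum_inv_prodB n (b : 'I_n.+2 -> R) : injective b ->
  \sum_(j < n.+2) (\prod_(i < n.+1) (b (lift j i) - b j))^-1 = 0.
Proof.
move=> b_inj; have := det_alternant_row0 (fun=> 1) b_inj.
rewrite (determinant_alternate (i1 := ord0) (i2 := lift ord0 ord0))//; last first.
  by move=> j; rewrite !mxE unlift_none liftK expr0.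
move/esym/eqP; rewrite !mulf_eq0 signr_eq0 orbF => /orP[|/eqP E].
  move=> /prodf_eq0[i _] /prodf_eq0[j ij]; rewrite subr_eq0 => /eqP/b_inj e.
  by rewrite e ltnn in ij.
have := congr1 ( *%R ((-1) ^+ n.+1)) E; rewrite mulr0 mulr_sumr => E'.
apply: etrans E'; apply: eq_bigr => j _.
rewrite mul1r -[X in (-1) ^+ X]card_ord -prodr_const -!prodfV -big_split/=.
by apply: eq_bigr => i _; rewrite -[RHS]invrK invfM invrN invr1 mulN1r invrK opprB.
Qed.

(** The formula is checked against the equation and the initial value that characterize the density;
    the initial value is 0 by [sum_inv_prodB]. *)
Lemma hypo_explicit n (a : 'I_n.+1 -> R) (t : R) :
  injective a -> (forall i, 0 < a i) ->
  hypo [seq (a i)^-1 | i <- enum 'I_n.+1] 0 t =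
  \sum_(j < n.+1) expR (- a j * t) *
    (\prod_i a i / \prod_(i < n) (a (lift j i) - a j)).
Proof.
elim: n a t => [|n IHn] a t a_inj a0.
  have -> : enum 'I_1 = [:: ord0] by rewrite enum_ordSl (size0nil (size_enum_ord 0)).
  have /= -> // : hypo [:: (a ord0)^-1] 0 =
    (fun t => \sum_(j < 1) expR (- a j * t) *
      (\prod_i a i / \prod_(i < 0) (a (lift j i) - a j))).
  apply: hypo_unique.
  - by rewrite /positive/= invr_gt0 a0.
  - move=> u; have := is_derive1Z (a ord0) (is_derive1_expRM (- a ord0) u).
    rewrite (_ : (fun _ => _) = (fun t => \sum_(j < 1) expR (- a j * t) *
      (\prod_i a i / \prod_(i < 0) (a (lift j i) - a j)))).
      move/is_derive1_eq; apply; rewrite hypo_nil invrK.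
      by rewrite !big_ord_recl !big_ord0; field.
    by apply/funext => v; rewrite !big_ord_recl !big_ord0; field.
  - by rewrite !big_ord_recl !big_ord0 mulr0 expR0 invrK; field.
rewrite enum_ordSl /= -map_comp.
pose a' := a \o lift ord0.
have a'_inj : injective a' by exact: inj_comp a_inj (@lift_inj _ _).
have pos' : positive [seq (a' i)^-1 | i <- enum 'I_n.+1].
  by apply/allP => _ /mapP[i _ ->]; rewrite invr_gt0; exact: a0.
rewrite (_ : [seq _ | i <- enum 'I_n.+1] = [seq (a' i)^-1 | i <- enum 'I_n.+1])//.
pose W (j : 'I_n.+2) := \prod_i a i / \prod_(i < n.+1) (a (lift j i) - a j).
have -> // : hypo ((a ord0)^-1 :: [seq (a' i)^-1 | i <- enum 'I_n.+1]) 0 =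
    (fun t => \sum_j expR (- a j * t) * W j).
apply: hypo_unique.
- by apply/andP; split; first rewrite invr_gt0.
- move=> u; rewrite (IHn a')//; last by move=> i; exact: a0.
  have H : is_derive u 1 (fun t => \sum_j expR (- a j * t) * W j)
      (\sum_j (- a j * expR (- a j * u) * W j)).
    rewrite (_ : (fun _ => _) =
      \sum_j (fun t => expR (- a j * t) * W j)); last first.
      by apply/funext => v; rewrite fct_sumE.
    apply: is_derive_sum => j.
    have := is_derive1M (is_derive1_expRM (- a j) u) (is_derive1_cst (W j) u).
    by move/is_derive1_eq; apply; rewrite mulr0 addr0.
  apply: is_derive1_eq H _; rewrite invrK; apply/eqP.
  rewrite mulrBl eq_sym subr_eq !mulr_suml -big_split [eqbRHS]big_ord_recl.
  (* The summand with rate [a ord0] solves the homogeneous equation and drops out. *)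
  rewrite [X in _ == X + _](_ : _ = 0) ?add0r; last by rewrite /=; ring.
  apply/eqP/eq_bigr => j _.
  have Wj : W (lift ord0 j) = a ord0 * \prod_i a' i /
      ((a ord0 - a' j) * \prod_(i < n) (a' (lift j i) - a' j)).
    rewrite /W big_ord_recl; congr (_ / _); first by rewrite big_ord_recl.
    congr (_ * _); first by congr (a _ - _); exact: val_inj.
    apply: eq_bigr => i _; congr (a _ - _); apply: val_inj => /=.
    by rewrite /bump /= !add1n ltnS addnS.
  have D : a ord0 - a' j != 0.
    by rewrite subr_eq0; apply/negP => /eqP/a_inj/eqP; rewrite (negbTE (neq_lift _ _)).
  have D2 : \prod_(i < n) (a' (lift j i) - a' j) != 0.
    apply/prodf_neq0 => i _; rewrite subr_eq0 eq_sym.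
    by apply/negP => /eqP/a'_inj/eqP; rewrite (negbTE (neq_lift _ _)).
  rewrite /= {}Wj; change (a (lift ord0 j)) with (a' j); move: D D2.
  move: (\prod_(i < n) _) (\prod_i _) (expR _) => x y z D D2.
  by field; rewrite D D2.
- under eq_bigr do rewrite mulr0 expR0 mul1r.
  rewrite -mulr_sumr sum_inv_prodB// mulr0.
  by case: (enum _) (size_enum_ord n.+1).
Qed.

End HypoExplicit.

(** * Integrals of functions of [fhat] *)

Section Average.
Variables (R : realType) (f : R -> R).
Hypothesis f_decr : {in `[0, 1]%R &, forall s t : R, s <= t -> f t <= f s}.
Implicit Types (g h : R -> R) (w x t M : R).

Notation lo := (fhat f 1).
Notation hi := (fhat f 0).

Lemma fhat_decr s t : 0 <= s -> s <= t -> t <= 1 -> fhat f t <= fhat f s.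
Proof.
move=> s0 st t1; rewrite /fhat.
have := @f_decr s t; rewrite !in_itv/= s0 t1 (le_trans st t1).
by rewrite (le_trans s0 st) => /(_ isT isT st); lra.
Qed.

Lemma fhat_range t : 0 <= t <= 1 -> lo <= fhat f t <= hi.
Proof. by move=> /andP[t0 t1]; rewrite !fhat_decr. Qed.

Lemma fhat_lo_hi : lo <= hi.
Proof. by apply: fhat_decr. Qed.

Definition avg g : R := \int[lebesgue_measure]_(t in `[0, 1]) g (fhat f t).

Definition cont_range g := forall x, lo <= x <= hi -> {for x, continuous g}.

Lemma measurable_fhat : measurable_fun (`[0, 1]%classic : set R) (fhat f).
Proof.
(* Clipping the argument extends [fhat] to a monotone function on the whole line, which is therefore
   measurable. *)
pose clip t : R := Num.max 0 (Num.min 1 t).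
have clip01 t : 0 <= clip t <= 1.
  by rewrite /clip le_max lexx/= ge_max ler01 ge_min lexx.
have : measurable_fun (`[0, 1]%classic : set R) (fhat f \o clip).
  apply: nonincreasing_measurable => // s t st /=.
  have /andP[s0 s1] := clip01 s; have /andP[t0 t1] := clip01 t.
  apply: fhat_decr => //; rewrite /clip ge_max !le_max lexx/= le_min !ge_min.
  by rewrite lexx st !orbT.
apply: eq_measurable_fun => t; rewrite inE/= in_itv/= => /andP[t0 t1].
by rewrite /clip (min_idPr t1) (max_idPr t0).
Qed.

Lemma avg_integrable g : cont_range g ->
  lebesgue_measure.-integrable (`[0, 1]%classic : set R) (EFin \o (fun t => g (fhat f t))).
Proof.
move=> cg; have cgw : {within `[lo, hi], continuous g}.
  apply: continuous_in_subspaceT => x; rewrite inE/= in_itv/=.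
  exact: cg.
have [x xJ gM] := EVT_max fhat_lo_hi cgw.
have [y yJ gm] := EVT_min fhat_lo_hi cgw.
have sub : fhat f @` `[0, 1]%classic `<=` `[lo, hi]%classic.
  move=> _ /= [t + <-]; rewrite !in_itv/= => t01.
  exact: fhat_range.
apply: measurable_bounded_integrable => //.
- by rewrite /= lebesgue_measure_itv/= lte01 -EFinB ltry.
- apply: (measurable_comp (F := `[lo, hi]%classic)) => //; last exact: measurable_fhat.
  by apply: subspace_continuous_measurable_fun.
- exists (`|g x| + `|g y|); split; first exact: num_real.
  move=> M ltM t /=; rewrite in_itv/= => t01; apply: le_trans (ltW ltM).
  have tJ : fhat f t \in `[lo, hi]%R by rewrite in_itv/=; exact: fhat_range.
  rewrite ler_norml; apply/andP; split.
    rewrite lerNl; apply: (@le_trans _ _ (- g y)); first by rewrite lerN2 gm.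
    by rewrite (le_trans (ler_norm _))// normrN lerDr.
  by rewrite (le_trans (gM _ tJ))// (le_trans (ler_norm _))// lerDl.
Qed.

Lemma eq_avg g h : (forall x, lo <= x <= hi -> g x = h x) -> avg g = avg h.
Proof.
move=> gh; apply: eq_Rintegral => t; rewrite inE/= in_itv/= => t01.
by apply: gh; exact: fhat_range.
Qed.

Lemma avgD g h : cont_range g -> cont_range h ->
  avg (fun x => g x + h x) = avg g + avg h.
Proof. by move=> cg ch; apply: RintegralD => //; exact: avg_integrable. Qed.

Lemma avgB g h : cont_range g -> cont_range h ->
  avg (fun x => g x - h x) = avg g - avg h.
Proof. by move=> cg ch; apply: RintegralB => //; exact: avg_integrable. Qed.

Lemma avgZ k g : cont_range g -> avg (fun x => k * g x) = k * avg g.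
Proof. by move=> cg; apply: RintegralZl => //; exact: avg_integrable. Qed.

Lemma avg_cst k : avg (fun=> k) = k.
Proof.
rewrite /avg Rintegral_cst//= lebesgue_measure_itv/= lte01 -EFinB/=.
by rewrite subr0 mulr1.
Qed.

Lemma cont_range_cst k : cont_range (fun=> k).
Proof. by move=> x _; exact: cst_continuous. Qed.

Lemma le_avg g h : cont_range g -> cont_range h ->
  (forall x, lo <= x <= hi -> g x <= h x) -> avg g <= avg h.
Proof.
move=> cg ch gh; apply: le_Rintegral => //; try exact: avg_integrable.
by move=> t; rewrite /= in_itv/= => t01; apply: gh; exact: fhat_range.
Qed.

Lemma avg_le_norm g M : cont_range g ->
  (forall x, lo <= x <= hi -> `|g x| <= M) -> `|avg g| <= M.
Proof.
move=> cg gM; rewrite ler_norml -[- M]avg_cst -[M]avg_cst !le_avg//.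
- exact: cont_range_cst.
- by move=> x /gM; apply: le_trans; exact: ler_norm.
- exact: cont_range_cst.
- by move=> x /gM; rewrite ler_norml avg_cst => /andP[].
Qed.

End Average.

(** * Second order expansion of the real logarithm *)

Section LogTaylor.
Variable R : realType.
Implicit Types (w x h d z : R).

Lemma ln1D_taylor z : `|z| <= 2^-1 ->
  `|ln (1 + z) - z + z ^+ 2 / 2| <= 2 * `|z| ^+ 3.
Proof.
move=> z2; pose F (u : R) := ln (1 + u) - u + 2^-1 * u ^+ 2.
have dF (u : R) : `|u| <= `|z| -> is_derive u 1 F (u ^+ 2 / (1 + u)).
  move=> uz; have u1 : -1 < u.
    by have := ler_norm (- u); rewrite normrN; lra.
  have := is_derive1D (is_derive1B (is_derive1_ln1D u1) (is_derive_id u (1 : R)))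
    (is_derive1Z 2^-1 (is_derive1X 1 u)).
  move/is_derive1_eq; apply; field.
  by rewrite gt_eqF// -ltrBlDl sub0r.
have bF (u : R) : `|u| <= `|z| -> `|u ^+ 2 / (1 + u)| <= 2 * `|z| ^+ 2.
  move=> uz; have u1 : 2^-1 <= 1 + u.
    by have := ler_norm (- u); rewrite normrN; lra.
  have u0 : 0 < 1 + u by lra.
  rewrite normrM normfV (gtr0_norm u0) normrX ler_pdivrMr//.
  have : `|u| ^+ 2 <= `|z| ^+ 2 by rewrite lerXn2r ?nnegrE.
  have := sqr_ge0 `|z|; nra.
have F0 : F 0 = 0 by rewrite /F addr0 ln1; ring.
have -> : ln (1 + z) - z + z ^+ 2 / 2 = F z - F 0.
  by rewrite F0 subr0 /F (mulrC 2^-1).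
have -> : 2 * `|z| ^+ 3 = 2 * `|z| ^+ 2 * `|z| by ring.
have [z0|z0] := leP 0 z.
  have E : 2 * `|z| ^+ 2 * `|z| = 2 * `|z| ^+ 2 * (z - 0) by rewrite subr0 [X in _ * X = _]ger0_norm.
  rewrite {}E; apply: (@le_is_derive1_norm R F (fun u => u ^+ 2 / (1 + u)) 0 z _ _ _ z0).
    by move=> u /andP[u0 uz]; apply: dF; rewrite !ger0_norm.
  by move=> u /andP[u0 uz]; apply: bF; rewrite !ger0_norm.
have E : 2 * `|z| ^+ 2 * `|z| = 2 * `|z| ^+ 2 * (0 - z).
  by rewrite sub0r [X in _ * X = _]ltr0_norm.
rewrite {}E distrC.
apply: (@le_is_derive1_norm R F (fun u => u ^+ 2 / (1 + u)) z 0 _ _ _ (ltW z0)).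
  by move=> u /andP[zu u0]; apply: dF; rewrite !ler0_norm ?lerN2// ltW.
by move=> u /andP[zu u0]; apply: bF; rewrite !ler0_norm ?lerN2// ltW.
Qed.

Lemma ln_dist_taylor w x h d : 0 < d -> d <= `|w - x| -> `|h| <= d / 2 ->
  `|ln `|w + h - x| - ln `|w - x| - h * (w - x)^-1 + h ^+ 2 / 2 * (w - x) ^- 2| <=
  2 * `|h| ^+ 3 / d ^+ 3.
Proof.
move=> d0 dwx hd; have wx0 : 0 < `|w - x| by exact: lt_le_trans dwx.
have wx : w - x != 0 by rewrite -normr_gt0.
pose z := h / (w - x).
have zd : `|z| <= `|h| / d by rewrite normrM normfV ler_wpM2l// lef_pV2.
have z2 : `|z| <= 2^-1 by apply: le_trans zd _; rewrite ler_pdivrMr// mulrC.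
have z1 : 0 < 1 + z by have := ler_norm (- z); rewrite normrN; lra.
have -> : `|w + h - x| = `|w - x| * (1 + z).
  rewrite -[1 + z]gtr0_norm// -normrM /z; congr `| _ |.
  by field.
rewrite lnM ?posrE// [ln _ + _]addrC addrK.
apply: le_trans (_ : 2 * `|z| ^+ 3 <= _); last first.
  rewrite -mulrA ler_wpM2l// -expr_div_n lerXn2r ?nnegrE//.
  by rewrite divr_ge0// ltW.
have := ln1D_taylor z2; rewrite /z expr_div_n.
by rewrite [_ / _ / 2]mulrAC.
Qed.

End LogTaylor.

(** * The complex logarithm and complex derivatives *)

Section ComplexLog.
Variable R : realType.
Implicit Types (z k w : R[i]) (d x y : R).

Local Notation Re := complex.Re.
Local Notation Im := complex.Im.
Local Notation normc := Normc.normc.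

Lemma ReD z k : Re (z + k) = Re z + Re k. Proof. by case: z k => ? ? []. Qed.
Lemma ImD z k : Im (z + k) = Im z + Im k. Proof. by case: z k => ? ? []. Qed.
Lemma ReB z k : Re (z - k) = Re z - Re k. Proof. by case: z k => ? ? []. Qed.
Lemma ImB z k : Im (z - k) = Im z - Im k. Proof. by case: z k => ? ? []. Qed.

Lemma normr_Re_le z : `|Re z| <= normc z.
Proof.
by case: z => a b /=; rewrite -[leLHS]sqrtr_sqr ler_wsqrtr// lerDl sqr_ge0.
Qed.

Lemma normr_Im_le z : `|Im z| <= normc z.
Proof.
by case: z => a b /=; rewrite -[leLHS]sqrtr_sqr ler_wsqrtr// lerDr sqr_ge0.
Qed.

Lemma normc_ge0 z : 0 <= normc z.
Proof. by rewrite (le_trans _ (normr_Re_le z)). Qed.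

Lemma normc_opp z : normc (- z) = normc z.
Proof. by case: z => a b /=; rewrite !sqrrN. Qed.

Lemma normc_le_ReIm z : normc z <= `|Re z| + `|Im z|.
Proof.
case: z => a b /=; rewrite -[leRHS]ger0_norm ?addr_ge0// -sqrtr_sqr ler_wsqrtr//.
rewrite sqrrD !real_normK ?num_real// lerD2r lerDl.
by rewrite mulrn_wge0// mulr_ge0.
Qed.

Lemma normc_real x : normc x%:C = `|x|.
Proof. by rewrite /= expr0n addr0 sqrtr_sqr. Qed.

(* A logarithm on each of the half-planes Re z > 0 and Re z < 0, invariant
   under z -> - z. *)
Definition half_log z : R[i] :=
  (2^-1 * ln (Re z ^+ 2 + Im z ^+ 2)) +i* atan (Im z / Re z).

Lemma half_logN z : half_log (- z) = half_log z.
Proof. by case: z => a b; rewrite /half_log/= !sqrrN invrN mulrNN. Qed.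

Lemma lnc_half_log z : 0 < Re z -> lnc z = half_log z.
Proof.
case: z => a b /= a0; rewrite /lnc /half_log /argc/=.
have n0 : 0 < a ^+ 2 + b ^+ 2 by rewrite ltr_pwDl ?exprn_gt0 ?sqr_ge0.
have E1 : ln (Num.sqrt (a ^+ 2 + b ^+ 2)) = 2^-1 * ln (a ^+ 2 + b ^+ 2).
  rewrite -[X in _ = _ * ln X]sqr_sqrtr; last exact: ltW.
  by rewrite lnXn ?sqrtr_gt0//; field.
have E2 : a / Num.sqrt (a ^+ 2 + b ^+ 2) = cos (atan (b / a)).
  rewrite cos_atan; have -> : a ^+ 2 + b ^+ 2 = a ^+ 2 * (1 + (b / a) ^+ 2).
    by field; rewrite gt_eqF.
  rewrite sqrtrM ?sqr_ge0// sqrtr_sqr (gtr0_norm a0) invfM mulrA.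
  by rewrite mulfV ?gt_eqF// mul1r.
rewrite E1; congr (_ +i* _).
have pi0 := pi_gt0 R.
have h2 := atan_gtNpi2 (b / a); have h1 := atan_ltpi2 (b / a).
have [b0|b0] := leP 0 b; rewrite E2.
  rewrite cosK// in_itv/= -{1}(@atan0 R) le_atan ?divr_ge0 ?(ltW a0)//=.
  by lra.
rewrite -cosN cosK ?opprK// in_itv/= oppr_ge0 -{1}(@atan0 R).
rewrite le_atan ?pmulr_lle0 ?invr_gt0 ?(ltW b0)//=.
by lra.
Qed.

(** The real and imaginary parts of [half_log (z + s k) - s k / z] are real functions of s on
    [0, 1], with derivatives the parts of k/(z + s k) - k/z; the mean value bound applies to
    each. *)
Lemma half_log_taylor z k d : 0 < d -> d <= `|Re z| -> normc k <= d / 2 ->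
  normc (half_log (z + k) - half_log z - k / z) <= 4 * normc k ^+ 2 / d ^+ 2.
Proof.
move=> d0 dz kd.
(* The whole segment from z to z + k stays away from the imaginary axis. *)
have Z (s : R) : 0 <= s <= 1 -> d / 2 <= `|Re (z + s%:C * k)|.
  move=> /andP[s0 s1].
  have : `|Re (s%:C * k)| <= d / 2.
    apply: le_trans kd; apply: le_trans (normr_Re_le _) _.
    by rewrite Normc.normcM normc_real ger0_norm// ler_piMl ?normc_ge0.
  rewrite ReD; have := ler_normB (Re z + Re (s%:C * k)) (Re (s%:C * k)).
  by rewrite addrK; move: dz; lra.
have zn0 : z != 0.
  by apply/negP => /eqP z0; move: dz; rewrite z0/= normr0 leNgt d0.
have B (s : R) : 0 <= s <= 1 ->
    normc (k / (z + s%:C * k) - k / z) <= 2 * normc k ^+ 2 / d ^+ 2.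
  move=> s01; have Zs := Z _ s01; have /andP[s0 s1] := s01.
  have zsn0 : z + s%:C * k != 0.
    apply/negP => /eqP e; move: Zs; rewrite e/= normr0 leNgt.
    by rewrite divr_gt0.
  have -> : k / (z + s%:C * k) - k / z = - (s%:C * (k * k)) / ((z + s%:C * k) * z).
    by field; rewrite zsn0 zn0.
  rewrite Normc.normcM Normc.normcV normc_opp !Normc.normcM normc_real ger0_norm//.
  have zz : d ^+ 2 / 2 <= normc (z + s%:C * k) * normc z.
    have -> : d ^+ 2 / 2 = d / 2 * d by ring.
    apply: ler_pM; rewrite ?divr_ge0 ?(ltW d0)//.
      exact: le_trans Zs (normr_Re_le _).
    exact: le_trans dz (normr_Re_le _).
  have d2 : 0 < d ^+ 2 / 2 by rewrite divr_gt0 ?exprn_gt0.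
  rewrite ler_pdivrMr ?(lt_le_trans d2)//.
  apply: le_trans (ler_wpM2l _ zz); last first.
    by apply: divr_ge0; rewrite ?sqr_ge0//; apply: mulr_ge0; rewrite ?sqr_ge0.
  rewrite (_ : _ * (d ^+ 2 / 2) = 1 * (normc k * normc k)); last first.
    by field; rewrite gt_eqF.
  by rewrite ler_wpM2r ?mulr_ge0 ?normc_ge0.
case: z k dz kd Z zn0 B => [x y] [a b] dz kd Z zn0 B.
pose p (s : R) := x + s * a; pose q (s : R) := y + s * b.
have ps (s : R) : (x +i* y) + s%:C * (a +i* b) = p s +i* q s.
  by rewrite /p /q; simpc.
have p0 (s : R) : 0 <= s <= 1 -> p s != 0.
  move=> s01; have := Z _ s01; rewrite ps/= => h.
  by rewrite -normr_gt0 (lt_le_trans _ h)// divr_gt0.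
have dp (s : R) : is_derive s 1 p a.
  have := is_derive1D (is_derive1_cst x s) (is_derive1Z a (is_derive_id s (1 : R))).
  under eq_fun do rewrite mulrC.
  by move/is_derive1_eq; apply; rewrite add0r mulr1.
have dq (s : R) : is_derive s 1 q b.
  have := is_derive1D (is_derive1_cst y s) (is_derive1Z b (is_derive_id s (1 : R))).
  under eq_fun do rewrite mulrC.
  by move/is_derive1_eq; apply; rewrite add0r mulr1.
have [c cE] : exists c, c = (a +i* b) / (x +i* y) by eexists.
have kE (s : R) : 0 <= s <= 1 -> (a +i* b) / (p s +i* q s) =
    ((a * p s + b * q s) / (p s ^+ 2 + q s ^+ 2)) +i*
    ((b * p s - a * q s) / (p s ^+ 2 + q s ^+ 2)).
  move=> s01; have n0 : p s ^+ 2 + q s ^+ 2 != 0.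
    by rewrite gt_eqF// ltr_pwDl ?sqr_ge0// exprn_even_gt0 ?p0.
  have pq : p s +i* q s != 0.
    by apply/negP => /eqP[e _]; move: (p0 _ s01); rewrite e eqxx.
  apply: (mulIf pq); rewrite divfK//; simpc.
  by congr (_ +i* _); field.
pose f1 (s : R) := 2^-1 * ln (p s ^+ 2 + q s ^+ 2) - s * Re c.
pose f2 (s : R) := atan (q s / p s) - s * Im c.
have d1 (s : R) : 0 <= s <= 1 ->
    is_derive s 1 f1 (Re ((a +i* b) / (p s +i* q s) - c)).
  move=> s01; rewrite ReB kE// [Re (_ +i* _)]/=.
  have n0 : 0 < p s * p s + q s * q s.
    by rewrite -!expr2 ltr_pwDl ?sqr_ge0// exprn_even_gt0 ?p0.
  have dn := is_derive1D (is_derive1M (dp s) (dp s)) (is_derive1M (dq s) (dq s)).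
  have := is_derive1B (is_derive1Z 2^-1
    (@is_derive1_comp R (@ln R) _ s _ _ (is_derive1_ln n0) dn))
    (is_derive1M (is_derive_id s (1 : R)) (is_derive1_cst (Re c) s)).
  move/is_derive1_eq; apply; field.
  by rewrite expr2 expr2 gt_eqF.
have d2 (s : R) : 0 <= s <= 1 ->
    is_derive s 1 f2 (Im ((a +i* b) / (p s +i* q s) - c)).
  move=> s01; rewrite ImB kE// [Im (_ +i* _)]/=.
  have n0 : p s ^+ 2 + q s ^+ 2 != 0.
    by rewrite gt_eqF// ltr_pwDl ?sqr_ge0// exprn_even_gt0 ?p0.
  have dn := is_derive1M (dq s) (is_derive1V (p0 _ s01) (dp s)).
  have := is_derive1B
    (@is_derive1_comp R (@atan R) _ s _ _ (is_derive1_atan _) dn)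
    (is_derive1M (is_derive_id s (1 : R)) (is_derive1_cst (Im c) s)).
  move/is_derive1_eq; apply; have := p0 _ s01; move: (p s) (q s) n0 => P Q n0 P0.
  by field; rewrite n0 P0.
have H1 : `|f1 1 - f1 0| <= 2 * normc (a +i* b) ^+ 2 / d ^+ 2 * (1 - 0).
  apply: (le_is_derive1_norm d1) => // s s01.
  by apply: le_trans (normr_Re_le _) _; rewrite cE -ps; exact: B.
have H2 : `|f2 1 - f2 0| <= 2 * normc (a +i* b) ^+ 2 / d ^+ 2 * (1 - 0).
  apply: (le_is_derive1_norm d2) => // s s01.
  by apply: le_trans (normr_Im_le _) _; rewrite cE -ps; exact: B.
apply: le_trans (normc_le_ReIm _) _.
have -> : 4 * normc (a +i* b) ^+ 2 / d ^+ 2 =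
  2 * normc (a +i* b) ^+ 2 / d ^+ 2 * (1 - 0) +
  2 * normc (a +i* b) ^+ 2 / d ^+ 2 * (1 - 0) by rewrite subr0; ring.
have E1 : (x +i* y) + (a +i* b) = p 1 +i* q 1 by rewrite /p /q !mul1r; simpc.
have E0 : x +i* y = p 0 +i* q 0 by rewrite /p /q !mul0r !addr0.
apply: lerD.
  apply: le_trans H1; rewrite !ReB E1 -cE {1}E0 /half_log/= /f1.
  by rewrite mul1r mul0r subr0 addrAC.
apply: le_trans H2; rewrite !ImB E1 -cE {1}E0 /half_log/= /f2.
by rewrite mul1r mul0r subr0 addrAC.
Qed.

(** Reduces a complex derivative to a quadratic bound on the remainder, which can be integrated over
    [t]. *)
Lemma derive1_taylor (F : R[i] -> R[i]) w (L : R[i]) (C d : R) : 0 < d ->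
  (forall k, normc k <= d ->
     normc (F (w + k) - F w - k * L) <= C * normc k ^+ 2) ->
  (F^`())%classic w = L.
Proof.
move=> d0 FC; apply: cvg_lim => //.
apply/cvgrPdist_le => /= e e0.
have eE : e = (Re e)%:C by rewrite RRe_real// gtr0_real.
have e0' : 0 < Re e by move: e0; rewrite ltcE => /andP[].
pose r := Num.min d (Re e / (`|C| + 1)).
have C1 : 0 < `|C| + 1 by rewrite ltr_wpDl.
have r0 : 0 < r by rewrite lt_min d0 divr_gt0.
near=> k.
have k0 : k != 0 by near: k; exact: nbhs_dnbhs_neq.
have kr : normc k <= r.
  have : `|k| <= r%:C.
    by near: k; apply: dnbhs0_le; rewrite ltcE/= eqxx.
  by rewrite normc_def lecE/= => /andP[_]; case: (k).
have kd : normc k <= d by rewrite (le_trans kr)// ge_min lexx.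
have := FC _ kd; set D := F (w + k) - F w - k * L => DC.
have -> : L - k^-1 *: (F (k + w) - F w) = - (k^-1 * D).
  by rewrite /D /GRing.scale/= (addrC k); field.
rewrite normrN normc_def eE lecE/= eqxx/=.
have nE z : Num.sqrt (Re z ^+ 2 + Im z ^+ 2) = normc z by case: z.
rewrite nE Normc.normcM Normc.normcV.
have nk0 : 0 < normc k.
  rewrite lt_neqAle normc_ge0 andbT eq_sym; apply: contra k0 => /eqP.
  by move/Normc.eq0_normc => ->.
rewrite mulrC ler_pdivrMr//; apply: le_trans DC _.
rewrite expr2 mulrA ler_wpM2r ?normc_ge0//.
apply: le_trans (_ : (`|C| + 1) * r <= _).
  apply: (@le_trans _ _ ((`|C| + 1) * normc k)).
    by rewrite ler_wpM2r ?normc_ge0// (le_trans (ler_norm _))// lerDl.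
  by rewrite ler_wpM2l// ltW.
by rewrite mulrC -ler_pdivlMr// ge_min lexx orbT.
Unshelve. all: by end_near. Qed.

End ComplexLog.

(** * First and second derivative of F off the range of [fhat] *)

Section CalF.
Variables (R : realType) (f : R -> R).
Hypothesis f_decr : {in `[0, 1]%R &, forall s t : R, s <= t -> f t <= f s}.
Implicit Types (w k : R[i]) (g m : R -> R[i]) (u v x d : R).

Local Notation Re := complex.Re.
Local Notation Im := complex.Im.
Local Notation normc := Normc.normc.
Local Notation lo := (fhat f 1).
Local Notation hi := (fhat f 0).

(** At a root w0 the two alternatives correspond to y > 0 and y < 0. *)
Definition gap u d := 0 < d /\ (hi + d <= u \/ u <= lo - d).

Lemma gap_dist u d x : gap u d -> lo <= x <= hi -> d <= `|u - x|.
Proof.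
move=> [d0 [h|h]] /andP[lx xh].
  by rewrite ger0_norm; lra.
by rewrite distrC ger0_norm; lra.
Qed.

Lemma gap_neq u d x : gap u d -> lo <= x <= hi -> u - x != 0.
Proof.
by move=> ud xJ; rewrite -normr_gt0 (lt_le_trans _ (gap_dist ud xJ))//; case: ud.
Qed.

Lemma gap_half u u' d : gap u d -> `|u' - u| <= d / 2 -> gap u' (d / 2).
Proof.
move=> [d0 h]; rewrite ler_distl => /andP[h1 h2]; split; first by lra.
by case: h => h; [left|right]; lra.
Qed.

Lemma gap_lo u d : gap u d -> (u < lo) = (u <= lo - d).
Proof.
move=> [d0 [h|h]]; last by rewrite h; apply/idP; lra.
have lh := fhat_lo_hi f_decr.
by apply/idP/idP => H; exfalso; move: H h lh d0; lra.
Qed.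

Definition avgC g : R[i] := avg f (fun x => Re (g x)) +i* avg f (fun x => Im (g x)).

Definition cont_rangeC g := cont_range f (fun x => Re (g x)) /\ cont_range f (fun x => Im (g x)).

(** The factor 2 comes from estimating real and imaginary parts separately. *)
Lemma avgC_taylor g1 g2 m k (M : R) :
  cont_rangeC g1 -> cont_rangeC g2 -> cont_rangeC m ->
  (forall x, lo <= x <= hi -> normc (g1 x - g2 x - k * m x) <= M) ->
  normc (avgC g1 - avgC g2 - k * avgC m) <= 2 * M.
Proof.
move=> [r1 i1] [r2 i2] [rm im] H; case: k H => a b H.
have cD (p q : R -> R) : cont_range f p -> cont_range f q -> cont_range f (fun x => p x + q x).
  by move=> cg ch x xJ; apply: continuousD; [exact: cg|exact: ch].
have cB (p q : R -> R) : cont_range f p -> cont_range f q -> cont_range f (fun x => p x - q x).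
  by move=> cg ch x xJ; apply: continuousB; [exact: cg|exact: ch].
have cZ r (p : R -> R) : cont_range f p -> cont_range f (fun x => r * p x).
  by move=> cg x xJ; apply: continuousM; [exact: cst_continuous|exact: cg].
have E : avgC g1 - avgC g2 - (a +i* b) * avgC m =
  avg f (fun x => (Re (g1 x) - Re (g2 x)) - (a * Re (m x) - b * Im (m x))) +i*
  avg f (fun x => (Im (g1 x) - Im (g2 x)) - (a * Im (m x) + b * Re (m x))).
  rewrite (avgB f_decr (cB _ _ r1 r2) (cB _ _ (cZ a _ rm) (cZ b _ im))).
  rewrite (avgB f_decr (cB _ _ i1 i2) (cD _ _ (cZ a _ im) (cZ b _ rm))).
  rewrite (avgB f_decr r1 r2) (avgB f_decr i1 i2).
  rewrite (avgB f_decr (cZ a _ rm) (cZ b _ im)) (avgD f_decr (cZ a _ im) (cZ b _ rm)).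
  rewrite !(avgZ f_decr _ rm) !(avgZ f_decr _ im).
  by apply/eqP; rewrite eq_complex /=; apply/andP; split; apply/eqP; ring.
rewrite {}E; apply: le_trans (normc_le_ReIm _) _.
have -> : 2 * M = M + M by ring.
apply: lerD => /=; apply: (avg_le_norm f_decr).
- exact: (cB _ _ (cB _ _ r1 r2) (cB _ _ (cZ a _ rm) (cZ b _ im))).
- move=> x /H; apply: le_trans; apply: le_trans (normr_Re_le _).
  by case: (g1 x) (g2 x) (m x) => ? ? [? ?] [? ?].
- exact: (cB _ _ (cB _ _ i1 i2) (cD _ _ (cZ a _ im) (cZ b _ rm))).
- move=> x /H; apply: le_trans; apply: le_trans (normr_Im_le _).
  by case: (g1 x) (g2 x) (m x) => ? ? [? ?] [? ?].
Qed.

Definition log_kernel w x : R[i] := half_log (w - x%:C).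
Definition inv_kernel w x : R[i] := (w - x%:C)^-1.

Lemma is_derive1_subl u x : is_derive x 1 (fun x => u - x) (-1).
Proof.
have := is_derive1B (is_derive1_cst u x) (is_derive_id x (1 : R)).
by move/is_derive1_eq; apply; rewrite sub0r.
Qed.

Lemma normsq_gt0 u v x : u - x != 0 ->
  0 < (u - x) * (u - x) + v * v.
Proof.
by move=> ux; rewrite -!expr2 ltr_pwDl ?sqr_ge0// exprn_even_gt0.
Qed.

Lemma cont_log_kernel w d : gap (Re w) d -> cont_rangeC (log_kernel w).
Proof.
case: w => u v /= wd; split=> x xJ; have ux := gap_neq wd xJ.
  have n0 := normsq_gt0 v ux.
  have du := is_derive1_subl u x.
  have dn := is_derive1D (is_derive1M du du) (is_derive1_cst (v * v) x).
  apply: (is_derive1_continuous (f := fun x => _)).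
  rewrite /= subr0; apply: (is_derive1Z 2^-1
    (@is_derive1_comp R (@ln R) (fun x => (u - x) * (u - x) + v * v) x _ _ (is_derive1_ln n0) dn)).
have du := is_derive1_subl u x.
have dn := is_derive1M (is_derive1_cst v x) (is_derive1V (f := fun x => u - x) ux du).
apply: (is_derive1_continuous (f := fun x => _)).
rewrite /= subr0.
exact: (@is_derive1_comp R (@atan R) (fun x => v * (u - x)^-1) x _ _ (is_derive1_atan _) dn).
Qed.

Lemma cont_inv_kernel w d : gap (Re w) d -> cont_rangeC (inv_kernel w).
Proof.
case: w => u v /= wd; split=> x xJ; have ux := gap_neq wd xJ.
  have n0 := lt0r_neq0 (normsq_gt0 v ux).
  have du := is_derive1_subl u x.
  have dn := is_derive1D (is_derive1M du du) (is_derive1_cst (v * v) x).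
  apply: (is_derive1_continuous (f := fun x => _)).
  rewrite /= subr0; exact: (is_derive1M du (is_derive1V (f := fun x => (u - x) * (u - x) + v * v) n0 dn)).
have n0 := lt0r_neq0 (normsq_gt0 v ux).
have du := is_derive1_subl u x.
have dn := is_derive1D (is_derive1M du du) (is_derive1_cst (v * v) x).
apply: (is_derive1_continuous (f := fun x => _)).
rewrite /= subr0; exact: (is_derive1N (is_derive1M (is_derive1_cst v x) (is_derive1V (f := fun x => (u - x) * (u - x) + v * v) n0 dn))).
Qed.

(** Since [half_log] is even, both branches of [ln_diff] lead to the same kernel; the choice of
    branch survives as an additive constant, which derivatives do not see. *)
Lemma calF_log_kernel w d : gap (Re w) d ->
  calF f w = avgC (log_kernel w) + (if Re w < lo then pi *i else 0).
Proof.
move=> wd; have wlo := gap_lo wd; case: wd => d0 wd.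
rewrite /calF /integral01 /ln_diff; case: ifP => wlt.
  have E t : 0 <= t <= 1 -> lnc ((fhat f t)%:C - w) = log_kernel w (fhat f t).
    move=> /(fhat_range f_decr) /andP[lt th].
    rewrite lnc_half_log; last by rewrite ReB/= subr_gt0 (lt_le_trans wlt).
    by rewrite /log_kernel -half_logN opprB.
  have [cr ci] : cont_rangeC (log_kernel w).
    by apply: (@cont_log_kernel _ d); split=> //; right; rewrite -wlo.
  transitivity (avg f (fun x => Re (log_kernel w x)) +i*
    (avg f (fun x => Im (log_kernel w x)) + pi)); last by rewrite /avgC; simpc.
  congr (_ +i* _).
    apply: eq_Rintegral => t; rewrite inE/= in_itv/= => t01.
    transitivity (Re (lnc ((fhat f t)%:C - w) + pi *i)) => //.
    by rewrite E// ReD addr0.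
  rewrite -[X in _ = _ + X](avg_cst f) -avgD//; last exact: cont_range_cst.
  apply: eq_Rintegral => t; rewrite inE/= in_itv/= => t01.
  transitivity (Im (lnc ((fhat f t)%:C - w) + pi *i)) => //.
  by rewrite E// ImD.
have wh : hi + d <= Re w by case: wd => // h; move: wlt; rewrite wlo h.
have E t : 0 <= t <= 1 -> lnc (w - (fhat f t)%:C) = log_kernel w (fhat f t).
  move=> /(fhat_range f_decr) /andP[lt th].
  rewrite lnc_half_log// ReB subr_gt0/= (le_lt_trans th)//.
  by rewrite (lt_le_trans _ wh)// ltrDl.
rewrite addr0; congr (_ +i* _); apply: eq_Rintegral => t;
  rewrite inE/= in_itv/= => t01.
  by transitivity (Re (lnc (w - (fhat f t)%:C))) => //; rewrite E.
by transitivity (Im (lnc (w - (fhat f t)%:C))) => //; rewrite E.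
Qed.

(** Stated at complex points because the second derivative at a real point is taken along complex
    increments. *)
Lemma calF_deriv1 w d : gap (Re w) d ->
  ((calF f)^`())%classic w = avgC (inv_kernel w).
Proof.
move=> wd; have d0 : 0 < d by case: wd.
apply: (@derive1_taylor _ _ _ _ (8 / d ^+ 2) (d / 2)); first by rewrite divr_gt0.
move=> k kd; have rk : `|Re (w + k) - Re w| <= d / 2.
  by rewrite ReD addrC addKr (le_trans (normr_Re_le _)).
have wkd := gap_half wd rk.
rewrite (calF_log_kernel wd) (calF_log_kernel wkd).
have -> : (Re (w + k) < lo) = (Re w < lo).
  have lh := fhat_lo_hi f_decr.
  rewrite (gap_lo wkd) (gap_lo wd); move: rk; rewrite ler_distl => /andP[r1 r2].
  case: wd => _ [h|h]; first by apply/idP/idP => H; exfalso; move: H h lh d0 r1 r2; lra.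
  by rewrite h; apply/idP; lra.
rewrite (_ : _ - _ - _ = avgC (log_kernel (w + k)) - avgC (log_kernel w) -
  k * avgC (inv_kernel w)); last by ring.
rewrite (_ : 8 / d ^+ 2 * _ = 2 * (4 * normc k ^+ 2 / d ^+ 2)); last by ring.
apply: avgC_taylor; [exact: cont_log_kernel wkd|exact: cont_log_kernel wd|
  exact: cont_inv_kernel wd|].
move=> x xJ; rewrite /log_kernel /inv_kernel.
have -> : w + k - x%:C = w - x%:C + k by ring.
apply: half_log_taylor => //; rewrite ReB/=.
exact: gap_dist wd xJ.
Qed.

Lemma calF''_avg u d : gap u d ->
  calF'' f u%:C = (- avg f (fun x => (u - x) ^- 2))%:C.
Proof.
move=> ud; have d0 : 0 < d by case: ud.
have c1 : cont_range f (fun x => (u - x) ^- 2).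
  move=> x xJ; have ux := gap_neq ud xJ.
  have du := is_derive1_subl u x.
  have ux2 : (u - x) * (u - x) != 0 by rewrite mulf_neq0.
  exact: is_derive1_continuous
    (is_derive1V (f := fun x => (u - x) * (u - x)) ux2 (is_derive1M du du)).
have c2 : cont_range f (fun x => - (u - x) ^- 2).
  by move=> x xJ; apply: continuousN; exact: c1.
have E : avg f (fun x => - (u - x) ^- 2) = - avg f (fun x => (u - x) ^- 2).
  rewrite -mulN1r -(avgZ f_decr _ c1).
  by apply: eq_avg => // x _; rewrite mulN1r.
rewrite /calF'' derive1Sn derive1n1.
pose m x : R[i] := (- (u - x) ^- 2)%:C.
have -> : (- avg f (fun x => (u - x) ^- 2))%:C = avgC m.
  by rewrite /avgC -E; congr (_ +i* _); rewrite [LHS](_ : 0 = avg f (fun=> 0))// avg_cst.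
apply: (@derive1_taylor _ _ _ _ (4 / d ^+ 3) (d / 2)); first by rewrite divr_gt0.
move=> k kd; have rk : `|Re (u%:C + k) - u| <= d / 2.
  by rewrite ReD/= addrC addKr (le_trans (normr_Re_le _)).
have ukd := gap_half ud rk.
rewrite (calF_deriv1 (w := u%:C) ud) (calF_deriv1 ukd).
rewrite (_ : 4 / d ^+ 3 * _ = 2 * (2 * normc k ^+ 2 / d ^+ 3)); last by ring.
apply: avgC_taylor; [exact: cont_inv_kernel ukd|exact: (@cont_inv_kernel u%:C d ud)|
  by split=> //; exact: cont_range_cst|].
move=> x xJ; have xd := gap_dist ud xJ; have ux := gap_neq ud xJ.
have kxd := gap_dist ukd xJ; have kx := gap_neq ukd xJ.
have z0 : u%:C - x%:C != 0 by rewrite -rmorphB; apply: contra ux => /eqP[->].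
have zk0 : u%:C + k - x%:C != 0.
  by apply: contra kx => /eqP/(congr1 (@complex.Re R)); rewrite ReB/= => ->.
have -> : inv_kernel (u%:C + k) x - inv_kernel u%:C x - k * m x =
    (k * k) / ((u%:C - x%:C) * (u%:C - x%:C) * (u%:C + k - x%:C)).
  rewrite /inv_kernel /m rmorphN fmorphV rmorphXn rmorphB.
  by field; rewrite z0 zk0.
rewrite Normc.normcM Normc.normcV !Normc.normcM.
have n1 : d <= normc (u%:C - x%:C).
  by apply: le_trans (normr_Re_le _); rewrite ReB.
have n2 : d / 2 <= normc (u%:C + k - x%:C).
  by apply: le_trans (normr_Re_le _); rewrite ReB.
have P : d * d * (d / 2) <= normc (u%:C - x%:C) * normc (u%:C - x%:C) *
    normc (u%:C + k - x%:C).
  by rewrite !ler_pM// ?mulr_ge0// ?divr_ge0// ltW.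
have P0 : 0 < d * d * (d / 2) by rewrite !mulr_gt0.
rewrite ler_pdivrMr ?(lt_le_trans P0)//.
have q0 : 0 <= 2 * normc k ^+ 2 / d ^+ 3.
  by apply: divr_ge0; [apply: mulr_ge0 => //; exact: sqr_ge0|rewrite exprn_ge0// ltW].
apply: le_trans (ler_wpM2l q0 P).
by rewrite le_eqVlt; apply/orP; left; apply/eqP; field; rewrite gt_eqF.
Qed.

(** For u off the range of [fhat], the common sign of all [u - fhat f t]; at a root it is the sign
    of y. *)
Definition side u : R := if u < lo then -1 else 1.

Lemma expc_calF u d N : gap u d -> expc (N%:R * calF f u%:C) =
  (side u ^+ N * expR (N%:R * avg f (fun x => ln `|u - x|)))%:C.
Proof.
move=> ud; rewrite (calF_log_kernel (w := u%:C) ud) /avgC.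
have -> : avg f (fun x => Re (log_kernel u%:C x)) = avg f (fun x => ln `|u - x|).
  apply: eq_avg => // x xJ; have := gap_neq ud xJ; rewrite -normr_gt0 => n0.
  rewrite /= subr0 expr0n addr0 -[(u - x) ^+ 2]real_normK ?num_real// lnXn//.
  by field.
have -> : avg f (fun x => Im (log_kernel u%:C x)) = 0.
  rewrite -[RHS](avg_cst f); apply: eq_avg => // x xJ.
  by rewrite /= subrr mul0r atan0.
set A := avg _ _; have -> : (N%:R : R[i]) = (N%:R : R)%:C by rewrite rmorph_nat.
have cosN : cos (N%:R * pi) = (-1) ^+ N :> R /\ sin (N%:R * pi) = 0 :> R.
  elim: N => [|N [IH1 IH2]]; first by rewrite mul0r cos0 sin0.
  rewrite -natr1 mulrDl mul1r; split.
    by rewrite cosD IH1 IH2 cospi mul0r subr0 exprSr.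
  by rewrite sinD IH1 IH2 sinpi mul0r mulr0 addr0.
rewrite /side /=; case: ifP => _; simpc; rewrite /expc/=.
  case: cosN => -> ->; simpc.
  by rewrite mulrC.
by rewrite cos0 sin0 expr1n mul1r; simpc.
Qed.

End CalF.

(** * Mean and variance from the oscillation of Q *)

Section MeanVariance.
Variables (R : realType) (f : R -> R).
Hypothesis f_decr : {in `[0, 1]%R &, forall s t : R, s <= t -> f t <= f s}.
Implicit Types (u w h d K e : R).

Local Notation lo := (fhat f 1).
Local Notation hi := (fhat f 0).

(** On the real line off the range of [fhat], these three averages are the real part of F, F' and -
    F''. *)
Definition log_pot w := avg f (fun x => ln `|w - x|).
Definition stieltjes w := avg f (fun x => (w - x)^-1).
Definition stieltjes2 w := avg f (fun x => (w - x) ^- 2).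

Lemma cont_log_dist w d : gap f w d -> cont_range f (fun x => ln `|w - x|).
Proof.
move=> wd x xJ; have ux := gap_neq wd xJ.
apply: (@continuous_comp _ _ _ (fun x => `|w - x|) (@ln R)).
  apply: (@continuous_comp _ _ _ (fun x => w - x) (fun z => `|z|)).
    exact: is_derive1_continuous (is_derive1_subl w x).
  exact: norm_continuous.
by apply: continuous_ln; rewrite normr_gt0.
Qed.

Lemma cont_inv w d : gap f w d -> cont_range f (fun x => (w - x)^-1).
Proof.
move=> wd x xJ; have ux := gap_neq wd xJ.
exact: is_derive1_continuous (is_derive1V (f := fun x => w - x) ux (is_derive1_subl w x)).
Qed.

Lemma cont_inv2 w d : gap f w d -> cont_range f (fun x => (w - x) ^- 2).
Proof.
move=> wd x xJ; have ux := gap_neq wd xJ.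
have du := is_derive1_subl w x.
have ux2 : (w - x) * (w - x) != 0 by rewrite mulf_neq0.
exact: is_derive1_continuous
  (is_derive1V (f := fun x => (w - x) * (w - x)) ux2 (is_derive1M du du)).
Qed.

Lemma cont_comb (k1 k2 : R) (g1 g2 : R -> R) :
  cont_range f g1 -> cont_range f g2 -> cont_range f (fun x => k1 * g1 x + k2 * g2 x).
Proof.
move=> c1 c2 x xJ; apply: continuousD.
  by apply: continuousM; [exact: cst_continuous|exact: c1].
by apply: continuousM; [exact: cst_continuous|exact: c2].
Qed.

Lemma log_pot_taylor w d h : gap f w d -> `|h| <= d / 2 ->
  `|log_pot (w + h) - log_pot w - h * stieltjes w + h ^+ 2 / 2 * stieltjes2 w| <=
  2 * `|h| ^+ 3 / d ^+ 3.
Proof.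
move=> wd hd; have d0 : 0 < d by case: wd.
have whd : gap f (w + h) (d / 2) by apply: gap_half wd _; rewrite addrC addKr.
have C1 := cont_log_dist whd; have C2 := cont_log_dist wd.
have C3 := cont_inv wd; have C4 := cont_inv2 wd.
have C5 := @cont_comb 1 (-1) _ _ C1 C2; have C6 := @cont_comb (- h) (h ^+ 2 / 2) _ _ C3 C4.
have -> : log_pot (w + h) - log_pot w - h * stieltjes w + h ^+ 2 / 2 * stieltjes2 w =
    avg f (fun x => 1 * (1 * ln `|w + h - x| + -1 * ln `|w - x|) +
      1 * (- h * (w - x)^-1 + h ^+ 2 / 2 * (w - x) ^- 2)).
  have cZ k g : cont_range f g -> cont_range f (fun x => k * g x).
    by move=> c x xJ; apply: continuousM; [exact: cst_continuous|exact: c].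
  rewrite (avgD f_decr (cZ 1 _ C5) (cZ 1 _ C6)) !(avgZ f_decr 1 C5) !(avgZ f_decr 1 C6).
  rewrite (avgD f_decr (cZ 1 _ C1) (cZ (-1) _ C2)).
  rewrite (avgD f_decr (cZ (- h) _ C3) (cZ (h ^+ 2 / 2) _ C4)).
  rewrite (avgZ f_decr 1 C1) (avgZ f_decr (-1) C2) (avgZ f_decr (- h) C3).
  by rewrite (avgZ f_decr (h ^+ 2 / 2) C4) /log_pot /stieltjes /stieltjes2; ring.
apply: (avg_le_norm f_decr); first exact: cont_comb.
move=> x xJ; have := ln_dist_taylor d0 (gap_dist wd xJ) hd.
by rewrite !mul1r mulN1r mulNr addrA.
Qed.

Section Points.
Variables (N : nat) (p : 'I_N -> R).

(** For the points mu_j/N this is ln |Q(u)|, by [norm_calQ_re]. *)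
Definition log_ratio u := N%:R * log_pot u - \sum_j ln `|u - p j|.

Lemma log_ratio_taylor w d h : gap f w d -> (forall j, d <= `|w - p j|) ->
  `|h| <= d / 2 ->
  `|log_ratio (w + h) - log_ratio w -
    h * (N%:R * stieltjes w - \sum_j (w - p j)^-1) +
    h ^+ 2 / 2 * (N%:R * stieltjes2 w - \sum_j (w - p j) ^- 2)| <=
  4 * N%:R * `|h| ^+ 3 / d ^+ 3.
Proof.
move=> wd pd hd; have d0 : 0 < d by case: wd.
have -> : log_ratio (w + h) - log_ratio w -
    h * (N%:R * stieltjes w - \sum_j (w - p j)^-1) +
    h ^+ 2 / 2 * (N%:R * stieltjes2 w - \sum_j (w - p j) ^- 2) =
  N%:R * (log_pot (w + h) - log_pot w - h * stieltjes w +
    h ^+ 2 / 2 * stieltjes2 w) -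
  \sum_j (ln `|w + h - p j| - ln `|w - p j| - h * (w - p j)^-1 +
    h ^+ 2 / 2 * (w - p j) ^- 2).
  by rewrite big_split sumrB sumrB/= -!mulr_sumr /log_ratio; ring.
rewrite (le_trans (ler_normB _ _))//.
have -> : 4 * N%:R * `|h| ^+ 3 / d ^+ 3 =
  N%:R * (2 * `|h| ^+ 3 / d ^+ 3) + N%:R * (2 * `|h| ^+ 3 / d ^+ 3) by ring.
apply: lerD.
  by rewrite normrM normr_nat ler_wpM2l// log_pot_taylor.
rewrite (le_trans (ler_norm_sum _ _ _))//.
rewrite -[X in X%:R * _]card_ord mulr_natl -sumr_const ler_sum// => j _.
exact: ln_dist_taylor.
Qed.

(** The expansions at [h] and [- h] are combined: their difference isolates the first order term,
    their sum the second order term. *)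
Lemma mean_variance_bound w d K h : gap f w d -> (forall j, d <= `|w - p j|) ->
  (forall h, `|h| <= d / 2 -> `|log_ratio (w + h) - log_ratio w| <= K) ->
  0 < h -> h <= d / 2 ->
  h * `|N%:R * stieltjes w - \sum_j (w - p j)^-1| <= K + 4 * N%:R * h ^+ 3 / d ^+ 3 /\
  h ^+ 2 * `|N%:R * stieltjes2 w - \sum_j (w - p j) ^- 2| <=
    2 * K + 8 * N%:R * h ^+ 3 / d ^+ 3.
Proof.
move=> wd pd HK h0 hd.
have hp : `|h| <= d / 2 by rewrite gtr0_norm.
have hm : `|- h| <= d / 2 by rewrite normrN.
have := log_ratio_taylor wd pd hp; have := log_ratio_taylor wd pd hm.
have := HK _ hp; have := HK _ hm; rewrite normrN sqrrN (gtr0_norm h0) => K1 K2.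
move: (log_ratio _ - _) (log_ratio _ - _) K1 K2 => x y K1 K2.
move: (N%:R * _ - _) (N%:R * _ - _) => b v.
set E := 4 * _ * _ / _ => T1 T2.
have -> : 8 * N%:R * h ^+ 3 / d ^+ 3 = 2 * E by rewrite /E; ring.
move: T1 T2 K1 K2; rewrite !ler_norml => /andP[a1 a2] /andP[b1 b2] /andP[c1 c2] /andP[d1 d2].
split.
  by rewrite -{1}(gtr0_norm h0) -normrM ler_norml; apply/andP; split; lra.
rewrite -{1}[h ^+ 2]ger0_norm ?sqr_ge0// -normrM ler_norml; apply/andP; split; lra.
Qed.

End Points.

(** The first order bound needs 1/h and N h^2 small against N^(1/2), which leads to h = eta
    N^(-1/4); the second order bound needs only 1/h^2 and N h small against N. A small [eta] absorbs
    the Taylor remainder, then a large N (through [Q]) absorbs [K]. In the proof [q] is N^(1/4). *)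
Lemma mean_variance_cvg d K e : 0 < d -> 0 < e -> exists N1 : nat,
  forall (N : nat) (p : 'I_N -> R) w, (N1 <= N)%N -> (0 < N)%N -> gap f w d ->
  (forall j, d <= `|w - p j|) ->
  (forall h, `|h| <= d / 2 -> `|log_ratio p (w + h) - log_ratio p w| <= K) ->
  `|stieltjes w - (\sum_j (w - p j)^-1) / N%:R| <= e / Num.sqrt N%:R /\
  `|stieltjes2 w - (\sum_j (w - p j) ^- 2) / N%:R| <= e.
Proof.
move=> d0 e0.
(* Taylor's formula is used at distance [eta / N^(1/4)]. *)
pose eta := Num.min 1 (Num.min (d / 2) (e * d ^+ 3 / 16)).
have eta0 : 0 < eta.
  by rewrite !lt_min ltr01 !divr_gt0// mulr_gt0// exprn_gt0.
have eta1 : eta <= 1 by rewrite ge_min lexx.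
have etad : eta <= d / 2 by rewrite !ge_min lexx orbT.
have etae : 16 * eta <= e * d ^+ 3.
  by rewrite mulrC -ler_pdivlMr// !ge_min lexx !orbT.
pose Q := Num.max 1 (4 * (`|K| + 1) / (eta ^+ 2 * e)).
exists (Num.truncn (Q ^+ 4)).+1 => N p w N1 N0 wd pd HK.
have NR : 0 < N%:R :> R by rewrite ltr0n.
pose q : R := Num.sqrt (Num.sqrt N%:R).
have q2 : q ^+ 2 = Num.sqrt N%:R by rewrite sqr_sqrtr// sqrtr_ge0.
have q4 : q ^+ 4 = N%:R by rewrite (exprM q 2 2) q2 sqr_sqrtr// ltW.
have q0 : 0 < q by rewrite !sqrtr_gt0.
have qQ : Q <= q.
  rewrite -(@ler_pXn2r _ 4)// ?nnegrE ?(ltW q0)//; last by rewrite le_max ler01.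
  rewrite q4 ltW// (lt_le_trans (truncnS_gt _))// ler_nat//.
have q1 : 1 <= q by rewrite (le_trans _ qQ)// le_max lexx.
have qK : 4 * (`|K| + 1) <= eta ^+ 2 * e * q.
  rewrite -ler_pdivrMl ?mulr_gt0 ?exprn_gt0// [leLHS]mulrC (le_trans _ qQ)//.
  by rewrite le_max lexx orbT.
have h0 : 0 < eta / q by rewrite divr_gt0.
have hd : eta / q <= d / 2.
  by rewrite (le_trans _ etad)// ler_pdivrMr// ler_peMr// ltW.
have [B1 B2] := mean_variance_bound wd pd HK h0 hd.
have KK : K <= `|K| := ler_norm K.
have sN (a b : R) : a - b / N%:R = (N%:R * a - b) / N%:R.
  by field; rewrite gt_eqF.
rewrite !sN !normrM normfV (gtr0_norm NR) -q2 -q4.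
have d3 : 0 < d ^+ 3 by rewrite exprn_gt0.
move: B1 B2; rewrite -q4.
move: `|_ * stieltjes w - _| `|_ * stieltjes2 w - _| (normr_ge0 K) => b v K0 B1 B2.
split.
  rewrite ler_pdivrMr ?exprn_gt0//.
  have -> : e / q ^+ 2 * q ^+ 4 = e * q ^+ 2 by field; rewrite gt_eqF.
  rewrite -(ler_pM2l h0); apply: le_trans B1 _.
  have -> : eta / q * (e * q ^+ 2) = eta * e * q by field; rewrite gt_eqF.
  have -> : 4 * q ^+ 4 * (eta / q) ^+ 3 / d ^+ 3 = q * eta * (4 * eta ^+ 2 / d ^+ 3).
    by field; rewrite !gt_eqF.
  have e1 : 4 * eta ^+ 2 / d ^+ 3 <= e / 4.
    rewrite ler_pdivrMr//; have : eta ^+ 2 <= eta by rewrite expr2 ler_piMr// ltW.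
    by move: etae; lra.
  have e2 : eta ^+ 2 * e * q <= eta * e * q.
    by rewrite !ler_pM2r// expr2 ler_piMr// ltW.
  have := ler_wpM2l (ltW (mulr_gt0 q0 eta0)) e1; lra.
rewrite ler_pdivrMr ?exprn_gt0// -(ler_pM2l (exprn_gt0 2 h0)).
apply: le_trans B2 _.
have -> : (eta / q) ^+ 2 * (e * q ^+ 4) = eta ^+ 2 * e * q ^+ 2.
  by field; rewrite gt_eqF.
have -> : 8 * q ^+ 4 * (eta / q) ^+ 3 / d ^+ 3 = q * eta ^+ 2 * (8 * eta / d ^+ 3).
  by field; rewrite !gt_eqF.
have e1 : 8 * eta / d ^+ 3 <= e / 2 by rewrite ler_pdivrMr//; lra.
have e2 : eta ^+ 2 * e * q <= eta ^+ 2 * e * q ^+ 2.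
  have ee : 0 <= eta ^+ 2 * e by apply: mulr_ge0; [exact: sqr_ge0|exact: ltW].
  by apply: ler_wpM2l => //; rewrite expr2 ler_peMr// ltW.
have qe : 0 <= q * eta ^+ 2 by apply: mulr_ge0; [exact: ltW|exact: sqr_ge0].
have := ler_wpM2l qe e1; lra.
Qed.

End MeanVariance.

(** * Complex exponential and square root *)

Section ComplexExp.
Variable R : realType.
Implicit Types (z w : R[i]) (x : R).

Lemma expcD z w : expc (z + w) = expc z * expc w.
Proof.
case: z w => a b [c d]; rewrite /expc /= expRD cosD sinD.
by apply/eqP; rewrite eq_complex /=; apply/andP; split; apply/eqP; ring.
Qed.

Lemma expc_real x : expc x%:C = (expR x)%:C.
Proof. by rewrite /expc/= cos0 sin0; simpc. Qed.

Lemma expc_neq0 z : expc z != 0.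
Proof.
have : expc z * expc (- z) != 0.
  by rewrite -expcD subrr (expc_real 0) expR0 oner_neq0.
by rewrite mulf_eq0 negb_or => /andP[].
Qed.

Lemma expcB z w : expc (z - w) = expc z / expc w.
Proof.
apply: (mulIf (expc_neq0 w)); rewrite divfK ?expc_neq0//.
by rewrite -expcD subrK.
Qed.

Lemma sqrtC_real x : 0 <= x -> sqrtC x%:C = (Num.sqrt x)%:C.
Proof.
move=> x0; rewrite -{1}(sqr_sqrtr x0) rmorphXn sqrCK// lecE/= eqxx/=.
exact: sqrtr_ge0.
Qed.

End ComplexExp.

(** * Exact comparison of the Schur function with the main term *)

Section Assembly.
Variables (R : realType) (f : R -> R).
Hypothesis f_decr : {in `[0, 1]%R &, forall s t : R, s <= t -> f t <= f s}.
Implicit Types (u w y d : R).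

Definition points N (l : N.-tuple int) (j : 'I_N) : R := (mu l j)%:~R / N%:R.

Definition calQ_re N (l : N.-tuple int) u : R :=
  side f u ^+ N * expR (N%:R * log_pot f u) / \prod_j (u - points l j).

Lemma calQ_real N (l : N.-tuple int) u d : gap f u d ->
  calQ f l u%:C = (calQ_re l u)%:C.
Proof.
move=> ud; rewrite /calQ (expc_calF f_decr N ud) /calQ_re.
rewrite [RHS]rmorphM fmorphV rmorph_prod; congr (_ / _).
by apply: eq_bigr => j _; rewrite [RHS]rmorphB.
Qed.

Lemma side_sqr u : side f u ^+ 2 = 1.
Proof. by rewrite /side; case: ifP => _; rewrite ?sqrrN expr1n. Qed.

Lemma side_neq0 u : side f u != 0.
Proof. by rewrite /side; case: ifP => _; rewrite ?oppr_eq0 oner_neq0. Qed.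

Lemma norm_calQ_re N (l : N.-tuple int) u : (forall j, u - points l j != 0) ->
  `|calQ_re l u| = expR (log_ratio f (points l) u).
Proof.
move=> up; rewrite /calQ_re /log_ratio expRB !normrM normfV.
have -> : `|side f u ^+ N| = 1.
  rewrite normrX (_ : `|side f u| = 1) ?expr1n//.
  by rewrite /side; case: ifP => _; rewrite ?normrN normr1.
rewrite mul1r (ger0_norm (expR_ge0 _)) expR_sum normr_prod; congr (_ / _).
by apply: eq_bigr => j _; rewrite lnK// posrE normr_gt0.
Qed.

Section Ratio.
Variables (n : nat) (l : n.+1.-tuple int).
Hypothesis sig : is_signature l.
Variables (y w d : R).
Hypotheses (y0 : y != 0) (wd : gap f w d) (yw : side f w = Num.sg y).
Hypothesis pos : forall j, 0 < side f w * (w - points l j).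

(** Under [pos] this is |N w - mu_j|, the inverse mean of the j-th exponential variable. *)
Definition rate (j : 'I_n.+1) : R := side f w * (n.+1%:R * w - (mu l j)%:~R).
Definition means : seq R := [seq (rate j)^-1 | j <- enum 'I_n.+1].

Lemma rateE j : rate j = n.+1%:R * (side f w * (w - points l j)).
Proof. by rewrite /rate /points; field; rewrite nat1r pnatr_eq0. Qed.

Lemma rate_gt0 j : 0 < rate j.
Proof. by rewrite rateE mulr_gt0 ?pos. Qed.

Lemma rate_inj : injective rate.
Proof.
move=> i j /(mulfI (side_neq0 w)) e; apply: (@mu_inj R n l sig).
by apply: oppr_inj; apply: (addrI (n.+1%:R * w)).
Qed.

(** Expected to tend to 1: with V = [stieltjes2 f w] the density at its mean is about (N / (2 pi
    V))^(1/2), and N times the Poisson weight is about (N / (2 pi))^(1/2). *)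
Definition tau : R :=
  Num.sqrt (stieltjes2 f w) * hypo means 0 `|y| /
  (n.+1%:R * poisson n.+1 n.+1%:R).

Lemma hypo_means : hypo means 0 `|y| =
  side f w * expR (- (n.+1%:R * (y * w))) * n.+1%:R ^+ n.+1 *
  (\prod_j (w - points l j)) *
  \sum_j expR (y * (mu l j)%:~R) /
    \prod_(i < n) ((mu l j)%:~R - (mu l (lift j i))%:~R).
Proof.
rewrite hypo_explicit; [|exact: rate_inj|exact: rate_gt0].
rewrite mulr_sumr; apply: eq_bigr => j _.
have -> : - rate j * `|y| = y * (mu l j)%:~R - n.+1%:R * (y * w).
  rewrite /rate normrEsg -yw.
  rewrite (_ : - _ * _ = - (side f w ^+ 2 * ((n.+1%:R * w - (mu l j)%:~R) * y))); last by ring.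
  by rewrite side_sqr; ring.
have -> : \prod_i rate i = side f w ^+ n.+1 * n.+1%:R ^+ n.+1 *
    \prod_i (w - points l i).
  rewrite (eq_bigr (fun i => side f w * n.+1%:R * (w - points l i))); last first.
    by move=> i _; rewrite rateE mulrCA mulrA.
  by rewrite big_split/= prodr_const card_ord exprMn.
have -> : \prod_(i < n) (rate (lift j i) - rate j) =
    side f w ^+ n * \prod_(i < n) ((mu l j)%:~R - (mu l (lift j i))%:~R).
  rewrite (eq_bigr (fun i => side f w * ((mu l j)%:~R - (mu l (lift j i))%:~R))); last first.
    by move=> i _; rewrite /rate; ring.
  by rewrite big_split/= prodr_const card_ord.
have P0 : \prod_(i < n) ((mu l j)%:~R - (mu l (lift j i))%:~R) != 0 :> R.
  apply/prodf_neq0 => i _; rewrite subr_eq0.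
  by apply/negP => /eqP/(@mu_inj R n l sig)/eqP; rewrite (negbTE (neq_lift _ _)).
have s0 := expf_neq0 n (side_neq0 w); rewrite expRB expRN exprSr.
move: (\prod_(i < n) _) (\prod_i _) P0 s0 => P Q P0 s0.
by field; rewrite P0 s0 gt_eqF ?expR_gt0.
Qed.

Lemma expR_sub1_neq0 : expR y - 1 != 0.
Proof. by rewrite subr_eq0 -expR0; apply: contra y0 => /eqP/expR_inj ->. Qed.

(** Holds exactly for every N: exp(N F) cancels between the main term and Q, and the product of the
    w - mu_j/N left in Q is the one that [hypo_means] contains. *)
Lemma schur_main_term (g : R[i] -> R[i]) : g w%:C != 0 -> 0 < stieltjes2 f w ->
  (schur_normalized l (expR y))%:C = main_term f g n.+1 y w *
    ((calQ_re l w)%:C / g w%:C * tau%:C).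
Proof.
move=> g0 V0; rewrite /main_term /sqrt_opp_calF''.
rewrite (calF''_avg f_decr wd) -/(stieltjes2 f w) rmorphN opprK sqrtC_real ?(ltW V0)//.
rewrite mulrBr expcB (expc_calF f_decr _ wd) -/(log_pot f w).
have -> : (n.+1%:R : R[i]) * (y * w)%:C = (n.+1%:R * (y * w))%:C.
  by rewrite [RHS]rmorphM rmorph_nat.
rewrite expc_real -yw.
set V := Num.sqrt _; set E := expR (_ * log_pot _ _); set X := _ ^+ n.
have x0 : X != 0 by rewrite expf_neq0// expR_sub1_neq0.
have V0' : V != 0 by rewrite gt_eqF// sqrtr_gt0.
have s0 := side_neq0 w; have sN0 := expf_neq0 n.+1 s0.
have E0 : E != 0 by rewrite gt_eqF ?expR_gt0.
have cancel_g (G a b q t : R[i]) : G != 0 ->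
    G / a * b * (q / G * t) = a^-1 * b * q * t.
  by move=> G0; move: (a^-1) => ia; field.
have morph (a b c e q t : R) : (a^-1 * (b / c / e) * q * t)%:C =
    a%:C^-1 * (b%:C / c%:C / e%:C) * q%:C * t%:C.
  by rewrite !rmorphM !fmorphV.
rewrite cancel_g// -[(side f w)%:C * _](rmorphM (real_complex R)) -morph.
congr (_%:C); rewrite schur_normalizedE// /tau hypo_means /calQ_re -/E -/X -/V.
have P0 : \prod_j (w - points l j) != 0.
  apply/prodf_neq0 => j _; have := pos j.
  by apply: contraTneq => ->; rewrite mulr0 ltxx.
set S := \sum_j _; move: (\prod_j _) P0 => P P0.
have nf : (n`!%:R : R) != 0 by rewrite pnatr_eq0 -lt0n fact_gt0.
have N0 : (n.+1%:R : R) != 0 by rewrite pnatr_eq0.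
have NN0 := expf_neq0 n.+1 N0.
rewrite /poisson factS natrM !expRN.
have e1 := lt0r_neq0 (expR_gt0 (n.+1%:R : R)).
have e2 := lt0r_neq0 (expR_gt0 (n.+1%:R * (y * w))).
move: s0 (side_sqr w) sN0; move: (side f w) => s s0 s2 sN0.
have -> : s * (expR (n.+1%:R * (y * w)))^-1 = s^-1 * (expR (n.+1%:R * (y * w)))^-1.
  by congr (_ * _); apply: (mulfI s0); rewrite mulfV// -expr2.
rewrite (_ : (s * V)^-1 = s * V^-1); last first.
  by rewrite invfM; congr (_ * _); apply: (mulfI s0); rewrite mulfV// -expr2.
move: (s ^+ n.+1) sN0 => sN sN0; move: (_ ^+ n.+1) NN0 => NN NN0.
move: (expR _) (expR _) e1 e2 => a b e1 e2.
by field; rewrite nf nat1r N0 e2 e1 NN0 s0 P0 x0 E0 sN0 V0'.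
Qed.

End Ratio.
End Assembly.

(** * Dependence of the root on y, and poles of Q near w0 *)

Section Localization.
Variables (R : realType) (f : R -> R).
Hypothesis f_decr : {in `[0, 1]%R &, forall s t : R, s <= t -> f t <= f s}.
Implicit Types (u w y d e : R).

Local Notation normc := Normc.normc.
Local Notation lo := (fhat f 1).
Local Notation hi := (fhat f 0).

Lemma gap_le u d d' : gap f u d -> 0 < d' -> d' <= d -> gap f u d'.
Proof. by move=> [d0 h] d'0 dd; split=> //; case: h => h; [left|right]; lra. Qed.

Lemma gap_side u d u' : gap f u d -> `|u' - u| <= d / 2 -> side f u' = side f u.
Proof.
move=> ud uu; have ud' := gap_half ud uu; rewrite /side.
have -> // : (u' < lo) = (u < lo).
have lh := fhat_lo_hi f_decr.
rewrite (gap_lo f_decr ud') (gap_lo f_decr ud).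
move: uu; rewrite ler_distl => /andP[r1 r2].
case: ud => d0 [h|h]; last by rewrite h; apply/idP; lra.
by apply/idP/idP => H; exfalso; move: H h lh d0 r1 r2; lra.
Qed.

Lemma is_w0_gap y w : y != 0 -> is_w0 f y w ->
  exists2 d, gap f w d & side f w = Num.sg y /\ stieltjes f w = y.
Proof.
move=> y0 [yp yn yE]; have lh := fhat_lo_hi f_decr.
have [y1|y1|ye] := ltgtP y 0; last by rewrite ye eqxx in y0.
  have wl := yn y1; exists (lo - w).
    by split; [rewrite subr_gt0|right; rewrite subKr].
  by rewrite /side wl ltr0_sg.
have wh := yp y1; exists (w - hi).
  by split; [rewrite subr_gt0|left; rewrite addrC subrK].
by rewrite /side ltNge (le_trans lh (ltW wh))/= gtr0_sg.
Qed.

Lemma dist_le_sum u x : lo <= x <= hi -> `|u - x| <= `|u| + (`|lo| + `|hi|).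
Proof.
move=> /andP[lx xh]; rewrite (le_trans (ler_normB _ _))// lerD2l.
rewrite ler_norml; have := ler_norm (- lo); have := ler_norm hi.
have := normr_ge0 lo; have := normr_ge0 hi; rewrite normrN => a b c d.
by apply/andP; split; lra.
Qed.

Lemma gap_pos u d x : gap f u d -> lo <= x <= hi -> 0 < side f u * (u - x).
Proof.
move=> ud /andP[lx xh]; rewrite /side (gap_lo f_decr ud).
by case: ud => d0 [h|h]; case: ifP => h'; rewrite ?mulN1r ?mul1r ?opprB; lra.
Qed.

(** To keep the inequality strict after integration, the difference of the integrands is bounded
    below by the constant (w' - w)/D. *)
Lemma stieltjes_decr w w' d d' : gap f w d -> gap f w' d' ->
  side f w = side f w' -> w < w' -> stieltjes f w' < stieltjes f w.
Proof.
move=> wd wd' ss ww.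
pose D := (`|w| + (`|lo| + `|hi|)) * (`|w'| + (`|lo| + `|hi|)).
have J0 : lo <= lo <= hi by rewrite lexx fhat_lo_hi.
have D0 : 0 < D.
  rewrite mulr_gt0// (lt_le_trans _ (dist_le_sum _ J0))// normr_gt0.
    exact: gap_neq wd J0.
  exact: gap_neq wd' J0.
rewrite -subr_gt0; apply: lt_le_trans (_ : (w' - w) / D <= _).
  by rewrite divr_gt0// subr_gt0.
have c1 := cont_inv wd; have c2 := cont_inv wd'.
rewrite -(avgB f_decr c1 c2) -[leLHS](avg_cst f); apply: (le_avg f_decr).
- exact: cont_range_cst.
- by move=> x xJ; apply: continuousB; [exact: c1|exact: c2].
move=> x xJ; have p1 := gap_pos wd xJ; have p2 := gap_pos wd' xJ.
have n1 := gap_neq wd xJ; have n2 := gap_neq wd' xJ.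
have -> : (w - x)^-1 - (w' - x)^-1 = (w' - w) / ((w - x) * (w' - x)).
  by field; rewrite n1 n2.
have pp : 0 < (w - x) * (w' - x).
  by have := mulr_gt0 p1 p2; rewrite -ss mulrACA -expr2 side_sqr mul1r.
rewrite ler_wpM2l ?subr_ge0 ?(ltW ww)// lef_pV2 ?posrE//.
by rewrite -[leLHS]gtr0_norm// normrM ler_pM// dist_le_sum.
Qed.

(** By strict monotonicity the values at w0 - h and w0 + h enclose y0 strictly; as long as y stays
    between them, its root stays within h of w0. *)
Lemma is_w0_near y0 w0 d e : y0 != 0 -> gap f w0 d -> side f w0 = Num.sg y0 ->
  stieltjes f w0 = y0 -> 0 < e -> exists2 r, 0 < r &
  forall y w, `|y - y0| < r -> is_w0 f y w ->
    [/\ y != 0, Num.sg y = Num.sg y0, `|w - w0| < e & `|y0| / 2 <= `|y|].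
Proof.
move=> y00 wd sw Gw e0; have d0 : 0 < d by case: wd.
pose h := Num.min e (d / 2).
have h0 : 0 < h by rewrite lt_min e0 divr_gt0.
have hd : h <= d / 2 by rewrite ge_min lexx orbT.
have he : h <= e by rewrite ge_min lexx.
have wp : `|w0 + h - w0| <= d / 2 by rewrite addrC addKr gtr0_norm.
have wm : `|w0 - h - w0| <= d / 2 by rewrite addrC addKr normrN gtr0_norm.
have gp := gap_half wd wp; have gm := gap_half wd wm.
have sp := gap_side wd wp; have sm := gap_side wd wm.
have Gp : stieltjes f (w0 + h) < y0.
  by rewrite -Gw; apply: (stieltjes_decr wd gp); rewrite ?sp// ltrDl.
have Gm : y0 < stieltjes f (w0 - h).
  by rewrite -Gw; apply: (stieltjes_decr gm wd); rewrite ?sm// gtrBl.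
exists (Num.min (`|y0| / 2) (Num.min (y0 - stieltjes f (w0 + h))
    (stieltjes f (w0 - h) - y0))).
  by rewrite !lt_min !subr_gt0 Gp Gm divr_gt0// normr_gt0.
move=> y w; rewrite !lt_min => /and3P[r1 r2 r3] yw.
have yy : `|y0| / 2 <= `|y|.
  have := ler_normB (y0 - y) (- y); rewrite opprK subrK normrN distrC; lra.
have yn : y != 0 by rewrite -normr_gt0 (lt_le_trans _ yy)// divr_gt0// normr_gt0.
have sy : Num.sg y = Num.sg y0.
  have [z|z|z] := ltgtP y0 0; last by rewrite z eqxx in y00.
    rewrite !ltr0_sg//; move: r1; rewrite (ltr0_norm z) ltr_distl; lra.
  rewrite !gtr0_sg//; move: r1; rewrite (gtr0_norm z) ltr_distl; lra.
have [dw wdw [sw' Gw']] := is_w0_gap yn yw.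
split=> //; rewrite (lt_le_trans _ he)// ltr_distl; apply/andP; split.
  rewrite ltNge; apply/negP => wle.
  have : stieltjes f (w0 - h) <= y.
    rewrite -Gw'; move: wle; rewrite le_eqVlt => /predU1P[->//|wlt].
    by apply/ltW/(stieltjes_decr wdw gm) => //; rewrite sm sw sw' sy.
  by move: r3; rewrite ltr_distl => /andP[_]; lra.
rewrite ltNge; apply/negP => wle.
have : y <= stieltjes f (w0 + h).
  rewrite -Gw'; move: wle; rewrite le_eqVlt => /predU1P[<-//|wlt].
  by apply/ltW/(stieltjes_decr gp wdw) => //; rewrite sp sw sw' sy.
by move: r2; rewrite ltr_distl => /andP[+ _]; lra.
Qed.

Lemma finite_gap (s : seq R) w : exists2 r, 0 < r &
  forall p, p \in s -> p != w -> r <= `|w - p|.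
Proof.
elim: s => [|q s [r r0 rs]]; first by exists 1.
have [qw|qw] := eqVneq q w.
  by exists r => // p; rewrite inE => /predU1P[->|/rs//]; rewrite qw eqxx.
exists (Num.min r `|w - q|).
  by rewrite lt_min r0 normr_gt0 subr_eq0 eq_sym.
move=> p; rewrite inE => /predU1P[-> _|/rs ps /ps]; rewrite ge_min.
  by rewrite lexx orbT.
by move=> ->.
Qed.

Lemma points_interval N (l : N.-tuple int) w : (0 < N)%N -> is_signature l ->
  w \notin `[(nth 0 l N.-1)%:~R / N%:R, (nth 0 l 0)%:~R / N%:R + 1]%R ->
  (forall j, w < points R l j) \/ (forall j, points R l j < w).
Proof.
case: N l => // N l _ sig; have NR : 0 < N.+1%:R :> R by rewrite ltr0n.
have pI j : (nth 0 l N)%:~R / N.+1%:R <= points R l j <=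
    (nth 0 l 0)%:~R / N.+1%:R + 1.
  have h1 : tnth l ord_max <= tnth l j by apply: sig; rewrite -ltnS ltn_ord.
  have h2 : tnth l j <= tnth l ord0 by exact: sig.
  have -> : (nth 0 l 0)%:~R / N.+1%:R + 1 = ((nth 0 l 0) + N.+1%:Z)%:~R / N.+1%:R :> R.
    by rewrite intrD; field; rewrite nat1r pnatr_eq0.
  rewrite !ler_pM2r ?invr_gt0// !ler_int /mu.
  rewrite -[nth 0 l N]/(nth 0 l (ord_max : 'I_N.+1)) -(tnth_nth 0 l ord_max).
  rewrite -[nth 0 l 0]/(nth 0 l (ord0 : 'I_N.+1)) -(tnth_nth 0 l ord0).
  have jN := ltn_ord j; move: h1 h2.
  move: (tnth l j) (tnth l ord_max) (tnth l ord0) => a b c h1 h2.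
  apply/andP; split; lia.
rewrite in_itv/= negb_and -!ltNge => /orP[H|H]; [left|right] => j.
  by have /andP[+ _] := pI j; exact: lt_le_trans.
by have /andP[_ +] := pI j => /le_lt_trans; apply.
Qed.

Lemma log_pot_bound w0 d : gap f w0 d -> exists B : R, forall u,
  `|u - w0| <= d / 2 -> `|log_pot f u| <= B.
Proof.
move=> wd; have d0 : 0 < d by case: wd.
pose D := `|w0| + d / 2 + (`|lo| + `|hi|).
exists (`|ln (d / 2)| + `|ln D|) => u ud; have gu := gap_half wd ud.
apply: (avg_le_norm f_decr); first exact: cont_log_dist gu.
move=> x xJ; have h1 := gap_dist gu xJ.
have d2 : 0 < d / 2 by rewrite divr_gt0.
have h2 : `|u - x| <= D.
  rewrite (le_trans (dist_le_sum u xJ))// lerD2r.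
  have := ler_normD (u - w0) w0; rewrite subrK; move: ud; lra.
have ux : 0 < `|u - x| by exact: lt_le_trans h1.
have l1 : ln (d / 2) <= ln `|u - x| by rewrite ler_ln.
have l2 : ln `|u - x| <= ln D by rewrite ler_ln// posrE (lt_le_trans ux).
rewrite ler_norml; apply/andP; split.
  have := ler_norm (- ln (d / 2)); rewrite normrN; have := normr_ge0 (ln D); lra.
by have := ler_norm (ln D); have := normr_ge0 (ln (d / 2)); lra.
Qed.

Variables (lambda : forall N : nat, N.-tuple int) (g : R[i] -> R[i]) (w0 d r : R).
Hypothesis w0d : gap f w0 d.
Hypothesis Q_cvg : forall e, 0 < e -> exists N1 : nat,
  forall N u, (N1 <= N)%N -> `|u - w0| < r ->
    normc (calQ f (lambda N) u%:C - g u%:C) <= e.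

Local Notation p N := (points R (lambda N)).
Let F N u := \prod_j (u - p N j).

(* The poles of [calQ f (lambda N)] near [w0] are poles for one fixed [N1]:
   otherwise [calQ f (lambda N)] would be unbounded near a point where
   [calQ f (lambda N1)] is bounded, although the two differ by at most 2. *)
Lemma points_stable : exists2 N1 : nat, (0 < N1)%N & forall N (j : 'I_N), (N1 <= N)%N ->
  `|p N j - w0| < Num.min r (d / 2) -> p N j \in [seq p N1 i | i <- enum 'I_N1].
Proof.
have d0 : 0 < d by case: w0d.
have [N1' HQ] := Q_cvg ltr01; pose N1 := maxn 1 N1'.
have {}HQ N u : (N1 <= N)%N -> `|u - w0| < r ->
    normc (calQ f (lambda N) u%:C - g u%:C) <= 1.
  by move=> NN; apply: HQ; apply: leq_trans NN; rewrite leq_maxr.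
exists N1; first by rewrite leq_maxl.
move=> N j NN; rewrite lt_min => /andP[pr pd]; apply/negPn/negP => pN.
have [B HB] := log_pot_bound w0d.
have F1 : F N1 (p N j) != 0.
  apply/prodf_neq0 => i _; rewrite subr_eq0; apply: contra pN => /eqP ->.
  by apply: map_f; rewrite mem_enum.
(* Near the pole, [T] bounds |Q_N| by way of Q_N1. Since |Q_N| |F N u| = exp(N [log_pot f u]) >=
   exp(- N B), a point with |F N u| < [c] is contradictory. *)
pose T := expR (N1%:R * B) / (`|F N1 (p N j)| / 2) + 2.
have T0 : 0 < T by rewrite ltr_wpDl// divr_ge0 ?expR_ge0// divr_ge0.
pose c := expR (- (N%:R * B)) / T.
have c0 : 0 < c by rewrite divr_gt0// expR_gt0.
have Fc K : F K u @[u --> (p N j)^'] --> F K (p N j).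
  apply: cvg_prodr => i _; apply: (continuous_dnbhs (f := fun u => u - p K i)).
  by apply: continuousB; [exact: cvg_id|exact: cst_continuous].
have near_id : id @ (p N j)^' --> p N j by exact: nbhs_dnbhs.
suff [u [[F0 Fs] [ur ud] F1u]] : exists u, [/\ F N u != 0 /\ `|F N u| < c,
    `|u - w0| < r /\ `|u - w0| < d / 2 & `|F N1 (p N j)| / 2 <= `|F N1 u|].
  have Pn K v : F K v != 0 -> forall i, v - points R (lambda K) i != 0.
    by move=> /prodf_neq0 H i; exact: H.
  have F1n : F N1 u != 0.
    by rewrite -normr_gt0 (lt_le_trans _ F1u)// divr_gt0// normr_gt0.
  have gu : gap f u (d / 2) by apply: gap_half w0d _; exact: ltW.
  have QE K : F K u != 0 -> `|calQ_re f (lambda K) u| * `|F K u| = expR (K%:R * log_pot f u).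
    move=> FK; rewrite norm_calQ_re; last exact: Pn.
    rewrite /log_ratio expRB.
    have -> : `|F K u| = expR (\sum_j0 ln `|u - p K j0|).
      rewrite expR_sum normr_prod; apply: eq_bigr => i _.
      by rewrite lnK// posrE normr_gt0; exact: Pn.
    by rewrite divfK// gt_eqF// expR_gt0.
  have /= bA := HB u (ltW ud).
  have Q1 : `|calQ_re f (lambda N1) u| <= expR (N1%:R * B) / (`|F N1 (p N j)| / 2).
    rewrite ler_pdivlMr ?divr_gt0 ?normr_gt0//.
    apply: le_trans (ler_wpM2l (normr_ge0 _) F1u) _; rewrite QE// ler_expR.
    by rewrite ler_wpM2l// (le_trans (ler_norm _)).
  have QQ : `|calQ_re f (lambda N) u - calQ_re f (lambda N1) u| <= 2.
    have H1 := HQ N u NN ur; have H2 := HQ N1 u (leqnn _) ur.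
    move: H1 H2; rewrite !(calQ_real f_decr _ gu) => H1 H2.
    rewrite -normc_real rmorphB.
    have -> : (calQ_re f (lambda N) u)%:C - (calQ_re f (lambda N1) u)%:C =
      ((calQ_re f (lambda N) u)%:C - g u%:C) - ((calQ_re f (lambda N1) u)%:C - g u%:C).
      by ring.
    rewrite (le_trans (le_normcD _ _))// normc_opp; lra.
  have QT : `|calQ_re f (lambda N) u| <= T.
    have := ler_normD (calQ_re f (lambda N) u - calQ_re f (lambda N1) u)
      (calQ_re f (lambda N1) u).
    by rewrite subrK /T; lra.
  have : expR (N%:R * log_pot f u) < expR (- (N%:R * B)).
    rewrite -QE//; apply: le_lt_trans (ler_wpM2r (normr_ge0 _) QT) _.
    by rewrite mulrC -ltr_pdivlMr.
  rewrite ltNge ler_expR -mulrN ler_wpM2l//.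
  by move: bA; rewrite ler_norml => /andP[].
have Fi i : \forall u \near (p N j)^', u != p N i.
  have [->|pp] := eqVneq (p N i) (p N j); first exact: nbhs_dnbhs_neq.
  apply: nbhs_dnbhs; exists `|p N i - p N j|; first by rewrite /= normr_gt0 subr_eq0.
  by move=> v /=; apply: contraTneq => ->; rewrite distrC ltxx.
have : \forall u \near (p N j)^', [/\ F N u != 0 /\ `|F N u| < c,
    `|u - w0| < r /\ `|u - w0| < d / 2 & `|F N1 (p N j)| / 2 <= `|F N1 u|].
  near=> u; split; first split.
  - near: u; apply: filterS (filter_forall _ Fi) => u uF.
    by apply/prodf_neq0 => i _; rewrite subr_eq0.
  - near: u; have := Fc N; have -> : F N (p N j) = 0.
      by rewrite /F (bigD1 j)//= subrr mul0r.
    by move/cvgr0_norm_lt; apply.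
  - split; near: u; apply: nbhs_dnbhs.
      exists (r - `|p N j - w0|); first by rewrite /= subr_gt0.
      move=> v /= vp; have := ler_distD (p N j) v w0; rewrite (distrC v (p N j)).
      by move: vp pr; lra.
    exists (d / 2 - `|p N j - w0|); first by rewrite /= subr_gt0.
    move=> v /= vp; have := ler_distD (p N j) v w0; rewrite (distrC v (p N j)).
    by move: vp pd; lra.
  - near: u; have := Fc N1 => /cvgr_distC_lt H.
    have h0 : 0 < `|F N1 (p N j)| / 2 by rewrite divr_gt0// normr_gt0.
    apply: filterS (H _ h0) => v /= vF.
    have := ler_normD (F N1 (p N j) - F N1 v) (F N1 v); rewrite subrK.
    by move: vF; rewrite (distrC (F N1 v)); lra.
by move=> H; apply: filter_ex H; exact: Proper_dnbhs_numFieldType.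
Unshelve. all: by end_near.
Qed.

End Localization.

(** * Uniform bounds on Q and on the poles near w0 *)

Section Regularity.
Variables (R : realType) (f : R -> R).
Hypothesis f_decr : {in `[0, 1]%R &, forall s t : R, s <= t -> f t <= f s}.
Variables (lambda : forall N : nat, N.-tuple int) (g : R[i] -> R[i]) (w0 d r : R).
Hypotheses (sig : forall N, is_signature (lambda N)) (w0d : gap f w0 d) (r0 : 0 < r).
Hypothesis Q_cvg : forall e, 0 < e -> exists N1 : nat,
  forall N u, (N1 <= N)%N -> `|u - w0| < r ->
    Normc.normc (calQ f (lambda N) u%:C - g u%:C) <= e.
Hypothesis w0_out : \forall N \near \oo,
  w0 \notin `[(nth 0 (lambda N) N.-1)%:~R / N%:R,
              (nth 0 (lambda N) 0)%:~R / N%:R + 1].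
Hypothesis g0 : g w0%:C != 0.
Implicit Types (u w y e : R).

Local Notation normc := Normc.normc.
Local Notation p N := (points R (lambda N)).

(** Poles close to w0 belong to one finite set by [points_stable], and w0 is not a pole as it lies
    outside the interval; a finite set without w0 has a positive distance to it. *)
Lemma points_gap : exists rho (N3 : nat), [/\ 0 < rho, (0 < N3)%N &
  forall N, (N3 <= N)%N -> (forall j, rho <= `|w0 - p N j|) /\
    ((forall j, w0 < p N j) \/ (forall j, p N j < w0))].
Proof.
have d0 : 0 < d by case: w0d.
have [N1 N10 H] := points_stable f_decr w0d Q_cvg.
have [rho rho0 Hr] := finite_gap [seq p N1 i | i <- enum 'I_N1] w0.
have [N2 _ H2] := w0_out.
pose m := Num.min r (d / 2).
have m0 : 0 < m by rewrite lt_min r0 divr_gt0.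
exists (Num.min rho m), (maxn N1 N2); split.
- by rewrite lt_min rho0.
- by rewrite (leq_trans N10)// leq_maxl.
move=> N; rewrite geq_max => /andP[NN1 NN2].
have N0 : (0 < N)%N by apply: leq_trans NN1.
have side_of := points_interval N0 (@sig N) (H2 N NN2); split=> // j.
rewrite ge_min; have [pm|pm] := ltP `|p N j - w0| m; last by rewrite distrC pm orbT.
rewrite Hr//; first exact: (H N j NN1 pm).
by case: side_of => /(_ j) h; [rewrite gt_eqF|rewrite lt_eqF].
Qed.

(** Continuity of a single |Q_N| at w0, in the form that it changes at most by a factor 2. *)
Lemma log_ratio_cont N : (forall j, p N j != w0) -> exists2 h0, 0 < h0 &
  forall u, `|u - w0| <= h0 ->
    `|log_ratio f (p N) u - log_ratio f (p N) w0| <= ln 2.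
Proof.
move=> pw; have d0 : 0 < d by case: w0d.
have [q q0 Hq] := finite_gap [seq p N i | i <- enum 'I_N] w0.
pose m := Num.min q d.
have m0 : 0 < m by rewrite lt_min q0.
have gm : gap f w0 m by apply: gap_le w0d m0 _; rewrite /m ge_min lexx orbT.
have pm j : m <= `|w0 - p N j|.
  by rewrite /m ge_min Hq// map_f// mem_enum.
pose a := N%:R * stieltjes f w0 - \sum_j (w0 - p N j)^-1.
pose b := N%:R * stieltjes2 f w0 - \sum_j (w0 - p N j) ^- 2.
have l2 : 0 < ln 2 :> R by rewrite ln_gt0// ltr1n.
pose C := `|a| + m * `|b| + N%:R / m + 1.
have C0 : 0 < C.
  by rewrite ltr_wpDl// !addr_ge0// ?mulr_ge0// ?invr_ge0// ?ler0n// (ltW m0).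
exists (Num.min (m / 2) (ln 2 / C)); first by rewrite lt_min !divr_gt0.
move=> u; rewrite le_min => /andP[um uC].
have := log_ratio_taylor f_decr gm pm um; rewrite (addrC w0) subrK -/a -/b.
move: (log_ratio _ _ _ - _) um uC => x um; rewrite (ler_pdivlMr _ _ C0); move: um.
have h0 := normr_ge0 (u - w0).
have -> : (u - w0) ^+ 2 = `|u - w0| ^+ 2 by rewrite real_normK// num_real.
have na : `|(u - w0) * a| = `|u - w0| * `|a| by rewrite normrM.
move: na h0; move: (`|u - w0|) ((u - w0) * a) => h ha na h0 hm hC T.
have hb : `|h ^+ 2 / 2 * b| <= h * (m * `|b|).
  rewrite normrM ger0_norm ?divr_ge0 ?sqr_ge0// mulrA ler_wpM2r//.
  by rewrite expr2 -mulrA ler_wpM2l//; move: hm m0; lra.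
have h3 : 4 * N%:R * h ^+ 3 / m ^+ 3 <= h * (N%:R / m).
  have -> : 4 * N%:R * h ^+ 3 / m ^+ 3 = (h * (N%:R / m)) * (2 * h / m) ^+ 2.
    by field; rewrite gt_eqF.
  have hm0 : 0 <= 2 * h / m by rewrite divr_ge0 ?mulr_ge0// ltW.
  apply: ler_piMr; first by rewrite mulr_ge0// divr_ge0// ltW.
  by apply: exprn_ile1 => //; rewrite ler_pdivrMr// mul1r; move: hm; lra.
have hCE : h * C = h * `|a| + h * (m * `|b|) + h * (N%:R / m) + h.
  by rewrite /C; ring.
move: hC T hb h3; rewrite hCE -na; move: (h * (m * _)) (h * (_ / m)) (4 * _ * _ / _).
move=> B1 B2 B3 hC T hb h3.
have := ler_normD (x - ha + h ^+ 2 / 2 * b) (ha - h ^+ 2 / 2 * b).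
have := ler_normB ha (h ^+ 2 / 2 * b).
rewrite (_ : x - ha + _ + _ = x); last by ring.
by lra.
Qed.

(** Bounds valid for one Q_N5 near w0 by continuity pass to g, and from g to all later Q_N, because
    the convergence is uniform near w0. *)
Lemma calQ_regular : exists rho K c (N5 : nat),
  [/\ 0 < rho, 0 < c, rho < r, rho <= d / 2 &
  forall N u, (N5 <= N)%N -> `|u - w0| <= rho ->
   [/\ c <= normc (g u%:C), (forall j, rho <= `|u - p N j|),
     ((forall j, u < p N j) \/ (forall j, p N j < u)) &
     `|log_ratio f (p N) u - log_ratio f (p N) w0| <= K]].
Proof.
have d0 : 0 < d by case: w0d.
have [q [N3 [q0 N30 Hq]]] := points_gap.
(* With |g(w0)| = 8e: |Q_N5(w0)| is in [7e, 9e], hence |Q_N5| nearby in [7/2 e, 18e], |g| at least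
   5/2 e and at most 19e, and |Q_N| in [3/2 e, 20e]. *)
pose e := normc (g w0%:C) / 8.
have e0 : 0 < e.
  rewrite divr_gt0// lt_neqAle normc_ge0 andbT eq_sym.
  by apply: contra g0 => /eqP/Normc.eq0_normc ->.
have ge : normc (g w0%:C) = 8 * e by rewrite /e mulrCA mulfV ?mulr1// pnatr_eq0.
have [N4 HQ] := Q_cvg e0; pose N5 := maxn N3 N4.
have N35 : (N3 <= N5)%N by rewrite leq_maxl.
have [Hq5 side5] := Hq N5 N35.
have pw j : p N5 j != w0.
  by case: side5 => /(_ j) h; [rewrite gt_eqF|rewrite lt_eqF].
have [h0 h00 Hh] := log_ratio_cont pw.
pose rho := Num.min (Num.min h0 (q / 2)) (Num.min (d / 2) (r / 2)).
have rho0 : 0 < rho by rewrite !lt_min h00 !divr_gt0.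
have [rh rq rd rr] : [/\ rho <= h0, rho <= q / 2, rho <= d / 2 & rho <= r / 2].
  by rewrite /rho; split; rewrite !ge_min lexx ?orbT.
have far N u : (N3 <= N)%N -> `|u - w0| <= rho ->
    (forall j, rho <= `|u - p N j|) /\ ((forall j, u < p N j) \/ (forall j, p N j < u)).
  move=> NN uw; have [Hd Hs] := Hq N NN; split.
    move=> j; have := ler_distD u w0 (p N j); rewrite (distrC w0 u).
    by have := Hd j; move: uw rq; lra.
  move: uw; rewrite ler_distl => /andP[u1 u2].
  case: Hs => Hs; [left|right] => j; have := Hd j; have := Hs j => s1.
    by rewrite ltr0_norm ?subr_lt0//; lra.
  by rewrite gtr0_norm ?subr_gt0//; lra.
have close N u : (N5 <= N)%N -> `|u - w0| <= rho ->
    `|calQ_re f (lambda N) u| = expR (log_ratio f (p N) u) /\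
    `|expR (log_ratio f (p N) u) - normc (g u%:C)| <= e.
  move=> NN uw; have [pu _] := far N u (leq_trans N35 NN) uw.
  have E : `|calQ_re f (lambda N) u| = expR (log_ratio f (p N) u).
    by apply: norm_calQ_re => j; rewrite -normr_gt0 (lt_le_trans rho0).
  have gu : gap f u (d / 2) by apply: gap_half w0d _; exact: le_trans rd.
  split=> //; have ur : `|u - w0| < r by move: uw rr r0; lra.
  have := HQ N u (leq_trans (leq_maxr _ _) NN) ur.
  rewrite (calQ_real f_decr _ gu) -E => H.
  have n1 := le_normcD ((calQ_re f (lambda N) u)%:C - g u%:C) (g u%:C).
  have n2 := le_normcD (g u%:C - (calQ_re f (lambda N) u)%:C) ((calQ_re f (lambda N) u)%:C).
  move: n1 n2; rewrite !subrK -(normc_opp (g u%:C - _)) opprB normc_real => n1 n2.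
  by rewrite ler_norml; apply/andP; split; lra.
have ww : `|w0 - w0| <= rho by rewrite subrr normr0 ltW.
pose L N u := log_ratio f (p N) u.
have L5 u : `|u - w0| <= rho -> 2^-1 * expR (L N5 w0) <= expR (L N5 u) <= 2 * expR (L N5 w0).
  move=> uw; have := Hh u (le_trans uw rh); rewrite ler_norml => /andP[h1 h2].
  have E2 : expR (ln 2) = 2 :> R by rewrite lnK// posrE.
  rewrite -[X in _ <= _ <= X * _]E2 -[X in X^-1]E2 -expRN -!expRD !ler_expR.
  by move: h1 h2; rewrite -/(L N5 u) -/(L N5 w0); lra.
have bd N u : (N5 <= N)%N -> `|u - w0| <= rho ->
    [/\ 5 / 2 * e <= normc (g u%:C), ln (3 / 2 * e) <= L N u & L N u <= ln (20 * e)].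
  move=> NN uw; have [_ cN] := close N u NN uw.
  have [_ c5] := close N5 u (leqnn _) uw; have [_ c0] := close N5 w0 (leqnn _) ww.
  have /andP[l1 l2] := L5 u uw.
  move: cN c5 c0; rewrite -/(L _ _) -/(L _ _) -/(L _ _) ge.
  rewrite !ler_norml => /andP[a1 a2] /andP[b1 b2] /andP[c1 c2].
  split; first by lra.
  - by rewrite -[leRHS]expRK ler_ln ?posrE ?expR_gt0 ?mulr_gt0//; lra.
  - by rewrite -[leLHS]expRK ler_ln ?posrE ?expR_gt0 ?mulr_gt0//; lra.
exists rho, (ln (20 * e) - ln (3 / 2 * e)), (5 / 2 * e), N5; split=> //.
- by rewrite mulr_gt0.
- by move: rr r0; lra.
move=> N u NN uw; have [pu su] := far N u (leq_trans N35 NN) uw.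
have [b1 b2 b3] := bd N u NN uw; have [_ b2' b3'] := bd N w0 NN ww.
by split=> //; rewrite -/(L _ _) -/(L _ _) ler_norml; apply/andP; split; lra.
Qed.

End Regularity.

(** * The factor [tau] is close to 1 *)

Section LocalUniformity.
Variables (R : realType) (f : R -> R).
Hypothesis f_decr : {in `[0, 1]%R &, forall s t : R, s <= t -> f t <= f s}.
Implicit Types (u w y e : R).

Local Notation normc := Normc.normc.
Local Notation lo := (fhat f 1).
Local Notation hi := (fhat f 0).

Lemma stieltjes2_ge w0 d : gap f w0 d -> exists2 v, 0 < v &
  forall w, `|w - w0| <= d / 2 -> v <= stieltjes2 f w.
Proof.
move=> wd; have d0 : 0 < d by case: wd.
pose D := `|w0| + d / 2 + (`|lo| + `|hi|).
have D0 : 0 < D.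
  by rewrite ltr_pwDl ?addr_ge0// ltr_wpDl// divr_gt0.
exists (D ^- 2); first by rewrite invr_gt0 exprn_gt0.
move=> w ww; have gw := gap_half wd ww; rewrite -[leLHS](avg_cst f).
apply: (le_avg f_decr); [exact: cont_range_cst|exact: cont_inv2 gw|].
move=> x xJ; have n0 := gap_neq gw xJ.
have x2 : 0 < (w - x) ^+ 2 by rewrite exprn_even_gt0.
rewrite lef_pV2 ?posrE ?x2 ?exprn_gt0//.
rewrite -[leLHS]ger0_norm ?sqr_ge0// normrX; apply: lerXn2r; rewrite ?nnegrE ?(ltW D0)//.
rewrite (le_trans (dist_le_sum w xJ))// lerD2r.
by have := ler_normD (w - w0) w0; rewrite subrK; move: ww; lra.
Qed.

Lemma sqrt_sub1_le (z : R) : 0 <= z -> `|Num.sqrt z - 1| <= `|z - 1|.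
Proof.
move=> z0; have s0 := sqrtr_ge0 z.
have -> : z - 1 = (Num.sqrt z - 1) * (Num.sqrt z + 1).
  by rewrite -subr_sqr_1 sqr_sqrtr.
by rewrite normrM ler_peMr// ger0_norm; lra.
Qed.

Section Means.
Variables (n : nat) (l : n.+1.-tuple int) (w : R).
Hypothesis wp : forall j, w - points R l j != 0.
Local Notation p := (points R l).
Local Notation c := (means f l w).

Lemma rate_inv j : (rate f l w j)^-1 = side f w * ((w - p j)^-1 / n.+1%:R).
Proof.
rewrite rateE (_ : (_ * (_ * _))^-1 = (side f w)^-1 * ((w - p j)^-1 / n.+1%:R)).
  by congr (_ * _); apply: (mulfI (side_neq0 f w)); rewrite mulfV ?side_neq0// -expr2 side_sqr.
by field; rewrite side_neq0 nat1r pnatr_eq0 wp.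
Qed.

Lemma sum_means : \sum_(x <- c) x = side f w * ((\sum_j (w - p j)^-1) / n.+1%:R).
Proof.
rewrite big_map big_enum /= mulr_suml mulr_sumr.
by apply: eq_bigr => j _; exact: rate_inv.
Qed.

Lemma sum_means_sqr :
  \sum_(x <- c) x ^+ 2 = ((\sum_j (w - p j) ^- 2) / n.+1%:R) / n.+1%:R.
Proof.
rewrite big_map big_enum /= !mulr_suml.
apply: eq_bigr => j _; rewrite rate_inv exprMn side_sqr mul1r.
by field; rewrite nat1r pnatr_eq0 wp.
Qed.

End Means.

(** [tau] is the quotient controlled by the local limit theorem, normalized by the actual variance
    [VN] / N, times the square root of [stieltjes2 f w / VN]. Both factors are within [eta] of 1,
    and eta <= 1 gives 3 [eta]. The variance hypothesis of [lim] has v/2 because [VN] may fall below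
    v by [e]. *)
Lemma tau_near1 (C v rho e eta : R) n (l : n.+1.-tuple int) y w :
  (forall s t, positive s -> size s = n.+1 ->
    all (fun c => c <= rho^-1 / n.+1%:R) s ->
    (v / 2) / n.+1%:R <= \sum_(c <- s) c ^+ 2 -> 0 <= t ->
    `|hypo s 0 t * Num.sqrt ((\sum_(c <- s) c ^+ 2) / n.+1%:R) /
      poisson n.+1 n.+1%:R - 1| <=
    C * (1 + n.+1%:R * `|t - \sum_(c <- s) c|) / Num.sqrt n.+1%:R) ->
  0 < v -> 0 <= C -> 0 < rho -> eta <= 1 -> e <= v / 2 -> e / (v / 2) <= eta ->
  C / Num.sqrt n.+1%:R <= eta / 2 -> C * e <= eta / 2 ->
  side f w = Num.sg y -> stieltjes f w = y -> y != 0 ->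
  (forall j, 0 < side f w * (w - points R l j)) ->
  (forall j, rho <= `|w - points R l j|) ->
  v <= stieltjes2 f w ->
  `|stieltjes f w - (\sum_j (w - points R l j)^-1) / n.+1%:R| <= e / Num.sqrt n.+1%:R ->
  `|stieltjes2 f w - (\sum_j (w - points R l j) ^- 2) / n.+1%:R| <= e ->
  `|tau f l y w - 1| <= 3 * eta.
Proof.
move=> lim v0 C0 rho0 eta1 ev ee Cn Ce sw yE y0 pos far vw H1 H2.
have wp j : w - points R l j != 0.
  by have := pos j; apply: contraTneq => ->; rewrite mulr0 ltxx.
pose VN := (\sum_j (w - points R l j) ^- 2) / n.+1%:R.
have sN0 : 0 < Num.sqrt n.+1%:R :> R by rewrite sqrtr_gt0 ltr0n.
have NR : 0 < n.+1%:R :> R by rewrite ltr0n.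
have VNv : v / 2 <= VN by move: H2; rewrite -/VN ler_distl => /andP[a b]; lra.
have VN0 : 0 < VN by lra.
have sm := sum_means wp; have sq := sum_means_sqr wp.
rewrite -/VN in sq.
have dist : `| `|y| - \sum_(x <- means f l w) x| <= e / Num.sqrt n.+1%:R.
  rewrite sm (normrEsg y) -sw -{1}yE -mulrBr normrM.
  have -> : `|side f w| = 1 by rewrite /side; case: ifP => _; rewrite ?normrN normr1.
  by rewrite mul1r.
have := lim (means f l w) `|y| _ _ _ _ (normr_ge0 _).
have -> : positive (means f l w).
  rewrite /positive; apply/allP => x /mapP[j _ ->]; rewrite invr_gt0.
  exact: rate_gt0.
have -> : size (means f l w) = n.+1 by rewrite size_map size_enum_ord.
have -> : all (fun c => c <= rho^-1 / n.+1%:R) (means f l w).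
  apply/allP => x /mapP[j _ ->]; rewrite rateE invfM mulrC ler_pM2r ?invr_gt0//.
  rewrite lef_pV2 ?posrE ?pos//.
  rewrite (le_trans (far j))// -[leRHS]ger0_norm ?(ltW (pos j))// normrM.
  have -> : `|side f w| = 1 by rewrite /side; case: ifP => _; rewrite ?normrN normr1.
  by rewrite mul1r.
rewrite sq => /(_ isT erefl isT); rewrite ler_pM2r ?invr_gt0// => /(_ VNv).
have tE : tau f l y w = hypo (means f l w) 0 `|y| *
    Num.sqrt (VN / n.+1%:R / n.+1%:R) / poisson n.+1 n.+1%:R *
    Num.sqrt (stieltjes2 f w / VN).
  have -> : VN / n.+1%:R / n.+1%:R = VN / n.+1%:R ^+ 2.
    by field; rewrite nat1r pnatr_eq0.
  have V0 : 0 <= stieltjes2 f w by apply: le_trans vw; exact: ltW.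
  rewrite (sqrtrM _ (ltW VN0)) (sqrtrM _ V0).
  rewrite !sqrtrV ?sqr_ge0 ?(ltW VN0)// sqrtr_sqr (ger0_norm (ltW NR)) /tau.
  have s0 : Num.sqrt VN != 0 by rewrite gt_eqF// sqrtr_gt0.
  move: (poisson _ _) (hypo _ _ _) (Num.sqrt VN) s0 => P h s s0.
  rewrite invfM; move: (P^-1) => iP.
  by field; rewrite nat1r pnatr_eq0 s0.
rewrite tE; move: (_ / poisson _ _) => X HX.
set z := stieltjes2 f w / VN.
have hz : `|z - 1| <= eta.
  have -> : z - 1 = (stieltjes2 f w - VN) / VN by rewrite /z; field; rewrite gt_eqF.
  rewrite normrM normfV (gtr0_norm VN0); apply: le_trans ee.
  apply: ler_pM => //; first by rewrite invr_ge0 ltW.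
  by rewrite lef_pV2 ?posrE// divr_gt0.
have z0 : 0 <= z by rewrite divr_ge0 ?(ltW VN0)// (le_trans (ltW v0) vw).
have hs := le_trans (sqrt_sub1_le z0) hz.
have hX : `|X - 1| <= eta.
  apply: le_trans HX _.
  have -> : eta = eta / 2 + eta / 2 by field.
  apply: le_trans (lerD Cn Ce).
  have -> : C / Num.sqrt n.+1%:R + C * e =
      C * (1 + n.+1%:R * (e / Num.sqrt n.+1%:R)) / Num.sqrt n.+1%:R.
    have sE : n.+1%:R = Num.sqrt n.+1%:R ^+ 2 :> R by rewrite sqr_sqrtr ?ler0n.
    move: sN0 sE; move: (Num.sqrt _) => s s0 ->.
    by field; rewrite gt_eqF.
  by rewrite ler_pM2r ?invr_gt0// ler_wpM2l// lerD2l ler_wpM2l// ltW.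
move: (Num.sqrt z) hs => s hs.
have -> : X * s - 1 = (X - 1) * (s - 1) + (X - 1) + (s - 1) by ring.
rewrite (le_trans (ler_normD _ _))// (_ : 3 * eta = eta + eta + eta); last by ring.
rewrite lerD// (le_trans (ler_normD _ _))// lerD// normrM.
by rewrite (le_trans _ hs)// ler_piMl// (le_trans hX).
Qed.

End LocalUniformity.

(** * Asymptotics uniform near a given y *)

Section LocalLimit.
Variables (R : realType) (f : R -> R).
Hypothesis f_decr : {in `[0, 1]%R &, forall s t : R, s <= t -> f t <= f s}.
Variables (lambda : forall N : nat, N.-tuple int) (g : R[i] -> R[i]) (y0 w0 r : R).
Hypotheses (sig : forall N, is_signature (lambda N)) (y00 : y0 != 0)
  (w0y0 : is_w0 f y0 w0) (r0 : 0 < r).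
Hypothesis Q_cvg : forall e, 0 < e -> exists N1 : nat,
  forall N u, (N1 <= N)%N -> `|u - w0| < r ->
    Normc.normc (calQ f (lambda N) u%:C - g u%:C) <= e.
Hypothesis w0_out : \forall N \near \oo,
  w0 \notin `[(nth 0 (lambda N) N.-1)%:~R / N%:R,
              (nth 0 (lambda N) 0)%:~R / N%:R + 1].
Hypothesis g0 : g w0%:C != 0.
Implicit Types (u w y e : R).

Local Notation normc := Normc.normc.
Local Notation p N := (points R (lambda N)).

Lemma div_sqrt_small (C e : R) : 0 <= C -> 0 < e ->
  exists N1 : nat, forall N, (N1 <= N)%N -> C / Num.sqrt N%:R <= e.
Proof.
move=> C0 e0; have Ce : 0 <= C / e by rewrite divr_ge0// ltW.
exists (Num.bound ((C / e) ^+ 2)) => N NN.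
have : (C / e) ^+ 2 < N%:R.
  by rewrite (lt_le_trans (archi_boundP (sqr_ge0 _)))// ler_nat.
move=> H; have N0 : 0 < N%:R :> R by apply: le_lt_trans H; exact: sqr_ge0.
have s0 : 0 < Num.sqrt N%:R :> R by rewrite sqrtr_gt0.
rewrite ler_pdivrMr// mulrC -ler_pdivrMr//.
by rewrite -(ger0_norm Ce) -sqrtr_sqr ler_sqrt// ltW.
Qed.

(** The points lie on one side of w, but which one is not given. On the wrong side, the average of
    the 1/(w - mu_j/N) would have the sign opposite to y, while it is within e < |y| of y. *)
Lemma pos_of_means (n : nat) (l : n.+1.-tuple int) y w e :
  (forall j, w < points R l j) \/ (forall j, points R l j < w) ->
  side f w = Num.sg y -> stieltjes f w = y -> y != 0 -> e < `|y| ->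
  `|stieltjes f w - (\sum_j (w - points R l j)^-1) / n.+1%:R| <= e ->
  forall j, 0 < side f w * (w - points R l j).
Proof.
move=> sides sw -> yn0 ey H.
have e0 : 0 <= e by apply: le_trans H.
have N0 : 0 < n.+1%:R^-1 :> R by rewrite invr_gt0.
move: H; rewrite ler_distl => /andP[].
set S := \sum_j _; set q := S / _ => h1 h2.
have [yn|yp|yz] := ltgtP y 0; last by rewrite yz eqxx in yn0.
  rewrite sw ltr0_sg//; case: sides => hs j; first by rewrite mulN1r oppr_gt0 subr_lt0.
  exfalso; have : 0 <= q.
    by rewrite mulr_ge0 ?(ltW N0)// sumr_ge0// => i _; rewrite invr_ge0 subr_ge0 ltW.
  by move: ey; rewrite (ltr0_norm yn); lra.
rewrite sw gtr0_sg//; case: sides => hs j; last by rewrite mul1r subr_gt0.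
exfalso; have : q <= 0.
  by rewrite mulr_le0_ge0 ?(ltW N0)// sumr_le0// => i _; rewrite invr_le0 subr_le0 ltW.
by move: ey; rewrite (gtr0_norm yp); lra.
Qed.

Lemma normc_mul_sub1 (z : R[i]) (t a b : R) : normc (z - 1) <= a -> `|t - 1| <= b ->
  normc (z * t%:C - 1) <= a * (1 + b) + b.
Proof.
move=> za tb; have -> : z * t%:C - 1 = (z - 1) * t%:C + (t - 1)%:C.
  by rewrite [(t - 1)%:C]rmorphB/=; ring.
rewrite (le_trans (le_normcD _ _))// Normc.normcM !normc_real lerD//.
apply: ler_pM => //; first exact: normc_ge0.
by have := ler_normD (t - 1) 1; rewrite subrK normr1; lra.
Qed.

(** All bounds are established on a neighbourhood of w0, and [delta] keeps the root [w] of a nearby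
    y inside it; so [delta] and [N0] depend on y0 and [eps] alone. *)
Lemma local_limit (eps : R) : 0 < eps -> exists delta (N0 : nat), 0 < delta /\
  forall y w n, `|y - y0| < delta -> is_w0 f y w -> (N0 <= n.+1)%N ->
  exists2 Z : R[i], (schur_normalized (lambda n.+1) (expR y))%:C =
    main_term f g n.+1 y w * Z & normc (Z - 1) <= eps.
Proof.
move=> eps0; have [d w0d [sw0 Gw0]] := is_w0_gap f_decr y00 w0y0.
have d0 : 0 < d by case: w0d.
have [rho [K [c [N5 [rho0 c0 rr rd REG]]]]] :=
  calQ_regular f_decr sig w0d r0 Q_cvg w0_out g0.
have [v v0 Hv] := stieltjes2_ge f_decr w0d.
have v20 : 0 < v / 2 by rewrite divr_gt0.
have ir0 : 0 < rho^-1 by rewrite invr_gt0.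
have [C [N6 lim]] := hypo_local_limit ir0 v20.
(* The errors [eta] of Q/g and 3 [eta] of [tau] combine to 4 eta + 3 eta^2 <= 7 eta. *)
pose eta := Num.min 1 (eps / 7).
have eta0 : 0 < eta by rewrite lt_min ltr01 divr_gt0.
have eta1 : eta <= 1 by rewrite /eta ge_min lexx.
have eta7 : 7 * eta <= eps.
  by rewrite mulrC -ler_pdivlMr// /eta ge_min lexx orbT.
have C1 : 0 < `|C| + 1 by rewrite ltr_wpDl.
(* The first three bounds are those required by [tau_near1]; the last makes e < |y| for the nearby
   y, as [pos_of_means] requires. *)
pose e := Num.min (Num.min (v / 2) (eta * (v / 2)))
  (Num.min (eta / 2 / (`|C| + 1)) (`|y0| / 4)).
have e0 : 0 < e by rewrite !lt_min v20 mulr_gt0//= !divr_gt0// normr_gt0.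
have [ev ev' eC ey] : [/\ e <= v / 2, e <= eta * (v / 2),
    e <= eta / 2 / (`|C| + 1) & e <= `|y0| / 4].
  by rewrite /e; split; rewrite !ge_min lexx ?orbT.
have ee : e / (v / 2) <= eta by rewrite ler_pdivrMr.
have Ce : `|C| * e <= eta / 2.
  move: eC; rewrite ler_pdivlMr// mulrC mulrDl mul1r; lra.
have [N7 MV] := mean_variance_cvg f_decr (2 * K) rho0 e0.
have ec0 : 0 < eta * c by rewrite mulr_gt0.
have [N8 HQ] := Q_cvg ec0.
have eta20 : 0 < eta / 2 by rewrite divr_gt0.
have [N9 HN9] := div_sqrt_small (normr_ge0 C) eta20.
have rho20 : 0 < rho / 2 by rewrite divr_gt0.
have [delta delta0 near0] := is_w0_near f_decr y00 w0d sw0 Gw0 rho20.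
exists delta, (maxn (maxn N5 N6) (maxn (maxn N7 N8) N9)); split=> // y w n yd yw.
rewrite !geq_max => /andP[/andP[n5 n6] /andP[/andP[n7 n8] n9]].
have [yn0 sy ww yy] := near0 y w yd yw.
have wr : `|w - w0| <= rho by move: ww rho0; lra.
have [gc far sides _] := REG _ _ n5 wr.
have gw : gap f w (d / 2) by apply: gap_half w0d _; exact: le_trans wr rd.
have gr : gap f w rho by exact: gap_le gw rho0 rd.
have [_ _ [sw Gw]] := is_w0_gap f_decr yn0 yw.
(* The oscillation is known relative to w0; passing through w0 doubles it. *)
have osc h : `|h| <= rho / 2 ->
    `|log_ratio f (p n.+1) (w + h) - log_ratio f (p n.+1) w| <= 2 * K.
  move=> hr; have whr : `|w + h - w0| <= rho.
    have -> : w + h - w0 = (w - w0) + h by ring.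
    by rewrite (le_trans (ler_normD _ _))//; move: ww; lra.
  have [_ _ _ L1] := REG _ _ n5 whr; have [_ _ _ L2] := REG _ _ n5 wr.
  have := ler_distD (log_ratio f (p n.+1) w0) (log_ratio f (p n.+1) (w + h))
    (log_ratio f (p n.+1) w).
  by rewrite (distrC (log_ratio _ _ w0)); lra.
have [H1 H2] := MV n.+1 (p n.+1) w n7 isT gr far osc.
have s1 : 1 <= Num.sqrt n.+1%:R :> R by rewrite -[leLHS]sqrtr1 ler_sqrt// ler1n.
have pos : forall j, 0 < side f w * (w - p n.+1 j).
  apply: pos_of_means sides sw Gw yn0 _ H1.
  apply: (@le_lt_trans _ _ e).
    by rewrite ler_pdivrMr ?(lt_le_trans ltr01)// ler_peMr// ltW.
  have : 0 < `|y0| by rewrite normr_gt0.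
  by move: ey yy; lra.
have vw : v <= stieltjes2 f w by apply: Hv; exact: le_trans wr rd.
have ht : `|tau f (lambda n.+1) y w - 1| <= 3 * eta.
  apply: (tau_near1 _ v0 (normr_ge0 C) rho0 eta1 ev ee (HN9 _ n9) Ce sw Gw
    yn0 pos far vw H1 H2) => s t ps ss all_s sV t0.
  apply: le_trans (lim _ s t n6 ps ss all_s sV t0) _.
  have s0 : 0 < (Num.sqrt n.+1%:R)^-1 :> R by rewrite invr_gt0 (lt_le_trans ltr01).
  rewrite (ler_pM2r s0); apply: ler_wpM2r (ler_norm C).
  by apply: addr_ge0 => //; apply: mulr_ge0.
have gn0 : g w%:C != 0.
  by apply: contraTneq gc => ->; rewrite normc_real normr0 -ltNge.
exists ((calQ_re f (lambda n.+1) w)%:C / g w%:C * (tau f (lambda n.+1) y w)%:C).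
  by apply: (schur_main_term f_decr (@sig _) yn0 gr sw pos gn0); exact: lt_le_trans vw.
have hq : normc ((calQ_re f (lambda n.+1) w)%:C / g w%:C - 1) <= eta.
  have wlt : `|w - w0| < r by exact: le_lt_trans wr rr.
  have := HQ _ w n8 wlt; rewrite (calQ_real f_decr _ gw) => H.
  have -> : (calQ_re f (lambda n.+1) w)%:C / g w%:C - 1 =
      ((calQ_re f (lambda n.+1) w)%:C - g w%:C) / g w%:C by field.
  rewrite Normc.normcM Normc.normcV ler_pdivrMr ?(lt_le_trans c0)//.
  by apply: le_trans H _; rewrite ler_wpM2l// ltW.
apply: le_trans (normc_mul_sub1 hq ht) _; apply: le_trans eta7.
have : eta * eta <= eta by rewrite ler_piMr// ltW.
rewrite mulrDr mulr1 mulrCA; lra.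
Qed.

End LocalLimit.

(** * Uniform convergence in terms of the modulus *)

Section UniformConvergence.
Variable R : realType.
Implicit Types (e : R) (z : R[i]).
Local Notation normc := Normc.normc.

Lemma ltc_norm z e : (`|z| < e%:C) = (normc z < e).
Proof. by rewrite normc_def ltcE/= eqxx/=; case: z. Qed.

Lemma uniform_cvg_normc (M : set R[i]) (F : nat -> R[i] -> R[i]) (g : R[i] -> R[i]) :
  {uniform M, F @ \oo --> g} -> forall e, 0 < e -> exists N1 : nat,
    forall N z, (N1 <= N)%N -> M z -> normc (F N z - g z) <= e.
Proof.
move=> H e e0; have e0C : 0 < e%:C by rewrite ltcE /= eqxx.
have /H : nbhs (g : {uniform` M -> _})
    [set h : {uniform` M -> R[i]} | forall u, M u -> ball (g u) e%:C (h u)].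
  apply/uniform_nbhs; exists [set xy | ball xy.1 e%:C xy.2]; split => //.
  exact: entourage_ball (PosNum e0C).
move=> [N1 _ HN]; exists N1 => N z /HN/= /(_ z) + Mz => /(_ Mz).
by rewrite -ball_normE /= ltc_norm => /ltW; rewrite -normc_opp opprB.
Qed.

Lemma normc_uniform_cvg0 (K : set R) (F : nat -> R -> R[i]) :
  (forall e, 0 < e -> \forall N \near \oo, forall y, K y -> normc (F N y) <= e) ->
  {uniform K, F @ \oo --> (fun=> 0 : R[i])}.
Proof.
move=> H P /uniform_nbhs[E [entE EP]].
move: entE; rewrite -entourage_ballE => -[e /= e0 Ee].
have eE : e = (complex.Re e)%:C by rewrite RRe_real// gtr0_real.
have e0' : 0 < complex.Re e by move: e0; rewrite ltcE => /andP[].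
have e2 : 0 < complex.Re e / 2 by rewrite divr_gt0.
apply: filterS (H _ e2) => N HN; apply: EP => y Ky; apply: Ee.
rewrite -ball_normE /= sub0r normrN eE ltc_norm (le_lt_trans (HN y Ky))//.
by rewrite ltr_pdivrMr// ltr_pMr// ltr1n.
Qed.

Lemma open_real_nbhs (M : set R[i]) (x : R) : open M -> M x%:C ->
  exists2 r, 0 < r & forall u, `|u - x| < r -> M u%:C.
Proof.
move=> Mo Mx.
have /nbhs_ballP[e /= e0 He] : nbhs x%:C M by apply: open_nbhs_nbhs.
have eE : e = (complex.Re e)%:C by rewrite RRe_real// gtr0_real.
exists (complex.Re e); first by move: e0; rewrite ltcE => /andP[].
move=> u ux; apply: He; rewrite -ball_normE /= eE ltc_norm.
by rewrite -[x%:C - _](rmorphB (real_complex R)) normc_real distrC.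
Qed.

Lemma main_term_neq0 (f : R -> R) (g : R[i] -> R[i]) N (y w : R) : y != 0 ->
  g w%:C != 0 -> calF'' f w%:C != 0 -> main_term f g N y w != 0.
Proof.
move=> y0 g0 F0; rewrite /main_term /sqrt_opp_calF''.
have real_neq0 (x : R) : x != 0 -> x%:C != 0 by move=> x0; rewrite fmorph_eq0.
have a0 : (Num.sg y)%:C * sqrtC (- calF'' f w%:C) != 0.
  by apply: mulf_neq0; rewrite ?sqrtC_eq0 ?oppr_eq0// real_neq0// sgr_eq0.
have b0 : (expR N%:R * (expR y - 1) ^+ N.-1)%:C != 0.
  apply/real_neq0/mulf_neq0; first by rewrite gt_eqF// expR_gt0.
  exact/expf_neq0/expR_sub1_neq0.
by apply: mulf_neq0; apply: mulf_neq0; rewrite ?invr_eq0 ?expc_neq0.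
Qed.

End UniformConvergence.

(** * From local to compact uniformity *)

Theorem proposition4p2 (R : realType) (lambda : forall N : nat, N.-tuple int)
    (f : R -> R) (M : set R[i]) (g : R[i] -> R[i])
    (lambda_sig : forall N : nat, is_signature (lambda N))
    (f_decr : {in `[0, 1]%R &, forall s t : R, s <= t -> f t <= f s})
    (M_open : open M)
    (Q_cvg : {uniform M, (fun N : nat => calQ f (lambda N)) @ \oo --> g}) :
  (forall y w0 : R, admissible lambda f M g y w0 ->
     exists r : nat -> R[i],
       (forall N : nat, (0 < N)%N ->
          (schur_normalized (lambda N) (expR y))%:C =
          main_term f g N y w0 * (1 + r N)) /\
       r @ \oo --> (0 : R[i])) /\
  (forall (K : set R) (w0 : R -> R), compact K ->
     (forall y : R, K y -> admissible lambda f M g y (w0 y)) ->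
     exists r : nat -> R -> R[i],
       (forall (N : nat) (y : R), (0 < N)%N -> K y ->
          (schur_normalized (lambda N) (expR y))%:C =
          main_term f g N y (w0 y) * (1 + r N y)) /\
       {uniform K, r @ \oo --> (fun=> 0 : R[i])}).
Proof.
pose rem N y w : R[i] :=
  (schur_normalized (lambda N) (expR y))%:C / main_term f g N y w - 1.
have remE N y w : admissible lambda f M g y w ->
    (schur_normalized (lambda N) (expR y))%:C = main_term f g N y w * (1 + rem N y w).
  move=> [[y0 _] _ _ g0 F0]; rewrite /rem addrC subrK mulrC divfK//.
  exact: main_term_neq0.
(* The estimate covers every admissible pair near y at once, which gives both the pointwise and the
   uniform claim. *)
have local y w : admissible lambda f M g y w -> forall eps, 0 < eps ->
    exists delta (N0 : nat), 0 < delta /\ forall y' w' N, `|y' - y| < delta ->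
      admissible lambda f M g y' w' -> (N0 <= N)%N ->
      Normc.normc (rem N y' w') <= eps.
  move=> [[y0 wy] out Mw gw Fw] eps eps0.
  have [r r0 rM] := open_real_nbhs M_open Mw.
  have Q_cvg_real e : 0 < e -> exists N1 : nat, forall N u, (N1 <= N)%N ->
      `|u - w| < r -> Normc.normc (calQ f (lambda N) u%:C - g u%:C) <= e.
    move=> /(uniform_cvg_normc Q_cvg)[N1 HN1].
    by exists N1 => N u NN /rM; exact: HN1.
  have [delta [N0 [delta0 H]]] :=
    local_limit f_decr lambda_sig y0 wy r0 Q_cvg_real out gw eps0.
  exists delta, (maxn N0 1); split=> // y' w' [|n] yd; first by rewrite geq_max ltn0 andbF.
  move=> [[y0' wy'] _ _ gw' Fw']; rewrite geq_max => /andP[n0 _].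
  have [Z ZE Z1] := H y' w' n yd wy' n0.
  by rewrite /rem ZE mulrAC mulfV ?mul1r//; exact: main_term_neq0.
have part2 (K : set R) (w0 : R -> R) : compact K ->
    (forall y : R, K y -> admissible lambda f M g y (w0 y)) ->
    {uniform K, (fun N y => rem N y (w0 y)) @ \oo --> (fun=> 0 : R[i])}.
  (* Since [local] applies to any root of any nearby [y'], the covering argument works for the given
     selection [w0] as it stands. *)
  move=> /compact_near_coveringP K_cov adm; apply: normc_uniform_cvg0 => eps eps0.
  pose P N y := K y -> Normc.normc (rem N y (w0 y)) <= eps.
  have [] := K_cov nat \oo P _; last first.
    by move=> N0 _ H; exists N0 => // N /H KP y Ky; exact: KP.
  move=> y Ky; have [delta [N0 [delta0 H]]] := local y (w0 y) (adm y Ky) eps eps0.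
  exists ([set y' | `|y' - y| < delta], [set N | (N0 <= N)%N]).
    split; last by exists N0.
    by exists delta => //= y' /=; rewrite distrC.
  by move=> [y' N] /= [yd NN] Ky'; exact: H yd (adm y' Ky') NN.
split=> [y w0 adm|K w0 Kc adm].
  exists (fun N => rem N y w0); split; first by move=> N _; exact: remE.
  apply/cvgrPdist_le => /= e e0.
  have eE : e = (complex.Re e)%:C by rewrite RRe_real// gtr0_real.
  have e0' : 0 < complex.Re e by move: e0; rewrite ltcE => /andP[].
  have [delta [N0 [delta0 H]]] := local y w0 adm _ e0'.
  exists N0 => // N /= NN; rewrite sub0r normrN eE normc_def lecE/= eqxx/=.
  have := H y w0 N _ adm NN; rewrite subrr normr0 => /(_ delta0).
  by case: (rem _ _ _).
exists (fun N y => rem N y (w0 y)); split; last exact: part2.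
by move=> N y _ Ky; apply: remE; exact: adm.
Qed.
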